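(* $\mathrm{ATR}_0$ implies Martin's pointed tree theorem $\mathrm{MPT}$; that is, $\mathrm{ATR}_0\vdash \mathrm{MPT}$.
   Context: All theories are in the language of second order arithmetic, with models $(N,M,0,1,+,\times,<)$, where $N$ is the number sort and $M$ is the sort of sets of numbers (equivalently, up to coding, functions from numbers to numbers, called reals). $\mathrm{ATR}_0$ is the usual system of arithmetical transfinite recursion. $\leq_{\rm T}$ denotes Turing reducibility. A tree $T\subseteq\omega^{<\omega}$ is a set of finite strings closed under initial segments; $[T]$ is the collection of its infinite paths. A perfect tree is a nonempty tree in which every node has two incompatible extensions in the tree. A set $A$ of reals is cofinal if for every real $x$ there is some $y\in A$ with $y\geq_{\rm T} x$. A pointed tree $T$ is a perfect tree such that $T\leq_{\rm T} x$ for every infinite path $x\in[T]$. Martin's pointed tree theorem, $\mathrm{MPT}$, is the statement (formulated in second order arithmetic): for every tree $T\subseteq\omega^{<\omega}$, if $[T]$ is cofinal, then $T$ has a pointed subtree. *)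

(* Defs.v *)
From Stdlib Require Import List.
Import ListNotations.

(** * The two-sorted language of second order arithmetic

    De Bruijn syntax with two independent families of indices: number variables
    are bound by [ForallN], set variables by [ForallS].  Equality is primitive for
    numbers only; sets have no term constructors besides variables. *)

Inductive term : Type :=
| Var  (n : nat)
| Zero
| One
| AddN  (s t : term)
| MulN  (s t : term).

Inductive form : Type :=
| EqN   (s t : term)
| LtN   (s t : term)
| Mem  (t : term) (X : nat)
| Bot
| Imp  (p q : form)
| ForallN (p : form)
| ForallS (p : form).

Definition Neg (p : form) : form := Imp p Bot.

Fixpoint tsubst (s : nat -> term) (t : term) : term :=
  match t with
  | Var n => s n
  | Zero => Zero
  | One => One
  | AddN u v => AddN (tsubst s u) (tsubst s v)
  | MulN u v => MulN (tsubst s u) (tsubst s v)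
  end.

Definition scons {A : Type} (a : A) (s : nat -> A) (n : nat) : A :=
  match n with 0 => a | S k => s k end.

Definition upN (s : nat -> term) : nat -> term :=
  scons (Var 0) (fun n => tsubst (fun k => Var (S k)) (s n)).

Definition upS (r : nat -> nat) : nat -> nat :=
  scons 0 (fun n => S (r n)).

(** Simultaneous capture-avoiding substitution of terms for number variables
    and renaming of set variables. *)
Fixpoint fsubst (s : nat -> term) (r : nat -> nat) (p : form) : form :=
  match p with
  | EqN u v => EqN (tsubst s u) (tsubst s v)
  | LtN u v => LtN (tsubst s u) (tsubst s v)
  | Mem t X => Mem (tsubst s t) (r X)
  | Bot => Bot
  | Imp p q => Imp (fsubst s r p) (fsubst s r q)
  | ForallN p => ForallN (fsubst (upN s) r p)
  | ForallS p => ForallS (fsubst s (upS r) p)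
  end.

Definition shiftN : form -> form := fsubst (fun n => Var (S n)) (fun n => n).
Definition shiftS : form -> form := fsubst Var S.
Definition instN (t : term) : form -> form := fsubst (scons t Var) (fun n => n).
Definition instS (X : nat) : form -> form := fsubst Var (scons X (fun n => n)).

(** Classical natural deduction for two-sorted first order logic with equality
    on the number sort.  Since an axiom of [Th] may be used under any context,
    in particular above [prv_AllNI] and [prv_AllSI], its free variables act as
    if universally quantified: a theory is the set of universal closures of
    its axioms. *)

Inductive prv (Th : form -> Prop) : list form -> form -> Prop :=
| prv_Ax G p : Th p -> prv Th G p
| prv_Hyp G p : In p G -> prv Th G p
| prv_ImpI G p q : prv Th (p :: G) q -> prv Th G (Imp p q)
| prv_ImpE G p q : prv Th G (Imp p q) -> prv Th G p -> prv Th G q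
| prv_Contra G p : prv Th (Neg p :: G) Bot -> prv Th G p
| prv_AllNI G p : prv Th (map shiftN G) p -> prv Th G (ForallN p)
| prv_AllNE G p t : prv Th G (ForallN p) -> prv Th G (instN t p)
| prv_AllSI G p : prv Th (map shiftS G) p -> prv Th G (ForallS p)
| prv_AllSE G p X : prv Th G (ForallS p) -> prv Th G (instS X p)
| prv_EqRefl G t : prv Th G (EqN t t)
| prv_EqSubst G p s t :
    prv Th G (EqN s t) -> prv Th G (instN s p) -> prv Th G (instN t p).

Definition provable (Th : form -> Prop) (p : form) : Prop := prv Th [] p.

Notation "Th ⊢ p" := (provable Th p) (at level 70, no associativity).

(** * Writing formulas with named bound variables

    A [bform] is a formula awaiting the number of number quantifiers and of set
    quantifiers it lies under; a variable bound under [n] quantifiers of its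
    sort has index [k - S n] at depth [k].  This lets Rocq binders stand for
    object-level binders while [build] produces plain De Bruijn formulas. *)

Definition bnum : Type := nat -> term.
Definition bset : Type := nat -> nat.
Definition bform : Type := nat -> nat -> form.

Definition build (p : bform) : form := p 0 0.

Declare Scope bnum_scope.
Delimit Scope bnum_scope with bnum.
Bind Scope bnum_scope with bnum.
Declare Scope bform_scope.
Delimit Scope bform_scope with bform.
Bind Scope bform_scope with bform.

Fixpoint numeral (n : nat) : term :=
  match n with
  | 0 => Zero
  | 1 => One
  | S k => AddN (numeral k) One
  end.

Definition bnumeral (n : nat) : bnum := fun _ => numeral n.
Definition badd (x y : bnum) : bnum := fun k => AddN (x k) (y k).
Definition bmul (x y : bnum) : bnum := fun k => MulN (x k) (y k).

Definition beq (x y : bnum) : bform := fun k _ => EqN (x k) (y k).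
Definition blt (x y : bnum) : bform := fun k _ => LtN (x k) (y k).
Definition bmem (x : bnum) (X : bset) : bform := fun k m => Mem (x k) (X m).
Definition bimp (p q : bform) : bform := fun k m => Imp (p k m) (q k m).
Definition bneg (p : bform) : bform := fun k m => Neg (p k m).
Definition ballN (f : bnum -> bform) : bform :=
  fun n m => ForallN (f (fun k => Var (k - S n)) (S n) m).
Definition ballS (f : bset -> bform) : bform :=
  fun n m => ForallS (f (fun k => k - S m) n (S m)).

Definition band (p q : bform) : bform := bneg (bimp p (bneg q)).
Definition bor (p q : bform) : bform := bimp (bneg p) q.
Definition biff (p q : bform) : bform := band (bimp p q) (bimp q p).
Definition bexN (f : bnum -> bform) : bform := bneg (ballN (fun x => bneg (f x))).
Definition bexS (f : bset -> bform) : bform := bneg (ballS (fun X => bneg (f X))).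

(** [bpair x y] is the code [(x + y)^2 + x] of the pair [(x, y)]; it is
    injective but not surjective. *)
Definition bpair (x y : bnum) : bnum :=
  badd (bmul (badd x y) (badd x y)) x.

Notation "# n" := (bnumeral n) (at level 1, n at level 0, format "# n") : bnum_scope.
Notation "x + y" := (badd x y) : bnum_scope.
Notation "x * y" := (bmul x y) : bnum_scope.
Notation "⟨ x , .. , y , z ⟩" := (bpair x .. (bpair y z) ..) : bnum_scope.

Notation "x == y" := (beq x y) (at level 70, no associativity) : bform_scope.
Notation "x < y" := (blt x y) : bform_scope.
Notation "x ∈ X" := (bmem x X) (at level 70, no associativity) : bform_scope.
Notation "p --> q" := (bimp p q) (at level 90, right associativity) : bform_scope.
Notation "p <--> q" := (biff p q) (at level 95, no associativity) : bform_scope.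
Notation "p /\ q" := (band p q) : bform_scope.
Notation "p \/ q" := (bor p q) : bform_scope.
Notation "~ p" := (bneg p) : bform_scope.
Notation "'allN' x .. y , p" :=
  (ballN (fun x => .. (ballN (fun y => p%bform)) ..))
  (at level 200, x binder, y binder, right associativity) : bform_scope.
Notation "'exN' x .. y , p" :=
  (bexN (fun x => .. (bexN (fun y => p%bform)) ..))
  (at level 200, x binder, y binder, right associativity) : bform_scope.
Notation "'allS' X .. Y , p" :=
  (ballS (fun X => .. (ballS (fun Y => p%bform)) ..))
  (at level 200, X binder, Y binder, right associativity) : bform_scope.
Notation "'exS' X .. Y , p" :=
  (bexS (fun X => .. (bexS (fun Y => p%bform)) ..))
  (at level 200, X binder, Y binder, right associativity) : bform_scope.

Local Open Scope bform_scope.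

(** [embN p x] is [p(x)], where [x] replaces number variable 0; in
    [embNS p x X] moreover [X] replaces set variable 0.  The other free
    variables of [p] are parameters and escape all surrounding quantifiers. *)
Definition embN (p : form) (x : bnum) : bform :=
  fun k m => fsubst (scons (x k) (fun i => Var (Nat.add i k)))
                    (fun i => Nat.add i m) p.
Definition embNS (p : form) (x : bnum) (X : bset) : bform :=
  fun k m => fsubst (scons (x k) (fun i => Var (Nat.add i k)))
                    (scons (X m) (fun i => Nat.add i m)) p.

Fixpoint arithmetical (p : form) : Prop :=
  match p with
  | EqN _ _ | LtN _ _ | Mem _ _ | Bot => True
  | Imp p q => arithmetical p /\ arithmetical q
  | ForallN p => arithmetical p
  | ForallS _ => False
  end.

Definition comprehension (p : form) : bform :=
  exS X, allN x, x ∈ X <--> embN p x.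

(** A linear order is coded as its reflexive relation [X]: [i <=_X j] is
    [⟨i, j⟩ ∈ X], and the field of [X] is the set of [i] with [i <=_X i]. *)
Definition in_field (i : bnum) (X : bset) : bform := bpair i i ∈ X.
Definition lt_in (X : bset) (i j : bnum) : bform :=
  bpair i j ∈ X /\ ~ bpair j i ∈ X.

Definition LO (X : bset) : bform :=
  (allN i j, bpair i j ∈ X --> in_field i X /\ in_field j X)
  /\ (allN i j k, bpair i j ∈ X /\ bpair j k ∈ X --> bpair i k ∈ X)
  /\ (allN i j, bpair i j ∈ X /\ bpair j i ∈ X --> i == j)
  /\ (allN i j, in_field i X /\ in_field j X --> bpair i j ∈ X \/ bpair j i ∈ X).

(** [F] is (the graph of) a function from numbers to numbers. *)
Definition Fun (F : bset) : bform :=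
  (allN c, c ∈ F --> exN x y, c == bpair x y)
  /\ (allN x, exN y, bpair x y ∈ F)
  /\ (allN x y z, bpair x y ∈ F /\ bpair x z ∈ F --> y == z).

Definition WF (X : bset) : bform :=
  ~ exS F, Fun F /\ allN n x y,
      bpair n x ∈ F /\ bpair (n + #1) y ∈ F --> lt_in X y x.

Definition WO (X : bset) : bform := LO X /\ WF X.

(** [Z = Y^j], i.e. [Z = {⟨m, i⟩ ∈ Y : i <_X j}]. *)
Definition below (X Y : bset) (j : bnum) (Z : bset) : bform :=
  allN c, c ∈ Z <--> (exN m i, c == bpair m i /\ lt_in X i j /\ c ∈ Y).

(** [Y = {⟨n, j⟩ : j ∈ field X, theta(n, Y^j)}].  Since [Y^j] is not a set
    variable it is named by [Z], which exists by arithmetical comprehension. *)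
Definition ATR_H (theta : form) (X Y : bset) : bform :=
  LO X /\
  allN c, c ∈ Y <-->
    (exN n j, c == bpair n j /\ in_field j X /\
       exS Z, below X Y j Z /\ embNS theta n Z).

Definition transfinite_recursion (theta : form) : bform :=
  allS X, WO X --> exS Y, ATR_H theta X Y.

Inductive ATR0 : form -> Prop :=
| ax_succ_nz : ATR0 (build (allN n, ~ n + #1 == #0))
| ax_succ_inj : ATR0 (build (allN m n, m + #1 == n + #1 --> m == n))
| ax_add_0 : ATR0 (build (allN m, m + #0 == m))
| ax_add_S : ATR0 (build (allN m n, m + (n + #1) == (m + n) + #1))
| ax_mul_0 : ATR0 (build (allN m, m * #0 == #0))
| ax_mul_S : ATR0 (build (allN m n, m * (n + #1) == m * n + m))
| ax_lt_0 : ATR0 (build (allN m, ~ m < #0))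
| ax_lt_S : ATR0 (build (allN m n, m < n + #1 <--> m < n \/ m == n))
| ax_ind : ATR0 (build (allS X,
    #0 ∈ X /\ (allN n, n ∈ X --> n + #1 ∈ X) --> allN n, n ∈ X))
| ax_ACA p : arithmetical p -> ATR0 (build (comprehension p))
| ax_ATR p : arithmetical p -> ATR0 (build (transfinite_recursion p)).

(** [y] is Gödel's [beta(a, b, i)], the remainder of [a] modulo [1 + (i+1) b]. *)
Definition beta (a b i y : bnum) : bform :=
  y < #1 + (i + #1) * b /\ exN q, a == q * (#1 + (i + #1) * b) + y.

(** [⟨l, a, b⟩] represents the sequence of length [l] with [i]-th entry
    [beta(a, b, i)]. *)
Definition len (s l : bnum) : bform := exN a b, s == ⟨l, a, b⟩.
Definition entry (s i x : bnum) : bform :=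
  exN l a b, s == ⟨l, a, b⟩ /\ i < l /\ beta a b i x.

Definition same_seq (s t : bnum) : bform :=
  (allN l, len s l <--> len t l) /\ (allN i x, entry s i x <--> entry t i x).

(** The code of a sequence is its least representative, so that distinct codes
    stand for distinct sequences. *)
Definition Seq (s : bnum) : bform :=
  (exN l, len s l) /\ ~ exN t, t < s /\ same_seq s t.

Definition initial (s t : bnum) : bform :=
  Seq s /\ Seq t
  /\ (exN l k, len s l /\ len t k /\ (l < k \/ l == k))
  /\ (allN i x, entry s i x --> entry t i x).

(** [computes Y e x y] says that [{e}^Y(x) = y] for the following indexing of
    the unary functions partial recursive in [Y]:

    - [⟨0,0⟩]: [x |-> x];
    - [⟨0,1⟩]: [x |-> 0];
    - [⟨0,2⟩]: [x |-> x + 1];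
    - [⟨0,3⟩], [⟨0,4⟩]: the projections of pairs;
    - [⟨0,5⟩]: the characteristic function of [Y];
    - [⟨1,f,g⟩]: [x |-> ⟨f(x), g(x)⟩];
    - [⟨2,f,g⟩]: [x |-> f(g(x))];
    - [⟨3,f,g⟩]: the [h] with [h⟨a,0⟩ = f(a)] and
      [h⟨a,m+1⟩ = g⟨a,m,h⟨a,m⟩⟩];
    - [⟨4,f⟩]: [x |-> mu y. f⟨x,y⟩ = 0].

    A computation is a finite sequence [d] of triples [⟨e,x,y⟩], each of
    which follows from earlier ones by one of these clauses. *)

Definition earlier (d i e x y : bnum) : bform :=
  exN j, j < i /\ entry d j ⟨e, x, y⟩.

Definition justified (Y : bset) (d i e x y : bnum) : bform :=
  (e == ⟨#0, #0⟩ /\ y == x)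
  \/ (e == ⟨#0, #1⟩ /\ y == #0)
  \/ (e == ⟨#0, #2⟩ /\ y == x + #1)
  \/ (e == ⟨#0, #3⟩ /\ exN z, x == ⟨y, z⟩)
  \/ (e == ⟨#0, #4⟩ /\ exN z, x == ⟨z, y⟩)
  \/ (e == ⟨#0, #5⟩ /\ ((x ∈ Y /\ y == #1) \/ (~ x ∈ Y /\ y == #0)))
  \/ (exN f g, e == ⟨#1, f, g⟩ /\ exN u v,
        earlier d i f x u /\ earlier d i g x v /\ y == ⟨u, v⟩)
  \/ (exN f g, e == ⟨#2, f, g⟩ /\ exN u,
        earlier d i g x u /\ earlier d i f u y)
  \/ (exN f g, e == ⟨#3, f, g⟩ /\ exN a,
        (x == ⟨a, #0⟩ /\ earlier d i f a y)
        \/ (exN m u, x == ⟨a, m + #1⟩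
              /\ earlier d i e ⟨a, m⟩ u /\ earlier d i g ⟨a, m, u⟩ y))
  \/ (exN f, e == ⟨#4, f⟩
        /\ earlier d i f ⟨x, y⟩ #0
        /\ allN z, z < y --> exN w, earlier d i f ⟨x, z⟩ (w + #1)).

Definition computes (Y : bset) (e x y : bnum) : bform :=
  exN d, Seq d
    /\ (allN i c, entry d i c --> exN e' x' y', c == ⟨e', x', y'⟩
          /\ justified Y d i e' x' y')
    /\ (exN i, entry d i ⟨e, x, y⟩).

(** [X <=_T Y]: the characteristic function of [X] is total recursive in [Y]. *)
Definition leT (X Y : bset) : bform :=
  exN e, allN x, (x ∈ X --> computes Y e x #1) /\ (~ x ∈ X --> computes Y e x #0).

(** Reals are sets; an infinite path is a function, given as a real by its
    graph. *)

Definition Tree (T : bset) : bform :=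
  (allN s, s ∈ T --> Seq s) /\ (allN s t, s ∈ T /\ initial t s --> t ∈ T).

(** [F ∈ [T]]: every finite initial segment of the function [F] is in [T]. *)
Definition Path (F T : bset) : bform :=
  Fun F /\ allN n, exN s, s ∈ T /\ len s n
    /\ allN i x, entry s i x --> bpair i x ∈ F.

Definition subset (S T : bset) : bform := allN s, s ∈ S --> s ∈ T.

Definition Perfect (T : bset) : bform :=
  Tree T /\ (exN s, s ∈ T)
  /\ allN s, s ∈ T --> exN t u, t ∈ T /\ u ∈ T
       /\ initial s t /\ initial s u /\ ~ initial t u /\ ~ initial u t.

Definition Pointed (T : bset) : bform :=
  Perfect T /\ allS F, Path F T --> leT T F.

Definition CofinalPaths (T : bset) : bform :=
  allS X, exS F, Path F T /\ leT X F.

Definition MPT : form :=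
  build (allS T, Tree T /\ CofinalPaths T --> exS S, subset S T /\ Pointed S).

(* Main.v *)
(** By the completeness theorem it suffices to prove the statement in an
    arbitrary, possibly nonstandard, model of [ATR0].

    Consider the game in which the closed player first names an index [e] and
    then builds a path through [T]: in position [s] the opponent names a bit
    [b], and the player must answer with the shortest extension [t] of [s] in
    [T] such that [{e}^t(⟨e, s⟩) = b].  The finite parts of strategies for the
    player form a tree.

    If this tree has an infinite path, the player has a winning strategy, given
    as a map [phi] from finite bit sequences to [T].  Fix a real [A] coding
    [phi], and let the opponent play the bits of [A] at even moves and arbitrary
    bits at odd moves.  The answers form a perfect tree.  A path [F] through it
    finds the positions on it, hence the bits played, by running [e]; so it
    computes [A], hence [phi] and the tree.

    Otherwise the Kleene-Brouwer order [L] of the tree of partial strategies is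
    a well-order, and arithmetical transfinite recursion along [L] yields the
    ranks of the positions won by the opponent.  Every initial position has a
    rank, for otherwise partial strategies avoiding the ranked positions could
    be extended so as to contradict the well-foundedness of [L].  The ranks
    define a strategy [tau] for the opponent.  If [F] is a path computing [tau]
    with index [e], the player may name [e] and follow [F], always having a
    legal answer, while the ranks descend: contradiction. *)

From Stdlib Require Import List Lia PeanoNat Cantor Ring Classical ClassicalEpsilon
  FunctionalExtensionality PropExtensionality ProofIrrelevance.
Require Import Defs.
Import ListNotations.

(** The question put to the index is [⟨e, s⟩], which makes the game diagonal: a strategy of the
    opponent is a real [tau] listing bits at such pairs, so a path that computes [tau] by [e] meets
    every challenge of [tau] simply by being followed. Read the other way, whoever plays against a
    strategy of the player dictates values of [{e}] along the resulting path, and this is how a real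
    is coded into all paths at once. The answer is the first place where [e] gives either bit; a
    path can therefore locate it without knowing which bit was asked.

    Comprehension does not yield the set of positions won by the opponent, because the length of the
    induction defining it is not known beforehand. The Kleene-Brouwer order serves as that length:
    answering one more position moves a partial strategy down in [L].

    Models may be nonstandard. Every induction, minimum or recursion inside one needs an
    arithmetical definition of its predicate ([Def]), and every reduction needs one index valid for
    all arguments ([Rec]). *)

(** * Substitution calculus for the two-sorted syntax *)

Lemma tsubst_comp s s' t :
  tsubst s (tsubst s' t) = tsubst (fun n => tsubst s (s' n)) t.
Proof. induction t; simpl; congruence. Qed.

Lemma tsubst_id t : tsubst Var t = t.
Proof. induction t; simpl; congruence. Qed.

Lemma upN_id : upN Var = Var.
Proof. extensionality n; destruct n; reflexivity. Qed.

Lemma upS_id : upS (fun n => n) = fun n => n.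
Proof. extensionality n; destruct n; reflexivity. Qed.

Lemma upN_comp s s' :
  (fun n => tsubst (upN s) (upN s' n)) = upN (fun n => tsubst s (s' n)).
Proof.
  extensionality n; destruct n; simpl; [reflexivity|].
  unfold upN; simpl. rewrite !tsubst_comp. reflexivity.
Qed.

Lemma upS_comp r r' : (fun n => upS r (upS r' n)) = upS (fun n => r (r' n)).
Proof. extensionality n; destruct n; reflexivity. Qed.

Lemma fsubst_id p : fsubst Var (fun n => n) p = p.
Proof.
  induction p; simpl; rewrite ?tsubst_id, ?upN_id, ?upS_id; congruence.
Qed.

Lemma fsubst_comp p : forall s r s' r',
  fsubst s r (fsubst s' r' p) = fsubst (fun n => tsubst s (s' n)) (fun n => r (r' n)) p.
Proof.
  induction p; intros; simpl; rewrite ?tsubst_comp, ?IHp, ?IHp1, ?IHp2,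
    ?upN_comp, ?upS_comp; reflexivity.
Qed.

Lemma fsubst_instN s r t p :
  fsubst s r (instN t p) = instN (tsubst s t) (fsubst (upN s) r p).
Proof.
  unfold instN. rewrite !fsubst_comp. f_equal. extensionality n.
  destruct n; simpl; [reflexivity|]. rewrite tsubst_comp, tsubst_id. reflexivity.
Qed.

Lemma fsubst_instS s r X p :
  fsubst s r (instS X p) = instS (r X) (fsubst s (upS r) p).
Proof.
  unfold instS. rewrite !fsubst_comp. f_equal.
  - extensionality n. simpl. rewrite tsubst_id. reflexivity.
  - extensionality n. destruct n; reflexivity.
Qed.

Lemma fsubst_shiftN s r p : fsubst (upN s) r (shiftN p) = shiftN (fsubst s r p).
Proof. unfold shiftN. rewrite !fsubst_comp. reflexivity. Qed.

Lemma fsubst_shiftS s r p : fsubst s (upS r) (shiftS p) = shiftS (fsubst s r p).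
Proof.
  unfold shiftS. rewrite !fsubst_comp. f_equal.
  extensionality n. simpl. rewrite tsubst_id. reflexivity.
Qed.

(** * Free variables *)

Fixpoint tbound (n : nat) (t : term) : Prop :=
  match t with
  | Var i => i < n
  | Zero | One => True
  | AddN u v | MulN u v => tbound n u /\ tbound n v
  end.

Fixpoint fbound (n m : nat) (p : form) : Prop :=
  match p with
  | EqN u v | LtN u v => tbound n u /\ tbound n v
  | Mem t X => tbound n t /\ X < m
  | Bot => True
  | Imp p q => fbound n m p /\ fbound n m q
  | ForallN p => fbound (S n) m p
  | ForallS p => fbound n (S m) p
  end.

Lemma tbound_mono t : forall n n', n <= n' -> tbound n t -> tbound n' t.
Proof. induction t; simpl; intuition eauto; lia. Qed.

Lemma fbound_mono p : forall n m n' m',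
  n <= n' -> m <= m' -> fbound n m p -> fbound n' m' p.
Proof.
  induction p; simpl; intros; intuition eauto using tbound_mono; try lia.
  - eapply (IHp (S n)); [| |eassumption]; lia.
  - eapply (IHp n (S m)); [| |eassumption]; lia.
Qed.

Lemma tbound_ex t : exists n, tbound n t.
Proof.
  induction t as [n| | |s [a IHs] t [b IHt]|s [a IHs] t [b IHt]]; simpl;
    try (exists 0; tauto); [exists (S n); lia| |];
    exists (a + b); split; (eapply tbound_mono; [|eassumption]); lia.
Qed.

Lemma fbound_ex p : exists n, fbound n n p.
Proof.
  induction p as [s t|s t|t X| |p [a IHp] q [b IHq]|p [a IHp]|p [a IHp]]; simpl.
  1-2: destruct (tbound_ex s) as [a], (tbound_ex t) as [b];
    exists (a + b); split; (eapply tbound_mono; [|eassumption]); lia.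
  - destruct (tbound_ex t) as [a]. exists (a + S X).
    split; [eapply tbound_mono; [|eassumption]|]; lia.
  - exists 0; exact I.
  - exists (a + b); split; (eapply fbound_mono; [| |eassumption]); lia.
  - exists a. eapply fbound_mono; [| |eassumption]; lia.
  - exists a. eapply fbound_mono; [| |eassumption]; lia.
Qed.

Lemma list_fbound_ex (G : list form) : exists n, forall p, In p G -> fbound n n p.
Proof.
  induction G as [|q G [a IH]]; simpl.
  - exists 0; tauto.
  - destruct (fbound_ex q) as [b]. exists (a + b). intros p [->|Hp];
      eapply fbound_mono; [| |eassumption| | |apply IH; assumption]; lia.
Qed.

Lemma tsubst_bound t : forall n s s',
  tbound n t -> (forall i, i < n -> s i = s' i) -> tsubst s t = tsubst s' t.
Proof. induction t; simpl; intros; f_equal; intuition eauto. Qed.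

Lemma fsubst_bound p : forall n m s s' r r',
  fbound n m p -> (forall i, i < n -> s i = s' i) -> (forall i, i < m -> r i = r' i) ->
  fsubst s r p = fsubst s' r' p.
Proof.
  induction p; simpl; intros n' m' s' s'' r' r'' Hb Hs Hr.
  - f_equal; eapply tsubst_bound; intuition eauto.
  - f_equal; eapply tsubst_bound; intuition eauto.
  - f_equal; [eapply tsubst_bound; intuition eauto|apply Hr; tauto].
  - reflexivity.
  - f_equal; [eapply IHp1|eapply IHp2]; intuition eauto.
  - f_equal. eapply IHp; [eassumption| |assumption].
    intros [|i] Hi; [reflexivity|]. unfold upN; simpl. rewrite Hs by lia. reflexivity.
  - f_equal. eapply IHp; [eassumption|assumption|].
    intros [|i] Hi; [reflexivity|]. unfold upS; simpl. rewrite Hr by lia. reflexivity.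
Qed.

(** * Structural properties of derivations *)

Lemma prv_weak Th G p : prv Th G p -> forall G', incl G G' -> prv Th G' p.
Proof.
  induction 1; intros G' HG.
  - now apply prv_Ax.
  - apply prv_Hyp; auto.
  - apply prv_ImpI, IHprv. intros x [->|Hx]; [left; reflexivity|right; auto].
  - eapply prv_ImpE; eauto.
  - apply prv_Contra, IHprv. intros x [->|Hx]; [left; reflexivity|right; auto].
  - apply prv_AllNI, IHprv, incl_map, HG.
  - now apply prv_AllNE, IHprv.
  - apply prv_AllSI, IHprv, incl_map, HG.
  - now apply prv_AllSE, IHprv.
  - apply prv_EqRefl.
  - eapply prv_EqSubst; eauto.
Qed.

(** The calculus instantiates one quantifier at a time, so a simultaneous substitution is decomposed
    into [n] single ones. The remaining terms are shifted at each level, which shields them from the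
    instantiation still to come. *)
Fixpoint instsN (n : nat) (s : nat -> term) : nat -> term :=
  match n with
  | 0 => Var
  | S k => fun i => tsubst (scons (s k) Var)
                      (instsN k (fun j => tsubst (fun l => Var (S l)) (s j)) i)
  end.

Fixpoint instsS (n : nat) (r : nat -> nat) : nat -> nat :=
  match n with
  | 0 => fun i => i
  | S k => fun i => scons (r k) (fun j => j) (instsS k (fun j => S (r j)) i)
  end.

Lemma instsN_ge n : forall s i, instsN n s (n + i) = Var i.
Proof.
  induction n; intros s i; simpl; [reflexivity|].
  replace (S (n + i)) with (n + S i) by lia. rewrite IHn. reflexivity.
Qed.

Lemma instsN_lt n : forall s i, i < n -> instsN n s i = s i.
Proof.
  induction n; intros s i Hi; simpl; [lia|].
  destruct (Nat.eq_dec i n) as [->|Hn].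
  - pose proof (fun t => instsN_ge n t 0) as H. rewrite Nat.add_0_r in H. rewrite H. reflexivity.
  - rewrite IHn by lia. rewrite tsubst_comp. apply tsubst_id.
Qed.

Lemma instsS_ge n : forall r i, instsS n r (n + i) = i.
Proof.
  induction n; intros s i; simpl; [reflexivity|].
  replace (S (n + i)) with (n + S i) by lia. rewrite IHn. reflexivity.
Qed.

Lemma instsS_lt n : forall r i, i < n -> instsS n r i = r i.
Proof.
  induction n; intros s i Hi; simpl; [lia|].
  destruct (Nat.eq_dec i n) as [->|Hn].
  - pose proof (fun t => instsS_ge n t 0) as H. rewrite Nat.add_0_r in H. rewrite H. reflexivity.
  - rewrite IHn by lia. reflexivity.
Qed.

Lemma provable_instsN Th p n :
  Th ⊢ p -> forall s, Th ⊢ fsubst (instsN n s) (fun i => i) p.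
Proof.
  intro Hp. induction n; intro s; simpl.
  - rewrite fsubst_id. exact Hp.
  - pose proof (prv_AllNE _ _ _ (s n) (prv_AllNI Th [] _ (IHn (fun j => tsubst (fun l => Var (S l)) (s j))))) as H.
    unfold instN in H. rewrite fsubst_comp in H. exact H.
Qed.

Lemma provable_instsS Th p n :
  Th ⊢ p -> forall r, Th ⊢ fsubst Var (instsS n r) p.
Proof.
  intro Hp. induction n; intro r; simpl.
  - rewrite fsubst_id. exact Hp.
  - pose proof (prv_AllSE _ _ _ (r n) (prv_AllSI Th [] _ (IHn (fun j => S (r j))))) as H.
    unfold instS in H. rewrite fsubst_comp in H. exact H.
Qed.

(** Generalisation over the empty context followed by instantiation replaces every free variable,
    and only finitely many occur. This is what lets [prv_subst] pass through an axiom with free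
    variables, as [Th] itself need not be closed under substitution. *)
Lemma provable_subst Th p s r : Th ⊢ p -> Th ⊢ fsubst s r p.
Proof.
  intro Hp. destruct (fbound_ex p) as [n Hn].
  pose proof (provable_instsN _ _ n (provable_instsS _ _ n Hp r) s) as H.
  rewrite fsubst_comp in H.
  erewrite fsubst_bound; [exact H|exact Hn| |].
  - intros i Hi. simpl. rewrite instsN_lt by assumption. reflexivity.
  - intros i Hi. simpl. rewrite instsS_lt by assumption. reflexivity.
Qed.

Lemma prv_subst Th G p : prv Th G p -> forall s r,
  prv Th (map (fsubst s r) G) (fsubst s r p).
Proof.
  induction 1; intros s' r'; simpl in *.
  - eapply prv_weak; [apply provable_subst; apply prv_Ax; assumption|intros x []].
  - apply prv_Hyp, in_map, H.
  - apply prv_ImpI, IHprv.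
  - eapply prv_ImpE; [apply IHprv1|apply IHprv2].
  - apply prv_Contra. apply (IHprv s' r').
  - apply prv_AllNI. specialize (IHprv (upN s') r').
    rewrite map_map in *. erewrite map_ext; [exact IHprv|].
    intro q. symmetry. apply fsubst_shiftN.
  - rewrite fsubst_instN. apply prv_AllNE, (IHprv s' r').
  - apply prv_AllSI. specialize (IHprv s' (upS r')).
    rewrite map_map in *. erewrite map_ext; [exact IHprv|].
    intro q. symmetry. apply fsubst_shiftS.
  - rewrite fsubst_instS. apply prv_AllSE, (IHprv s' r').
  - apply prv_EqRefl.
  - rewrite fsubst_instN. eapply prv_EqSubst; [apply IHprv1|].
    rewrite <- fsubst_instN. apply IHprv2.
Qed.

Lemma prv_Bot Th G p : prv Th G Bot -> prv Th G p.
Proof. intro H. apply prv_Contra. eapply prv_weak; [exact H|]. intros x Hx; right; exact Hx. Qed.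

(** A variable bounding the context acts as an eigenvariable: rename it to the
    bound variable. *)
Lemma prv_freshN Th G p k :
  (forall q, In q G -> fbound k k q) -> fbound (S k) (S k) p ->
  prv Th G (instN (Var k) p) -> prv Th G (ForallN p).
Proof.
  intros HG Hp H. apply prv_AllNI.
  apply (prv_subst _ _ _) with (s := fun i => if Nat.eq_dec i k then Var 0 else Var (S i))
    (r := fun i => i) in H.
  replace (map shiftN G) with
    (map (fsubst (fun i => if Nat.eq_dec i k then Var 0 else Var (S i)) (fun i => i)) G).
  - erewrite <- (fsubst_id p); unfold instN in H; rewrite fsubst_comp in H.
    erewrite fsubst_bound; [exact H|exact Hp| |reflexivity].
    intros [|i] Hi; simpl; destruct (Nat.eq_dec _ _); try reflexivity; lia.
  - apply map_ext_in. intros q Hq. apply (fsubst_bound q k k); [auto| |reflexivity].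
    intros i Hi. destruct (Nat.eq_dec i k); [lia|reflexivity].
Qed.

Lemma prv_freshS Th G p k :
  (forall q, In q G -> fbound k k q) -> fbound (S k) (S k) p ->
  prv Th G (instS k p) -> prv Th G (ForallS p).
Proof.
  intros HG Hp H. apply prv_AllSI.
  apply (prv_subst _ _ _) with (s := Var)
    (r := fun i => if Nat.eq_dec i k then 0 else S i) in H.
  replace (map shiftS G) with
    (map (fsubst Var (fun i => if Nat.eq_dec i k then 0 else S i)) G).
  - erewrite <- (fsubst_id p); unfold instS in H; rewrite fsubst_comp in H.
    erewrite fsubst_bound; [exact H|exact Hp|reflexivity|].
    intros [|i] Hi; simpl; destruct (Nat.eq_dec _ _); try reflexivity; lia.
  - apply map_ext_in. intros q Hq. apply (fsubst_bound q k k); [auto|reflexivity|].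
    intros i Hi. destruct (Nat.eq_dec i k); [lia|reflexivity].
Qed.

(** * Models and the completeness theorem *)

(** Henkin semantics: the set sort is an arbitrary type with a membership relation. Extensionality
    is not imposed, in keeping with the absence of an equality between sets. *)
Record model : Type := Model {
  num : Type;
  set : Type;
  m_zero : num;
  m_one : num;
  m_add : num -> num -> num;
  m_mul : num -> num -> num;
  m_lt : num -> num -> Prop;
  m_mem : num -> set -> Prop }.

Fixpoint teval (M : model) (rho : nat -> num M) (t : term) : num M :=
  match t with
  | Var n => rho n
  | Zero => m_zero M
  | One => m_one M
  | AddN s t => m_add M (teval M rho s) (teval M rho t)
  | MulN s t => m_mul M (teval M rho s) (teval M rho t)
  end.

Fixpoint sat (M : model) (rho : nat -> num M) (xi : nat -> set M) (p : form) : Prop :=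
  match p with
  | EqN s t => teval M rho s = teval M rho t
  | LtN s t => m_lt M (teval M rho s) (teval M rho t)
  | Mem t X => m_mem M (teval M rho t) (xi X)
  | Bot => False
  | Imp p q => sat M rho xi p -> sat M rho xi q
  | ForallN p => forall x, sat M (scons x rho) xi p
  | ForallS p => forall X, sat M rho (scons X xi) p
  end.

Lemma teval_tsubst M rho s t :
  teval M rho (tsubst s t) = teval M (fun n => teval M rho (s n)) t.
Proof. induction t; simpl; congruence. Qed.

Lemma sat_fsubst M p : forall rho xi s r,
  sat M rho xi (fsubst s r p) <-> sat M (fun n => teval M rho (s n)) (fun n => xi (r n)) p.
Proof.
  induction p; intros rho xi s' r'; simpl; rewrite ?teval_tsubst; try tauto.
  - rewrite IHp1, IHp2. tauto.
  - assert (E : forall x, (fun n => teval M (scons x rho) (upN s' n))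
                          = scons x (fun n => teval M rho (s' n))).
    { intro x. extensionality n. destruct n; simpl; [reflexivity|].
      unfold upN; simpl. rewrite teval_tsubst. reflexivity. }
    split; intros H x; specialize (H x); rewrite IHp in *; rewrite E in *; exact H.
  - assert (E : forall X, (fun n => scons X xi (upS r' n)) = scons X (fun n => xi (r' n))).
    { intro X. extensionality n. destruct n; reflexivity. }
    split; intros H X; specialize (H X); rewrite IHp in *; rewrite E in *; exact H.
Qed.

Definition models (M : model) (Th : form -> Prop) : Prop :=
  forall p, Th p -> forall rho xi, sat M rho xi p.

(** * Coding of formulas by numbers *)

Fixpoint tcode (t : term) : nat :=
  match t with
  | Var n => to_nat (0, n)
  | Zero => to_nat (1, 0)
  | One => to_nat (2, 0)
  | AddN s t => to_nat (3, to_nat (tcode s, tcode t))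
  | MulN s t => to_nat (4, to_nat (tcode s, tcode t))
  end.

Fixpoint fcode (p : form) : nat :=
  match p with
  | EqN s t => to_nat (0, to_nat (tcode s, tcode t))
  | LtN s t => to_nat (1, to_nat (tcode s, tcode t))
  | Mem t X => to_nat (2, to_nat (tcode t, X))
  | Bot => to_nat (3, 0)
  | Imp p q => to_nat (4, to_nat (fcode p, fcode q))
  | ForallN p => to_nat (5, fcode p)
  | ForallS p => to_nat (6, fcode p)
  end.

Lemma to_nat_pair a b c d : to_nat (a, b) = to_nat (c, d) -> a = c /\ b = d.
Proof.
  intro H. apply (f_equal of_nat) in H. rewrite !cancel_of_to in H.
  injection H. auto.
Qed.

Local Ltac code_inj :=
  repeat match goal with
  | H : to_nat _ = to_nat _ |- _ => apply to_nat_pair in H as [? ?]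
  end; subst; try discriminate.

Lemma tcode_inj s : forall t, tcode s = tcode t -> s = t.
Proof.
  induction s; destruct t; cbn [tcode]; intro H; code_inj; f_equal; auto.
Qed.

Lemma fcode_inj p : forall q, fcode p = fcode q -> p = q.
Proof.
  induction p; destruct q; cbn [fcode]; intro H; code_inj; f_equal; auto using tcode_inj.
Qed.

Definition fdecode (n : nat) : form := epsilon (inhabits Bot) (fun p => fcode p = n).

Lemma fdecode_fcode p : fdecode (fcode p) = p.
Proof. apply fcode_inj. unfold fdecode. apply epsilon_spec. exists p; reflexivity. Qed.

(** * Henkin construction and term model *)

Section Henkin.

Variable Th : form -> Prop.

Definition consistent (G : list form) : Prop := ~ prv Th G Bot.

Definition fresh (G : list form) : nat :=
  epsilon (inhabits 0) (fun n => forall p, In p G -> fbound n n p).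

Lemma fresh_spec G p : In p G -> fbound (fresh G) (fresh G) p.
Proof. apply (epsilon_spec _ _ (list_fbound_ex G)). Qed.

(** Existential quantifiers are negated universal ones, so these two shapes are the only ones that
    call for a witness; the witness is the variable [k] itself. *)
Definition witness (p : form) (k : nat) : list form :=
  match p with
  | Imp (ForallN q) Bot => [Neg (instN (Var k) q)]
  | Imp (ForallS q) Bot => [Neg (instS k q)]
  | _ => []
  end.

(** If the witness created a contradiction, the instance at the fresh variable would be derivable;
    generalising it by [prv_freshN] or [prv_freshS] contradicts [p], which denies the universal
    statement. *)
Lemma consistent_witness p G :
  consistent (p :: G) -> consistent (witness p (fresh (p :: G)) ++ p :: G).
Proof.
  intros H. set (k := fresh (p :: G)).
  assert (Hk : forall q, In q (p :: G) -> fbound k k q) by apply fresh_spec.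
  destruct p as [| | | |[| | | | |q|q] [| | | | | |]| |]; try exact H;
    simpl; intro C; apply H; eapply prv_ImpE;
    [apply prv_Hyp; left; reflexivity| |apply prv_Hyp; left; reflexivity|].
  - apply prv_freshN with k; [exact Hk| |apply prv_Contra, C].
    destruct (Hk _ (or_introl eq_refl)) as [Hq _]. simpl in Hq.
    eapply fbound_mono; [| |exact Hq]; lia.
  - apply prv_freshS with k; [exact Hk| |apply prv_Contra, C].
    destruct (Hk _ (or_introl eq_refl)) as [Hq _]. simpl in Hq.
    eapply fbound_mono; [| |exact Hq]; lia.
Qed.

Definition extend (G : list form) (p : form) : list form :=
  if excluded_middle_informative (consistent (p :: G))
  then witness p (fresh (p :: G)) ++ p :: G else G.

Variable G0 : list form.
Hypothesis G0_consistent : consistent G0.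

Fixpoint stage (n : nat) : list form :=
  match n with
  | 0 => G0
  | S n => extend (stage n) (fdecode n)
  end.

Definition maximal (p : form) : Prop := exists n, In p (stage n).

Lemma stage_consistent n : consistent (stage n).
Proof.
  induction n; simpl; [exact G0_consistent|]. unfold extend.
  destruct excluded_middle_informative as [H|H]; [|exact IHn].
  apply consistent_witness, H.
Qed.

Lemma stage_S n : incl (stage n) (stage (S n)).
Proof.
  simpl; unfold extend. destruct excluded_middle_informative; [|apply incl_refl].
  intros x Hx. apply in_or_app. right. right. exact Hx.
Qed.

Lemma stage_mono n m : n <= m -> incl (stage n) (stage m).
Proof.
  induction 1; [apply incl_refl|]. eapply incl_tran; [exact IHle|apply stage_S].
Qed.

Lemma maximal_finite G : (forall p, In p G -> maximal p) -> exists n, incl G (stage n).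
Proof.
  induction G as [|q G IH]; intro H; [exists 0; intros x []|].
  destruct IH as [n Hn]; [intros p Hp; apply H; right; exact Hp|].
  destruct (H q (or_introl eq_refl)) as [m Hm]. exists (n + m).
  intros x [->|Hx].
  - eapply stage_mono; [|exact Hm]; lia.
  - eapply stage_mono; [|apply Hn, Hx]; lia.
Qed.

Lemma maximal_or p : maximal p \/ exists n, prv Th (p :: stage n) Bot.
Proof.
  destruct (excluded_middle_informative (consistent (p :: stage (fcode p)))) as [H|H].
  - left. exists (S (fcode p)). simpl. rewrite fdecode_fcode. unfold extend.
    destruct excluded_middle_informative; [|contradiction].
    apply in_or_app. right. left. reflexivity.
  - right. exists (fcode p). apply NNPP, H.
Qed.

Lemma maximal_closed G p : (forall q, In q G -> maximal q) -> prv Th G p -> maximal p.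
Proof.
  intros HG Hp. destruct (maximal_or p) as [H|[n Hn]]; [exact H|exfalso].
  destruct (maximal_finite G HG) as [m Hm].
  apply (stage_consistent (n + m)). eapply prv_ImpE.
  - apply prv_ImpI. eapply prv_weak; [exact Hn|].
    intros x [->|Hx]; [left; reflexivity|right].
    eapply stage_mono; [|exact Hx]; lia.
  - eapply prv_weak; [exact Hp|]. intros x Hx. eapply stage_mono; [|apply Hm, Hx]; lia.
Qed.

Lemma maximal_Bot : ~ maximal Bot.
Proof. intros [n Hn]. apply (stage_consistent n). apply prv_Hyp, Hn. Qed.

Lemma maximal_Neg p : ~ maximal p -> maximal (Neg p).
Proof.
  intro H. destruct (maximal_or p) as [H'|[n Hn]]; [contradiction|].
  apply maximal_closed with (stage n); [intros q Hq; exists n; exact Hq|].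
  apply prv_ImpI, Hn.
Qed.

Lemma maximal_Imp p q : maximal (Imp p q) <-> (maximal p -> maximal q).
Proof.
  split.
  - intros H Hp. apply maximal_closed with [Imp p q; p].
    + intros x [<-|[<-|[]]]; assumption.
    + eapply prv_ImpE; apply prv_Hyp; [left|right; left]; reflexivity.
  - intro H. destruct (classic (maximal q)) as [Hq|Hq].
    + apply maximal_closed with [q]; [intros x [<-|[]]; assumption|].
      apply prv_ImpI, prv_Hyp. right; left; reflexivity.
    + apply maximal_closed with [Neg p].
      * intros x [<-|[]]. apply maximal_Neg. tauto.
      * apply prv_ImpI, prv_Bot. eapply prv_ImpE; apply prv_Hyp; [right; left|left]; reflexivity.
Qed.

(** A formula may enter early, from [G0] or as a witness of another one, but its own witness is
    added at its turn [fcode p]. The consistency test succeeds there, since [p] and that stage lie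
    together in a later consistent stage. *)
Lemma maximal_witness p : maximal p -> exists k, forall q, In q (witness p k) -> maximal q.
Proof.
  intro H. exists (fresh (p :: stage (fcode p))). intros q Hq.
  exists (S (fcode p)). simpl. rewrite fdecode_fcode. unfold extend.
  destruct excluded_middle_informative as [C|C].
  - apply in_or_app. left. exact Hq.
  - exfalso. apply C. intro B. destruct H as [m Hm].
    apply (stage_consistent (fcode p + m)). eapply prv_weak; [exact B|].
    intros x [<-|Hx].
    + eapply stage_mono; [|exact Hm]; lia.
    + eapply stage_mono; [|exact Hx]; lia.
Qed.

Lemma maximal_ForallN p : maximal (ForallN p) <-> forall t, maximal (instN t p).
Proof.
  split.
  - intros H t. apply maximal_closed with [ForallN p].
    + intros x [<-|[]]; assumption.
    + apply prv_AllNE, prv_Hyp. left; reflexivity.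
  - intro H. apply NNPP. intro C. apply maximal_Neg in C.
    destruct (maximal_witness _ C) as [k Hk].
    specialize (Hk _ (or_introl eq_refl)). apply maximal_Bot.
    apply (proj1 (maximal_Imp _ _) Hk), H.
Qed.

Lemma maximal_ForallS p : maximal (ForallS p) <-> forall X, maximal (instS X p).
Proof.
  split.
  - intros H X. apply maximal_closed with [ForallS p].
    + intros x [<-|[]]; assumption.
    + apply prv_AllSE, prv_Hyp. left; reflexivity.
  - intro H. apply NNPP. intro C. apply maximal_Neg in C.
    destruct (maximal_witness _ C) as [k Hk].
    specialize (Hk _ (or_introl eq_refl)). apply maximal_Bot.
    apply (proj1 (maximal_Imp _ _) Hk), H.
Qed.

Lemma maximal_EqSubst p s t : maximal (EqN s t) -> maximal (instN s p) -> maximal (instN t p).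
Proof.
  intros E H. apply maximal_closed with [EqN s t; instN s p].
  - intros x [<-|[<-|[]]]; assumption.
  - eapply prv_EqSubst; apply prv_Hyp; [left|right; left]; reflexivity.
Qed.

Lemma maximal_EqRefl t : maximal (EqN t t).
Proof. apply maximal_closed with []; [intros x []|apply prv_EqRefl]. Qed.

Local Notation shift := (tsubst (fun n => Var (S n))).

Lemma inst_shift t u : tsubst (scons t Var) (shift u) = u.
Proof. rewrite tsubst_comp. apply tsubst_id. Qed.

Lemma maximal_EqSym s t : maximal (EqN s t) -> maximal (EqN t s).
Proof.
  intro E. pose proof (maximal_EqSubst (EqN (Var 0) (shift s)) s t E) as H.
  unfold instN in H; simpl in H. rewrite !inst_shift in H. apply H, maximal_EqRefl.
Qed.

Lemma maximal_EqTrans s t u : maximal (EqN s t) -> maximal (EqN t u) -> maximal (EqN s u).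
Proof.
  intros E E'. pose proof (maximal_EqSubst (EqN (shift s) (Var 0)) t u E') as H.
  unfold instN in H; simpl in H. rewrite !inst_shift in H. apply H, E.
Qed.

(** A quotient by provable equality made of chosen representatives: equal terms define the same
    predicate of [u] by extensionality, and [epsilon] returns the same term for it. *)
Definition rep (t : term) : term := epsilon (inhabits Zero) (fun u => maximal (EqN t u)).

Lemma rep_spec t : maximal (EqN t (rep t)).
Proof. unfold rep. apply epsilon_spec. exists t. apply maximal_EqRefl. Qed.

Lemma rep_eq s t : maximal (EqN s t) -> rep s = rep t.
Proof.
  intro E. unfold rep. f_equal. extensionality u. apply propositional_extensionality.
  split; intro H; eapply maximal_EqTrans; [apply maximal_EqSym| | |]; eassumption.
Qed.

Definition cls (t : term) : {u : term | rep u = u} :=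
  exist _ (rep t) (rep_eq _ _ (maximal_EqSym _ _ (rep_spec t))).

Lemma cls_eq s t : cls s = cls t <-> maximal (EqN s t).
Proof.
  split.
  - intro H. apply (f_equal (@proj1_sig _ _)) in H. simpl in H.
    eapply maximal_EqTrans; [apply rep_spec|]. rewrite H. apply maximal_EqSym, rep_spec.
  - intro H. apply eq_sig_hprop; [intros; apply proof_irrelevance|]. apply rep_eq, H.
Qed.

Lemma cls_proj x : cls (proj1_sig x) = x.
Proof. apply eq_sig_hprop; [intros; apply proof_irrelevance|]. apply (proj2_sig x). Qed.

Lemma maximal_EqN_proj t : maximal (EqN (proj1_sig (cls t)) t).
Proof. apply cls_eq, cls_proj. Qed.

(** Numbers are classes of terms. Sets are the bare set variables: the language has no other set
    terms and no equality to divide by. *)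
Definition term_model : model :=
  Model {u : term | rep u = u} nat (cls Zero) (cls One)
    (fun x y => cls (AddN (proj1_sig x) (proj1_sig y)))
    (fun x y => cls (MulN (proj1_sig x) (proj1_sig y)))
    (fun x y => maximal (LtN (proj1_sig x) (proj1_sig y)))
    (fun x X => maximal (Mem (proj1_sig x) X)).

(** Rewriting with an equation of [maximal] at one position, named by a
    formula whose variable 0 marks it. *)
Local Ltac by_EqSubst p E :=
  let H := fresh in pose proof (maximal_EqSubst p _ _ E) as H;
  unfold instN in H; simpl in H; rewrite ?inst_shift in H; apply H.

Lemma cls_op (op : term -> term -> term) s s' t t' :
  (forall r u v, tsubst r (op u v) = op (tsubst r u) (tsubst r v)) ->
  maximal (EqN s s') -> maximal (EqN t t') -> maximal (EqN (op s t) (op s' t')).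
Proof.
  intros Hop E E'.
  pose proof (maximal_EqSubst (EqN (op (shift s) (shift t)) (op (shift s') (Var 0))) _ _ E') as H'.
  pose proof (maximal_EqSubst (EqN (op (shift s) (shift t)) (op (Var 0) (shift t))) _ _ E) as H.
  unfold instN in H, H'; simpl in H, H'. rewrite !Hop in H, H'; simpl in H, H'.
  rewrite !inst_shift in H. rewrite !inst_shift in H'.
  apply H', H, maximal_EqRefl.
Qed.

Lemma maximal_LtN s s' t t' : maximal (EqN s s') -> maximal (EqN t t') ->
  maximal (LtN s t) -> maximal (LtN s' t').
Proof.
  intros E E' H.
  by_EqSubst (LtN (shift s') (Var 0)) E'. by_EqSubst (LtN (Var 0) (shift t)) E. exact H.
Qed.

Lemma maximal_Mem s s' X : maximal (EqN s s') -> maximal (Mem s X) -> maximal (Mem s' X).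
Proof. intros E H. by_EqSubst (Mem (Var 0) X) E. exact H. Qed.

Lemma teval_term_model s t :
  teval term_model (fun n => cls (s n)) t = cls (tsubst s t).
Proof.
  induction t; simpl; try reflexivity.
  - rewrite IHt1, IHt2. apply cls_eq, (cls_op AddN); auto using maximal_EqN_proj.
  - rewrite IHt1, IHt2. apply cls_eq, (cls_op MulN); auto using maximal_EqN_proj.
Qed.

(** The truth lemma. It is stated for all substitutions so that the quantifier cases can instantiate
    the bound variable by any term, every element of the model being the class of one. *)
Lemma sat_term_model p : forall s r,
  sat term_model (fun n => cls (s n)) r p <-> maximal (fsubst s r p).
Proof.
  induction p; intros s' r'; simpl sat; simpl fsubst.
  - rewrite !teval_term_model. apply cls_eq.
  - rewrite !teval_term_model. simpl.
    split; apply maximal_LtN; (apply rep_spec || apply maximal_EqSym, rep_spec).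
  - rewrite teval_term_model. simpl.
    split; apply maximal_Mem; (apply rep_spec || apply maximal_EqSym, rep_spec).
  - split; [tauto|apply maximal_Bot].
  - rewrite maximal_Imp, IHp1, IHp2. tauto.
  - rewrite maximal_ForallN.
    assert (E : forall t, fsubst (scons t s') r' p = instN t (fsubst (upN s') r' p)).
    { intro t. unfold instN. rewrite fsubst_comp. f_equal. extensionality n.
      destruct n; simpl; [reflexivity|]. rewrite inst_shift. reflexivity. }
    assert (E' : forall t, scons (cls t) (fun n => cls (s' n)) = fun n => cls (scons t s' n)).
    { intro t. extensionality n. destruct n; reflexivity. }
    split.
    + intros H t. rewrite <- E. apply IHp. rewrite <- E'. apply H.
    + intros H x. rewrite <- (cls_proj x), E'. apply IHp. rewrite E. apply H.
  - rewrite maximal_ForallS.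
    assert (E : forall X, fsubst s' (scons X r') p = instS X (fsubst s' (upS r') p)).
    { intro X. unfold instS. rewrite fsubst_comp. f_equal.
      - extensionality n. symmetry. apply tsubst_id.
      - extensionality n. destruct n; reflexivity. }
    split; intros H X; specialize (H X); [rewrite <- E; apply IHp, H|].
    apply IHp. rewrite E. exact H.
Qed.

Lemma term_model_models : models term_model Th.
Proof.
  intros p Hp rho xi.
  replace rho with (fun n => cls (proj1_sig (rho n))).
  - apply sat_term_model. apply maximal_closed with []; [intros x []|].
    apply provable_subst, prv_Ax, Hp.
  - extensionality n. apply cls_proj.
Qed.

Lemma term_model_G0 p : In p G0 -> sat term_model (fun n => cls (Var n)) (fun n => n) p.
Proof.
  intro H. apply sat_term_model. rewrite fsubst_id. exists 0. exact H.
Qed.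

End Henkin.

Theorem completeness (Th : form -> Prop) (p : form) :
  (forall M, models M Th -> forall rho xi, sat M rho xi p) -> Th ⊢ p.
Proof.
  intro H. apply NNPP. intro C.
  assert (HC : consistent Th [Neg p]) by (intro B; apply C, prv_Contra, B).
  apply (term_model_G0 Th [Neg p] HC (Neg p) (or_introl eq_refl)).
  apply H, term_model_models.
Qed.

(** * Semantics of the defined notions in a model *)

Arguments m_zero {_}.
Arguments m_one {_}.
Arguments m_add {_} _ _.
Arguments m_mul {_} _ _.
Arguments m_lt {_} _ _.
Arguments m_mem {_} _ _.

Declare Scope model_scope.
Delimit Scope model_scope with model.
Local Open Scope model_scope.

Notation "0" := m_zero : model_scope.
Notation "1" := m_one : model_scope.
Notation "x + y" := (m_add x y) : model_scope.
Notation "x * y" := (m_mul x y) : model_scope.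
Notation "x < y" := (m_lt x y) : model_scope.
Notation "x ∈ X" := (m_mem x X) (at level 70, no associativity) : model_scope.

Definition mpair {M : model} (x y : num M) : num M := (x + y) * (x + y) + x.
Notation "⟨ x , .. , y , z ⟩" := (mpair x .. (mpair y z) ..) : model_scope.

Fixpoint mnumeral {M : model} (n : nat) : num M :=
  match n with
  | O => 0
  | S O => 1
  | S k => mnumeral k + 1
  end.
Notation "# n" := (mnumeral n) (at level 1, n at level 0, format "# n") : model_scope.

Section Notions.

Context {M : model}.
Implicit Types x y z n m i j k c d e s t l a b u v : num M.
Implicit Types X Y Z F T : set M.

Definition InField i X : Prop := ⟨i, i⟩ ∈ X.
Definition LtIn X i j : Prop := ⟨i, j⟩ ∈ X /\ ~ ⟨j, i⟩ ∈ X.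

Definition IsLO X : Prop :=
  (forall i j, ⟨i, j⟩ ∈ X -> InField i X /\ InField j X)
  /\ (forall i j k, ⟨i, j⟩ ∈ X /\ ⟨j, k⟩ ∈ X -> ⟨i, k⟩ ∈ X)
  /\ (forall i j, ⟨i, j⟩ ∈ X /\ ⟨j, i⟩ ∈ X -> i = j)
  /\ (forall i j, InField i X /\ InField j X -> ⟨i, j⟩ ∈ X \/ ⟨j, i⟩ ∈ X).

Definition IsFun F : Prop :=
  (forall c, c ∈ F -> exists x y, c = ⟨x, y⟩)
  /\ (forall x, exists y, ⟨x, y⟩ ∈ F)
  /\ (forall x y z, ⟨x, y⟩ ∈ F /\ ⟨x, z⟩ ∈ F -> y = z).

Definition IsWF X : Prop :=
  ~ exists F, IsFun F /\ forall n x y, ⟨n, x⟩ ∈ F /\ ⟨n + #1, y⟩ ∈ F -> LtIn X y x.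

Definition IsWO X : Prop := IsLO X /\ IsWF X.

Definition IsBelow X Y j Z : Prop :=
  forall c, c ∈ Z <-> (exists m i, c = ⟨m, i⟩ /\ LtIn X i j /\ c ∈ Y).

Definition Beta a b i y : Prop :=
  y < #1 + (i + #1) * b /\ exists q, a = q * (#1 + (i + #1) * b) + y.

Definition Len s l : Prop := exists a b, s = ⟨l, a, b⟩.
Definition Entry s i x : Prop := exists l a b, s = ⟨l, a, b⟩ /\ i < l /\ Beta a b i x.

Definition SameSeq s t : Prop :=
  (forall l, Len s l <-> Len t l) /\ (forall i x, Entry s i x <-> Entry t i x).

Definition IsSeq s : Prop := (exists l, Len s l) /\ ~ exists t, t < s /\ SameSeq s t.

Definition Initial s t : Prop :=
  IsSeq s /\ IsSeq t
  /\ (exists l k, Len s l /\ Len t k /\ (l < k \/ l = k))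
  /\ (forall i x, Entry s i x -> Entry t i x).

Definition Earlier d i e x y : Prop := exists j, j < i /\ Entry d j ⟨e, x, y⟩.

(** The clauses of [justified], relative to a set [E] of available triples and
    an oracle [O]. *)
Definition Just (E : num M -> num M -> num M -> Prop) (O : num M -> Prop) e x y : Prop :=
  (e = ⟨#0, #0⟩ /\ y = x)
  \/ (e = ⟨#0, #1⟩ /\ y = #0)
  \/ (e = ⟨#0, #2⟩ /\ y = x + #1)
  \/ (e = ⟨#0, #3⟩ /\ exists z, x = ⟨y, z⟩)
  \/ (e = ⟨#0, #4⟩ /\ exists z, x = ⟨z, y⟩)
  \/ (e = ⟨#0, #5⟩ /\ ((O x /\ y = #1) \/ (~ O x /\ y = #0)))
  \/ (exists f g, e = ⟨#1, f, g⟩ /\ exists u v, E f x u /\ E g x v /\ y = ⟨u, v⟩)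
  \/ (exists f g, e = ⟨#2, f, g⟩ /\ exists u, E g x u /\ E f u y)
  \/ (exists f g, e = ⟨#3, f, g⟩ /\ exists a,
        (x = ⟨a, #0⟩ /\ E f a y)
        \/ (exists m u, x = ⟨a, m + #1⟩ /\ E e ⟨a, m⟩ u /\ E g ⟨a, m, u⟩ y))
  \/ (exists f, e = ⟨#4, f⟩ /\ E f ⟨x, y⟩ #0
        /\ forall z, z < y -> exists w, E f ⟨x, z⟩ (w + #1)).

Definition Valid (O : num M -> Prop) d : Prop :=
  forall i q, Entry d i q ->
    exists e x y, q = ⟨e, x, y⟩ /\ Just (Earlier d i) O e x y.

Definition Member d q : Prop := exists i, Entry d i q.

Definition Comp (O : num M -> Prop) e x y : Prop :=
  exists d, IsSeq d /\ Valid O d /\ Member d ⟨e, x, y⟩.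

Definition Computes Y e x y : Prop := Comp (fun z => z ∈ Y) e x y.

Definition LeT X Y : Prop :=
  exists e, forall x, (x ∈ X -> Computes Y e x #1) /\ (~ x ∈ X -> Computes Y e x #0).

Definition IsTree T : Prop :=
  (forall s, s ∈ T -> IsSeq s) /\ (forall s t, s ∈ T /\ Initial t s -> t ∈ T).

Definition IsPath F T : Prop :=
  IsFun F /\ forall n, exists s, s ∈ T /\ Len s n
    /\ forall i x, Entry s i x -> ⟨i, x⟩ ∈ F.

Definition Subset X Y : Prop := forall s, s ∈ X -> s ∈ Y.

Definition IsPerfect T : Prop :=
  IsTree T /\ (exists s, s ∈ T)
  /\ forall s, s ∈ T -> exists t u, t ∈ T /\ u ∈ T
       /\ Initial s t /\ Initial s u /\ ~ Initial t u /\ ~ Initial u t.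

Definition IsPointed T : Prop := IsPerfect T /\ forall F, IsPath F T -> LeT T F.

Definition IsCofinal T : Prop := forall X, exists F, IsPath F T /\ LeT X F.

End Notions.

(** The axioms with their syntax evaluated away. Only the two schemes still mention formulas,
    together with assignments for their parameters. *)
Class ATR0_model (M : model) : Prop := {
  set_inhabited : inhabited (set M);
  succ_nz : forall n : num M, n + 1 <> 0;
  succ_inj : forall m n : num M, m + 1 = n + 1 -> m = n;
  add_0 : forall m : num M, m + 0 = m;
  add_S : forall m n : num M, m + (n + 1) = (m + n) + 1;
  mul_0 : forall m : num M, m * 0 = 0;
  mul_S : forall m n : num M, m * (n + 1) = m * n + m;
  lt_0 : forall m : num M, ~ m < 0;
  lt_S : forall m n : num M, m < n + 1 <-> m < n \/ m = n;
  set_ind : forall X : set M, 0 ∈ X /\ (forall n, n ∈ X -> n + 1 ∈ X) -> forall n, n ∈ X;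
  comprehension_sat : forall p, arithmetical p -> forall rho xi,
    exists X : set M, forall x, x ∈ X <-> sat M (scons x rho) xi p;
  recursion_sat : forall p, arithmetical p -> forall rho xi (X : set M), IsWO X ->
    exists Y, IsLO X /\ forall c, c ∈ Y <-> exists n j, c = ⟨n, j⟩ /\ InField j X /\
      exists Z, IsBelow X Y j Z /\ sat M (scons n rho) (scons Z xi) p }.

(** ** Evaluating named formulas

    [denotesN l x v] says that the [bnum] [x] has value [v] in every context
    extending [l]; similarly for set variables and formulas. *)

Section Denotation.

Context {M : model} (rho : nat -> num M) (xi : nat -> set M).

Fixpoint push {A : Type} (l : list A) (f : nat -> A) : nat -> A :=
  match l with
  | [] => f
  | a :: l => scons a (push l f)
  end.

Lemma push_length {A} (l : list A) f i : push l f (i + length l)%nat = f i.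
Proof.
  induction l; simpl; [f_equal; lia|].
  rewrite Nat.add_succ_r. exact IHl.
Qed.

Lemma push_app {A} (l' : list A) a l f :
  push (l' ++ a :: l) f (length (l' ++ a :: l) - S (length l)) = a.
Proof.
  rewrite length_app. simpl. rewrite Nat.add_succ_r. simpl. rewrite Nat.add_sub.
  induction l'; simpl; [reflexivity|assumption].
Qed.

Definition ext {A : Type} (l l' : list A) : Prop := exists k, l' = k ++ l.

Lemma ext_refl {A} (l : list A) : ext l l.
Proof. exists []; reflexivity. Qed.

Lemma ext_cons {A} (a : A) l l' : ext l l' -> ext l (a :: l').
Proof. intros [k ->]. exists (a :: k); reflexivity. Qed.

Lemma ext_trans {A} (l l' l'' : list A) : ext l l' -> ext l' l'' -> ext l l''.
Proof. intros [k ->] [k' ->]. exists (k' ++ k). apply app_assoc. Qed.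

Definition denotesN (l : list (num M)) (x : bnum) (v : num M) : Prop :=
  forall l', ext l l' -> teval M (push l' rho) (x (length l')) = v.

Definition denotesS (m : list (set M)) (X : bset) (V : set M) : Prop :=
  forall m', ext m m' -> push m' xi (X (length m')) = V.

Definition denotes (l : list (num M)) (m : list (set M)) (p : bform) (P : Prop) : Prop :=
  forall l' m', ext l l' -> ext m m' ->
    (sat M (push l' rho) (push m' xi) (p (length l') (length m')) <-> P).

Lemma denotesN_ext l l' x v : ext l l' -> denotesN l x v -> denotesN l' x v.
Proof. intros E H l'' E'. apply H. eapply ext_trans; eassumption. Qed.

Lemma denotesS_ext l l' x v : ext l l' -> denotesS l x v -> denotesS l' x v.
Proof. intros E H l'' E'. apply H. eapply ext_trans; eassumption. Qed.

Lemma denotes_add l x y v w :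
  denotesN l x v -> denotesN l y w -> denotesN l (badd x y) (v + w).
Proof. intros Hx Hy l' E. simpl. rewrite Hx, Hy by assumption. reflexivity. Qed.

Lemma denotes_mul l x y v w :
  denotesN l x v -> denotesN l y w -> denotesN l (bmul x y) (v * w).
Proof. intros Hx Hy l' E. simpl. rewrite Hx, Hy by assumption. reflexivity. Qed.

Lemma denotes_pair l x y v w :
  denotesN l x v -> denotesN l y w -> denotesN l (bpair x y) ⟨v, w⟩.
Proof. intros Hx Hy. unfold bpair, mpair. auto using denotes_add, denotes_mul. Qed.

Lemma denotes_numeral l n : denotesN l (bnumeral n) #n.
Proof.
  intros l' _. unfold bnumeral. induction n as [|[|n] IH]; try reflexivity.
  change (m_add (teval M (push l' rho) (numeral (S n))) 1 = #(S n) + 1).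
  rewrite IH. reflexivity.
Qed.

Lemma denotes_eq l m x y v w :
  denotesN l x v -> denotesN l y w -> denotes l m (beq x y) (v = w).
Proof. intros Hx Hy l' m' E E'. simpl. rewrite Hx, Hy by assumption. tauto. Qed.

Lemma denotes_lt l m x y v w :
  denotesN l x v -> denotesN l y w -> denotes l m (blt x y) (v < w).
Proof. intros Hx Hy l' m' E E'. simpl. rewrite Hx, Hy by assumption. tauto. Qed.

Lemma denotes_mem l m x X v V :
  denotesN l x v -> denotesS m X V -> denotes l m (bmem x X) (v ∈ V).
Proof. intros Hx HX l' m' E E'. simpl. rewrite Hx, HX by assumption. tauto. Qed.

Lemma denotes_imp l m p q P Q :
  denotes l m p P -> denotes l m q Q -> denotes l m (bimp p q) (P -> Q).
Proof. intros Hp Hq l' m' E E'. simpl. rewrite (Hp l' m'), (Hq l' m') by assumption. tauto. Qed.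

Lemma denotes_neg l m p P : denotes l m p P -> denotes l m (bneg p) (~ P).
Proof. intros Hp l' m' E E'. simpl. rewrite (Hp l' m') by assumption. tauto. Qed.

Lemma denotes_and l m p q P Q :
  denotes l m p P -> denotes l m q Q -> denotes l m (band p q) (P /\ Q).
Proof.
  intros Hp Hq l' m' E E'. simpl. rewrite (Hp l' m'), (Hq l' m') by assumption.
  destruct (classic P), (classic Q); tauto.
Qed.

Lemma denotes_or l m p q P Q :
  denotes l m p P -> denotes l m q Q -> denotes l m (bor p q) (P \/ Q).
Proof.
  intros Hp Hq l' m' E E'. simpl. rewrite (Hp l' m'), (Hq l' m') by assumption.
  destruct (classic P); tauto.
Qed.

Lemma denotes_iff l m p q P Q :
  denotes l m p P -> denotes l m q Q -> denotes l m (biff p q) (P <-> Q).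
Proof. intros. unfold biff. apply denotes_and; apply denotes_imp; assumption. Qed.

Lemma denotes_allN l m f (P : num M -> Prop) :
  (forall l' m' x v, ext l l' -> ext m m' -> denotesN l' x v -> denotes l' m' (f x) (P v)) ->
  denotes l m (ballN f) (forall v, P v).
Proof.
  intros H l' m' E E'. simpl.
  assert (Hv : forall v, sat M (scons v (push l' rho)) (push m' xi)
     (f (fun k => Var (k - S (length l'))) (S (length l')) (length m')) <-> P v).
  { intro v. apply (H (v :: l') m') with (l' := v :: l');
      auto using ext_refl, ext_cons.
    intros l'' [k ->]. simpl. apply push_app. }
  split; intros HP v; apply Hv, HP.
Qed.

Lemma denotes_allS l m f (P : set M -> Prop) :
  (forall l' m' X V, ext l l' -> ext m m' -> denotesS m' X V -> denotes l' m' (f X) (P V)) ->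
  denotes l m (ballS f) (forall V, P V).
Proof.
  intros H l' m' E E'. simpl.
  assert (Hv : forall V, sat M (push l' rho) (scons V (push m' xi))
     (f (fun k => k - S (length m'))%nat (length l') (S (length m'))) <-> P V).
  { intro V. apply (H l' (V :: m')) with (m' := V :: m');
      auto using ext_refl, ext_cons.
    intros l'' [k ->]. simpl. apply push_app. }
  split; intros HP v; apply Hv, HP.
Qed.

Lemma denotes_equiv l m p P Q : (P <-> Q) -> denotes l m p P -> denotes l m p Q.
Proof. intros H Hp l' m' E E'. rewrite (Hp l' m') by assumption. exact H. Qed.

Lemma denotes_exN l m f (P : num M -> Prop) :
  (forall l' m' x v, ext l l' -> ext m m' -> denotesN l' x v -> denotes l' m' (f x) (P v)) ->
  denotes l m (bexN f) (exists v, P v).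
Proof.
  intro H. apply denotes_equiv with (~ forall v, ~ P v).
  - split; [apply not_all_not_ex|firstorder].
  - apply denotes_neg, denotes_allN. intros. apply denotes_neg, H; assumption.
Qed.

Lemma denotes_exS l m f (P : set M -> Prop) :
  (forall l' m' X V, ext l l' -> ext m m' -> denotesS m' X V -> denotes l' m' (f X) (P V)) ->
  denotes l m (bexS f) (exists V, P V).
Proof.
  intro H. apply denotes_equiv with (~ forall V, ~ P V).
  - split; [apply not_all_not_ex|firstorder].
  - apply denotes_neg, denotes_allS. intros. apply denotes_neg, H; assumption.
Qed.

Lemma denotes_embN l m p x v :
  denotesN l x v -> denotes l m (embN p x) (sat M (scons v rho) xi p).
Proof.
  intros Hx l' m' E E'. unfold embN. rewrite sat_fsubst.
  replace (fun n => teval M (push l' rho) _) with (scons v rho).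
  - replace (fun n => push m' xi _) with xi; [tauto|].
    extensionality n. symmetry. apply push_length.
  - extensionality n. destruct n; simpl; symmetry; [apply Hx, E|apply push_length].
Qed.

Lemma denotes_embNS l m p x X v V :
  denotesN l x v -> denotesS m X V ->
  denotes l m (embNS p x X) (sat M (scons v rho) (scons V xi) p).
Proof.
  intros Hx HX l' m' E E'. unfold embNS. rewrite sat_fsubst.
  replace (fun n => teval M (push l' rho) _) with (scons v rho).
  - replace (fun n => push m' xi _) with (scons V xi); [tauto|].
    extensionality n. destruct n; simpl; symmetry; [apply HX, E'|apply push_length].
  - extensionality n. destruct n; simpl; symmetry; [apply Hx, E|apply push_length].
Qed.

Lemma sat_build p P : denotes [] [] p P -> (sat M rho xi (build p) <-> P).
Proof. intro H. apply (H [] []); apply ext_refl. Qed.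

End Denotation.

Ltac denote_lift :=
  repeat match goal with
  | E : ext ?l ?l', H : denotesN ?r ?l ?x ?v |- _ => apply (denotesN_ext _ _ _ _ _ E) in H
  | E : ext ?l ?l', H : denotesS ?r ?l ?x ?v |- _ => apply (denotesS_ext _ _ _ _ _ E) in H
  end;
  repeat match goal with E : ext _ _ |- _ => clear E end.

Ltac denote_num :=
  lazymatch goal with
  | |- denotesN _ _ (bpair _ _) _ => apply denotes_pair; denote_num
  | |- denotesN _ _ (badd _ _) _ => apply denotes_add; denote_num
  | |- denotesN _ _ (bmul _ _) _ => apply denotes_mul; denote_num
  | |- denotesN ?r ?l (bnumeral ?n) _ => exact (denotes_numeral r l n)
  | |- _ => eassumption
  end.

Ltac denote :=
  lazymatch goal with
  | |- denotes _ _ _ _ (beq _ _) _ => apply denotes_eq; denote_num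
  | |- denotes _ _ _ _ (blt _ _) _ => apply denotes_lt; denote_num
  | |- denotes _ _ _ _ (bmem _ _) _ => apply denotes_mem; denote_num
  | |- denotes _ _ _ _ (embN _ _) _ => apply denotes_embN; denote_num
  | |- denotes _ _ _ _ (embNS _ _ _) _ => apply denotes_embNS; denote_num
  | |- denotes _ _ _ _ (bimp _ _) _ => apply denotes_imp; denote
  | |- denotes _ _ _ _ (bneg _) _ => apply denotes_neg; denote
  | |- denotes _ _ _ _ (band _ _) _ => apply denotes_and; denote
  | |- denotes _ _ _ _ (bor _ _) _ => apply denotes_or; denote
  | |- denotes _ _ _ _ (biff _ _) _ => apply denotes_iff; denote
  | |- denotes _ _ _ _ (ballN _) _ => apply denotes_allN; intros; denote_lift; denote
  | |- denotes _ _ _ _ (ballS _) _ => apply denotes_allS; intros; denote_lift; denote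
  | |- denotes _ _ _ _ (bexN _) _ => apply denotes_exN; intros; denote_lift; denote
  | |- denotes _ _ _ _ (bexS _) _ => apply denotes_exS; intros; denote_lift; denote
  | |- _ => eauto with denote
  end.

(** * Truth values of the defined notions *)

Section Dictionary.

Context {M : model} (rho : nat -> num M) (xi : nat -> set M).
Lemma denotes_LO l m X V : denotesS xi m X V -> denotes rho xi l m (LO X) (IsLO V).
Proof. intros. unfold LO, IsLO, in_field, InField. denote. Qed.

Lemma denotes_WO l m X V : denotesS xi m X V -> denotes rho xi l m (WO X) (IsWO V).
Proof.
  intros. unfold WO, IsWO, WF, IsWF, Fun, IsFun, lt_in, LtIn.
  apply denotes_and; [apply denotes_LO; assumption|denote].
Qed.

Lemma denotes_below l m X V Y W j i Z U :
  denotesS xi m X V -> denotesS xi m Y W -> denotesN rho l j i -> denotesS xi m Z U -> denotes rho xi l m (below X Y j Z) (IsBelow V W i U).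
Proof. intros. unfold below, IsBelow, lt_in, LtIn. denote. Qed.

Lemma denotes_len l m s t i j : denotesN rho l s t -> denotesN rho l i j -> denotes rho xi l m (len s i) (Len t j).
Proof. intros. unfold len, Len. denote. Qed.

Lemma denotes_entry l m s t i j x v :
  denotesN rho l s t -> denotesN rho l i j -> denotesN rho l x v -> denotes rho xi l m (entry s i x) (Entry t j v).
Proof. intros. unfold entry, Entry, beta, Beta. denote. Qed.

#[local] Hint Extern 1 (denotesN _ _ _ _) => denote_num : denote.
#[local] Hint Resolve denotes_LO denotes_WO denotes_below denotes_len denotes_entry : denote.

Lemma denotes_Seq l m s t : denotesN rho l s t -> denotes rho xi l m (Seq s) (IsSeq t).
Proof. intros. unfold Seq, IsSeq, same_seq, SameSeq. denote. Qed.

Lemma denotes_earlier l m d d' i i' e e' x x' y y' :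
  denotesN rho l d d' -> denotesN rho l i i' -> denotesN rho l e e' -> denotesN rho l x x' -> denotesN rho l y y' ->
  denotes rho xi l m (earlier d i e x y) (Earlier d' i' e' x' y').
Proof. intros. unfold earlier, Earlier. denote. Qed.

#[local] Hint Resolve denotes_Seq denotes_earlier : denote.

Lemma denotes_initial l m s s' t t' :
  denotesN rho l s s' -> denotesN rho l t t' -> denotes rho xi l m (initial s t) (Initial s' t').
Proof. intros. unfold initial, Initial. denote. Qed.

Lemma denotes_justified l m Y V d d' i i' e e' x x' y y' :
  denotesS xi m Y V -> denotesN rho l d d' -> denotesN rho l i i' -> denotesN rho l e e' -> denotesN rho l x x' -> denotesN rho l y y' ->
  denotes rho xi l m (justified Y d i e x y) (Just (Earlier d' i') (fun z => z ∈ V) e' x' y').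
Proof. intros. unfold justified, Just. denote. Qed.

Lemma denotes_Path l m F V T W : denotesS xi m F V -> denotesS xi m T W -> denotes rho xi l m (Path F T) (IsPath V W).
Proof. intros. unfold Path, IsPath, Fun, IsFun. denote. Qed.

#[local] Hint Resolve denotes_initial denotes_justified denotes_Path : denote.

Lemma denotes_leT l m X V Y W :
  denotesS xi m X V -> denotesS xi m Y W -> denotes rho xi l m (leT X Y) (LeT V W).
Proof. intros. unfold leT, LeT, computes, Computes, Comp, Valid, Member. denote. Qed.

Lemma denotes_Tree l m X V : denotesS xi m X V -> denotes rho xi l m (Tree X) (IsTree V).
Proof. intros. unfold Tree, IsTree. denote. Qed.

#[local] Hint Resolve denotes_leT denotes_Tree : denote.

Lemma sat_MPT : sat M rho xi MPT <->
  forall T : set M, IsTree T /\ IsCofinal T -> exists S, Subset S T /\ IsPointed S.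
Proof.
  apply sat_build. unfold CofinalPaths, IsCofinal, subset, Subset, Pointed, IsPointed,
    Perfect, IsPerfect. denote.
Qed.

Lemma sat_comprehension p : sat M rho xi (build (comprehension p)) <->
  exists X, forall x, x ∈ X <-> sat M (scons x rho) xi p.
Proof. apply sat_build. unfold comprehension. denote. Qed.

Lemma sat_transfinite_recursion p : sat M rho xi (build (transfinite_recursion p)) <->
  forall X : set M, IsWO X -> exists Y, IsLO X /\
    forall c, c ∈ Y <-> exists n j, c = ⟨n, j⟩ /\ InField j X /\
      exists Z, IsBelow X Y j Z /\ sat M (scons n rho) (scons Z xi) p.
Proof.
  apply sat_build. unfold transfinite_recursion, ATR_H, in_field, InField. denote.
Qed.

End Dictionary.

Lemma ATR0_model_of_models M (rho : nat -> num M) (xi : nat -> set M) :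
  models M ATR0 -> ATR0_model M.
Proof.
  intro H.
  assert (ax : forall p P, ATR0 (build p) -> denotes rho xi [] [] p P -> P).
  { intros p P Hp HP. apply (sat_build rho xi p P HP), H, Hp. }
  constructor.
  - exact (inhabits (xi 0%nat)).
  - apply (ax _ _ ax_succ_nz). denote.
  - apply (ax _ _ ax_succ_inj). denote.
  - apply (ax _ _ ax_add_0). denote.
  - apply (ax _ _ ax_add_S). denote.
  - apply (ax _ _ ax_mul_0). denote.
  - apply (ax _ _ ax_mul_S). denote.
  - apply (ax _ _ ax_lt_0). denote.
  - apply (ax _ _ ax_lt_S). denote.
  - apply (ax _ _ ax_ind). denote.
  - intros p Hp rho' xi'. apply sat_comprehension, H. constructor. exact Hp.
  - intros p Hp rho' xi'. apply sat_transfinite_recursion, H. constructor. exact Hp.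
Qed.

(** * Arithmetically definable predicates *)

Section Definability.

Context {M : model}.

(** Contexts consist of [k] numbers, the innermost last, over one set; the set
    is only used for the argument [Z] of a transfinite recursion. *)
Fixpoint ctx (k : nat) : Type :=
  match k with
  | O => set M
  | S k => (ctx k * num M)%type
  end.

Fixpoint cset (k : nat) : ctx k -> set M :=
  match k with
  | O => fun c => c
  | S k => fun c => cset k (fst c)
  end.

Fixpoint cenv (k : nat) (r : nat -> num M) : ctx k -> nat -> num M :=
  match k with
  | O => fun _ => r
  | S k => fun c => scons (snd c) (cenv k r (fst c))
  end.

(** Definability with parameters: the assignments [r] and [x] interpret the free variables that lie
    beyond the context. *)
Definition Def (k : nat) (P : ctx k -> Prop) : Prop :=
  exists p r x, arithmetical p
    /\ forall c, sat M (cenv k r c) (scons (cset k c) x) p <-> P c.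

(** Only the graph has to be definable. The function may be any Rocq function, even one obtained
    from [epsilon], although no term of the language denotes it. *)
Definition DefF (k : nat) (f : ctx k -> num M) : Prop :=
  Def (S k) (fun c => snd c = f (fst c)).

Definition DefS (k : nat) (g : ctx k -> set M) : Prop :=
  (exists X, forall c, g c = X) \/ (forall c, g c = cset k c).

Inductive IsProj (k : nat) : forall k', (ctx k -> ctx k') -> Prop :=
| proj_id : IsProj k k (fun c => c)
| proj_fst k' h : IsProj k (S k') h -> IsProj k k' (fun c => fst (h c)).

Lemma cenv_ge k r c i : cenv k r c (k + i)%nat = r i.
Proof. induction k; simpl; [reflexivity|apply IHk]. Qed.

Lemma cenv_lt k r r' c i : (i < k)%nat -> cenv k r c i = cenv k r' c i.
Proof.
  revert c i; induction k; intros c i Hi; [lia|]. destruct i; simpl; [reflexivity|].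
  apply IHk. lia.
Qed.

Lemma arithmetical_fsubst p : forall s r, arithmetical p -> arithmetical (fsubst s r p).
Proof. induction p; simpl; intuition eauto. Qed.

Definition alternate {A : Type} (f g : nat -> A) (n : nat) : A :=
  if Nat.even n then f (Nat.div2 n) else g (Nat.div2 n).

Lemma alternate_even {A} (f g : nat -> A) i : alternate f g (2 * i) = f i.
Proof.
  unfold alternate. rewrite Nat.even_mul, Nat.div2_double. reflexivity.
Qed.

Lemma alternate_odd {A} (f g : nat -> A) i : alternate f g (S (2 * i)) = g i.
Proof.
  unfold alternate. rewrite Nat.even_succ, Nat.odd_mul, Nat.div2_succ_double. reflexivity.
Qed.

(** Two formulas bring their own parameters. Interleaving puts those of [p] at even and those of [q]
    at odd places; the renamings [s] and [z] leave the [k] context numbers and the context set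
    fixed. *)
Lemma merge k P Q : Def k P -> Def k Q -> exists p q r x,
  arithmetical p /\ arithmetical q
  /\ (forall c, sat M (cenv k r c) (scons (cset k c) x) p <-> P c)
  /\ (forall c, sat M (cenv k r c) (scons (cset k c) x) q <-> Q c).
Proof.
  intros (p & r & x & Ap & Hp) (q & r' & x' & Aq & Hq).
  set (s (h : nat -> nat) := fun i => if i <? k then Var i else Var (k + h (i - k)%nat)%nat).
  set (z (h : nat -> nat) := fun j => match j with O => O | S j => S (h j) end).
  assert (E : forall h r0 r1 (x0 x1 : nat -> set M), (forall i, r1 (h i) = r0 i) ->
    (forall i, x1 (h i) = x0 i) -> forall a c,
    (sat M (cenv k r1 c) (scons (cset k c) x1) (fsubst (s h) (z h) a)
     <-> sat M (cenv k r0 c) (scons (cset k c) x0) a)).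
  { intros h r0 r1 x0 x1 Hr Hx a c. rewrite sat_fsubst.
    replace (fun n => teval _ _ _) with (cenv k r0 c).
    - replace (fun n => scons _ _ _) with (scons (cset k c) x0); [tauto|].
      extensionality n. destruct n; simpl; auto.
    - extensionality n. unfold s. destruct (Nat.ltb_spec n k); simpl.
      + apply cenv_lt; assumption.
      + rewrite cenv_ge, Hr. replace n with (k + (n - k))%nat at 1 by lia. apply cenv_ge. }
  exists (fsubst (s (fun i => 2 * i)%nat) (z (fun i => 2 * i)%nat) p),
    (fsubst (s (fun i => S (2 * i))) (z (fun i => S (2 * i))) q),
    (alternate r r'), (alternate x x').
  repeat split; intros; try apply arithmetical_fsubst; auto;
    try (eapply Hp, E; [| |eassumption]); try (eapply Hq, E; [| |eassumption]);
    try (eapply E; [| |apply Hp; assumption]); try (eapply E; [| |apply Hq; assumption]);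
    intros; (apply alternate_even || apply alternate_odd).
Qed.

Lemma Def_equiv k P Q : (forall c, P c <-> Q c) -> Def k P -> Def k Q.
Proof.
  intros H (p & r & x & A & Hp). exists p, r, x. split; [exact A|].
  intro c. rewrite Hp. apply H.
Qed.

Lemma Def_imp k P Q : Def k P -> Def k Q -> Def k (fun c => P c -> Q c).
Proof.
  intros HP HQ. destruct (merge _ _ _ HP HQ) as (p & q & r & x & Ap & Aq & Hp & Hq).
  exists (Imp p q), r, x. split; [split; assumption|].
  intro c. simpl. rewrite Hp, Hq. tauto.
Qed.

Lemma Def_all k (P : ctx k -> num M -> Prop) :
  Def (S k) (fun c => P (fst c) (snd c)) -> Def k (fun c => forall n, P c n).
Proof.
  intros (p & r & x & Ap & Hp). exists (ForallN p), r, x. split; [exact Ap|].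
  intro c. simpl. split; intros H n; specialize (H n); apply (Hp (c, n)), H.
Qed.

Lemma Def_False (k : nat) (xi : nat -> set M) (rho : nat -> num M) : Def k (fun _ => False).
Proof. exists Bot, rho, xi. simpl. split; [exact I|tauto]. Qed.

Lemma Def_weak k P : Def k P -> Def (S k) (fun c => P (fst c)).
Proof.
  intros (p & r & x & Ap & Hp). exists (shiftN p), r, x.
  split; [apply arithmetical_fsubst, Ap|]. intro c. unfold shiftN.
  rewrite sat_fsubst. apply (Hp (fst c)).
Qed.

Lemma DefF_weak k f : DefF k f -> DefF (S k) (fun c => f (fst c)).
Proof.
  intros (p & r & x & Ap & Hp).
  (* Variable 0 is the value of the function and variable 1 the newly added context number, which
     the substitution skips. *)
  exists (fsubst (scons (Var 0) (fun n => Var (S (S n)))) (fun j => j) p), r, x.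
  split; [apply arithmetical_fsubst, Ap|]. intro c. rewrite sat_fsubst.
  rewrite <- (Hp (fst (fst c), snd c)). simpl.
  replace (fun n => teval M _ _) with (scons (snd c) (cenv k r (fst (fst c)))); [tauto|].
  extensionality n. destruct n; reflexivity.
Qed.

Lemma DefF_proj k k' h (f : ctx k' -> num M) :
  IsProj k k' h -> DefF k' f -> DefF k (fun c => f (h c)).
Proof.
  intro H. revert f. induction H; intros f Hf; [exact Hf|].
  apply (IHIsProj (fun c => f (fst c))), DefF_weak, Hf.
Qed.

Lemma DefS_proj k k' h (g : ctx k' -> set M) :
  IsProj k k' h -> DefS k' g -> DefS k (fun c => g (h c)).
Proof.
  intro H. revert g. induction H; intros g Hg; [exact Hg|].
  apply (IHIsProj (fun c => g (fst c))). destruct Hg as [[X HX]|HX].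
  - left. exists X. intro c. apply HX.
  - right. intro c. apply HX.
Qed.

Lemma DefS_const k X : DefS k (fun _ => X).
Proof. left. exists X. reflexivity. Qed.

Lemma DefS_set : DefS 0 (fun c => c).
Proof. right. reflexivity. Qed.

Context {HM : ATR0_model M}.

Lemma Def_neg k P : Def k P -> Def k (fun c => ~ P c).
Proof.
  intro H. apply Def_imp; [exact H|]. destruct set_inhabited as [X].
  exact (Def_False k (fun _ => X) (fun _ => 0)).
Qed.

Lemma Def_and k P Q : Def k P -> Def k Q -> Def k (fun c => P c /\ Q c).
Proof.
  intros HP HQ. apply Def_equiv with (fun c => ~ (P c -> ~ Q c)); [intro c; tauto|].
  apply Def_neg, Def_imp, Def_neg; assumption.
Qed.

Lemma Def_or k P Q : Def k P -> Def k Q -> Def k (fun c => P c \/ Q c).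
Proof.
  intros HP HQ. apply Def_equiv with (fun c => ~ P c -> Q c); [intro c; tauto|].
  apply Def_imp; [apply Def_neg|]; assumption.
Qed.

Lemma Def_iff k P Q : Def k P -> Def k Q -> Def k (fun c => P c <-> Q c).
Proof. intros HP HQ. apply Def_and; apply Def_imp; assumption. Qed.

Lemma Def_ex k (P : ctx k -> num M -> Prop) :
  Def (S k) (fun c => P (fst c) (snd c)) -> Def k (fun c => exists n, P c n).
Proof.
  intro H. apply Def_equiv with (fun c => ~ forall n, ~ P c n).
  - intro c. split; [apply not_all_not_ex|firstorder].
  - apply Def_neg, Def_all. exact (Def_neg _ _ H).
Qed.

Lemma Def_atom k p P : arithmetical p ->
  (forall c r x, sat M (cenv k r c) (scons (cset k c) x) p <-> P c) -> Def k P.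
Proof.
  intros A H. destruct set_inhabited as [X].
  exists p, (fun _ => 0), (fun _ => X). split; [exact A|]. intro c. apply H.
Qed.

Lemma DefF_snd k : DefF (S k) (fun c => snd c).
Proof. apply (Def_atom _ (EqN (Var 0) (Var 1))); [exact I|]. intros; reflexivity. Qed.

Lemma DefF_const k v : DefF k (fun _ => v).
Proof.
  destruct set_inhabited as [X].
  exists (EqN (Var 0) (Var (S k))), (fun _ => v), (fun _ => X). split; [exact I|].
  intro c. simpl. pose proof (cenv_ge k (fun _ => v) (fst c) 0) as E. rewrite Nat.add_0_r in E.
  rewrite E. tauto.
Qed.

(** Two-place atoms and operations reduce to atoms on variables by naming the
    arguments with existential quantifiers. *)
Lemma Def_binary k (R : num M -> num M -> Prop) f g :
  (forall k, Def (S (S k)) (fun c => R (snd (fst c)) (snd c))) ->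
  DefF k f -> DefF k g -> Def k (fun c => R (f c) (g c)).
Proof.
  intros HR Hf Hg.
  apply Def_equiv with (fun c => exists a b, a = f c /\ b = g c /\ R a b).
  { intro c. split; [intros (a & b & -> & -> & H); exact H|eauto]. }
  apply Def_ex, (Def_ex (S k) (fun (c : ctx (S k)) b => snd c = f (fst c) /\ b = g (fst c) /\ R (snd c) b)).
  apply Def_and; [|apply Def_and].
  - apply (Def_weak _ _ Hf).
  - apply (DefF_weak _ _ Hg).
  - apply HR.
Qed.

Lemma Def_eq k f g : DefF k f -> DefF k g -> Def k (fun c => f c = g c).
Proof.
  apply Def_binary. intro k'. apply (Def_atom _ (EqN (Var 1) (Var 0))); [exact I|].
  intros; reflexivity.
Qed.

Lemma Def_lt k f g : DefF k f -> DefF k g -> Def k (fun c => f c < g c).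
Proof.
  apply Def_binary. intro k'. apply (Def_atom _ (LtN (Var 1) (Var 0))); [exact I|].
  intros; reflexivity.
Qed.

Lemma Def_mem k f g : DefF k f -> DefS k g -> Def k (fun c => f c ∈ g c).
Proof.
  intros Hf Hg.
  apply Def_equiv with (fun c => exists a, a = f c /\ a ∈ g c).
  { intro c. split; [intros (a & -> & H); exact H|eauto]. }
  apply Def_ex, Def_and; [exact Hf|]. destruct Hg as [[X HX]|HX].
  - exists (Mem (Var 0) 1), (fun _ => 0), (fun _ => X). split; [exact I|].
    intro c. simpl. rewrite HX. tauto.
  - apply (Def_atom _ (Mem (Var 0) 0)); [exact I|]. intros c r x. simpl. rewrite HX. tauto.
Qed.

Lemma DefF_binary k (op : num M -> num M -> num M) f g :
  (forall k, Def (S (S (S k))) (fun c => snd (fst (fst c)) = op (snd (fst c)) (snd c))) ->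
  DefF k f -> DefF k g -> DefF k (fun c => op (f c) (g c)).
Proof.
  intros Hop Hf Hg.
  apply Def_equiv with (fun c => exists a b, a = f (fst c) /\ b = g (fst c) /\ snd c = op a b).
  { intro c. split; [intros (a & b & -> & -> & H); exact H|eauto]. }
  apply Def_ex, (Def_ex (S (S k)) (fun (c : ctx (S (S k))) b =>
    snd c = f (fst (fst c)) /\ b = g (fst (fst c)) /\ snd (fst c) = op (snd c) b)).
  apply Def_and; [|apply Def_and].
  - apply (Def_weak _ _ (DefF_weak _ _ Hf)).
  - apply (DefF_weak _ _ (DefF_weak _ _ Hg)).
  - apply Hop.
Qed.

Lemma DefF_add k f g : DefF k f -> DefF k g -> DefF k (fun c => f c + g c).
Proof.
  apply DefF_binary. intro k'.
  apply (Def_atom _ (EqN (Var 2) (AddN (Var 1) (Var 0)))); [exact I|]. intros; reflexivity.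
Qed.

Lemma DefF_mul k f g : DefF k f -> DefF k g -> DefF k (fun c => f c * g c).
Proof.
  apply DefF_binary. intro k'.
  apply (Def_atom _ (EqN (Var 2) (MulN (Var 1) (Var 0)))); [exact I|]. intros; reflexivity.
Qed.

Lemma DefF_pair k f g : DefF k f -> DefF k g -> DefF k (fun c => ⟨f c, g c⟩).
Proof. intros Hf Hg. unfold mpair. auto using DefF_add, DefF_mul. Qed.

Definition chi (P : Prop) : num M := if excluded_middle_informative P then 1 else 0.

Lemma chi_true (P : Prop) : P -> chi P = 1.
Proof. unfold chi. destruct excluded_middle_informative; tauto. Qed.

Lemma chi_false (P : Prop) : ~ P -> chi P = 0.
Proof. unfold chi. destruct excluded_middle_informative; tauto. Qed.

Lemma chi_iff (P Q : Prop) : (P <-> Q) -> chi P = chi Q.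
Proof. unfold chi. intro. do 2 destruct excluded_middle_informative; tauto. Qed.

Lemma DefF_chi p (P : ctx p -> Prop) : Def p P -> DefF p (fun c => chi (P c)).
Proof.
  intro H. apply Def_equiv with
    (fun c => (P (fst c) /\ snd c = 1) \/ (~ P (fst c) /\ snd c = 0)).
  - intro c. destruct (classic (P (fst c))) as [HP|HP].
    + rewrite (chi_true _ HP). tauto.
    + rewrite (chi_false _ HP). tauto.
  - pose proof (Def_weak _ _ H) as H'.
    apply Def_or; apply Def_and; [exact H'| |apply Def_neg, H'|];
      apply Def_eq; auto using DefF_snd, DefF_const.
Qed.

Lemma comprehension_Def (P : num M -> Prop) :
  Def 1 (fun c => P (snd c)) -> exists X, forall n, n ∈ X <-> P n.
Proof.
  intros (p & r & x & Ap & Hp). destruct set_inhabited as [X0].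
  destruct (comprehension_sat p Ap r (scons X0 x)) as [X HX].
  exists X. intro n. rewrite HX. apply (Hp (X0, n)).
Qed.

Lemma induction_Def (P : num M -> Prop) : Def 1 (fun c => P (snd c)) ->
  P 0 -> (forall n, P n -> P (n + 1)) -> forall n, P n.
Proof.
  intros HP H0 HS. destruct (comprehension_Def P HP) as [X HX].
  intro n. apply HX. apply set_ind. split; [apply HX, H0|].
  intros m Hm. apply HX, HS, HX, Hm.
Qed.

Lemma recursion_Def (P : num M -> set M -> Prop) (X : set M) :
  Def 1 (fun c => P (snd c) (fst c)) -> IsWO X ->
  exists Y, forall c, c ∈ Y <-> exists n j, c = ⟨n, j⟩ /\ InField j X /\
    exists Z, IsBelow X Y j Z /\ P n Z.
Proof.
  intros (p & r & x & Ap & Hp) HX.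
  destruct (recursion_sat p Ap r x X HX) as (Y & _ & HY).
  exists Y. intro c. rewrite HY.
  split; intros (n & j & E & Hj & Z & HZ & H); exists n, j; (split; [exact E|]);
    (split; [exact Hj|]); exists Z; (split; [exact HZ|]); apply (Hp (Z, n)), H.
Qed.

End Definability.

(** * Automation for definability proofs *)

Ltac def_proj :=
  lazymatch goal with
  | |- IsProj ?k _ (fun c => c) => exact (proj_id k)
  | |- IsProj ?k ?k' (@fst _ _) => exact (proj_fst k k' (fun c => c) (proj_id k))
  | |- IsProj ?k ?k' (fun c => fst (@?h c)) => refine (proj_fst k k' h _); def_proj
  end.

Create HintDb def_fun.

Ltac def_depth k h :=
  lazymatch h with
  | (fun c => c) => k
  | @fst _ _ => lazymatch k with S ?k2 => k2 end
  | (fun c => fst (@?h' c)) =>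
      let k1 := def_depth k h' in
      lazymatch k1 with S ?k2 => k2 end
  end.

Ltac def_set :=
  lazymatch goal with
  | |- DefS _ (fun c => c) => apply DefS_set
  | |- DefS _ (fun c => @?h c) =>
      first [apply DefS_const | apply (DefS_proj _ 0 h (fun c => c)); [def_proj|exact DefS_set]]
  | |- DefS _ (@fst _ _) =>
      apply (DefS_proj _ 0 (fun c => fst c) (fun c => c)); [def_proj|exact DefS_set]
  end.

(** Definability is read off from the syntactic shape. A bound variable appears as [snd] of an
    iterated [fst] of the context, and [def_depth] counts the projections to find the arity at which
    it was introduced. *)
Ltac def_fun :=
  lazymatch goal with
  | |- DefF (S ?k) (fun c => snd c) => exact (DefF_snd k)
  | |- DefF (S ?k) (@snd _ _) => exact (DefF_snd k)
  | |- DefF ?k (fun c => snd (@?h c)) =>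
      let k' := def_depth k h in
      apply (DefF_proj k k' h (fun c => snd c)); [def_proj|def_fun]
  | |- DefF _ (fun c => chi _) => apply DefF_chi; def
  | |- DefF _ (fun c => mpair _ _) => apply DefF_pair; def_fun
  | |- DefF _ (fun c => m_add _ _) => apply DefF_add; def_fun
  | |- DefF _ (fun c => m_mul _ _) => apply DefF_mul; def_fun
  | H : DefF _ ?f |- DefF _ ?f => exact H
  | H : DefF ?k' ?f |- DefF ?k (fun c => ?f (@?h c)) =>
      apply (DefF_proj k k' h f); [def_proj|exact H]
  | |- _ => first [apply DefF_const | solve [auto with def_fun]]
  end

with def :=
  lazymatch goal with
  | |- DefF _ _ => def_fun
  | |- Def _ (fun c => _ /\ _) => apply Def_and; def
  | |- Def _ (fun c => _ \/ _) => apply Def_or; def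
  | |- Def _ (fun c => _ <-> _) => apply Def_iff; def
  | |- Def _ (fun c => ~ _) => apply Def_neg; def
  | |- Def _ (fun c => _ = _) => apply Def_eq; def_fun
  | |- Def _ (fun c => m_lt _ _) => apply Def_lt; def_fun
  | |- Def _ (fun c => m_mem _ _) => apply Def_mem; [def_fun|def_set]
  | |- Def _ (fun c => exists x, _) => apply Def_ex; cbv beta; def
  | |- Def _ (fun c => forall x : num _, _) => apply Def_all; cbv beta; def
  | |- Def _ (fun c => _ -> _) => apply Def_imp; def
  | |- _ => solve [auto with def]
  end.

#[local] Hint Extern 1 (DefF _ _) => def_fun : def.

(** * Arithmetic in a model *)

Definition mle {M : model} (x y : num M) : Prop := x < y \/ x = y.
Notation "x <= y" := (mle x y) : model_scope.

Ltac induct x := revert x; refine (induction_Def _ _ _ _); [def| |].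

Section Semiring.

Context {M : model} {HM : ATR0_model M}.
Implicit Types x y z n m i j k d e s t l a b u v q r : num M.

Lemma add_0_l x : 0 + x = x.
Proof.
  induct x; [apply add_0|]. intros x H. rewrite add_S, H. reflexivity.
Qed.

Lemma add_S_l x y : (x + 1) + y = (x + y) + 1.
Proof.
  induct y; [rewrite !add_0; reflexivity|]. intros y H. rewrite !add_S, H. reflexivity.
Qed.

Lemma add_comm x y : x + y = y + x.
Proof.
  induct y; [rewrite add_0, add_0_l; reflexivity|].
  intros y H. rewrite add_S, add_S_l, H. reflexivity.
Qed.

Lemma add_assoc x y z : x + (y + z) = (x + y) + z.
Proof.
  induct z; [rewrite !add_0; reflexivity|]. intros z H. rewrite !add_S, H. reflexivity.
Qed.

Lemma mul_0_l x : 0 * x = 0.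
Proof. induct x; [apply mul_0|]. intros x H. rewrite mul_S, H, add_0. reflexivity. Qed.

Lemma mul_S_l x y : (x + 1) * y = x * y + y.
Proof.
  induct y; [rewrite !mul_0, add_0; reflexivity|].
  intros y H. rewrite !mul_S, H, !add_S. f_equal.
  rewrite <- !add_assoc. f_equal. apply add_comm.
Qed.

Lemma mul_comm x y : x * y = y * x.
Proof.
  induct y; [rewrite mul_0, mul_0_l; reflexivity|].
  intros y H. rewrite mul_S, mul_S_l, H. reflexivity.
Qed.

Lemma mul_add x y z : (x + y) * z = x * z + y * z.
Proof.
  induct z; [rewrite !mul_0, add_0; reflexivity|].
  intros z H. rewrite !mul_S, H, <- !add_assoc. f_equal.
  rewrite !add_assoc. f_equal. apply add_comm.
Qed.

Lemma mul_assoc x y z : x * (y * z) = (x * y) * z.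
Proof.
  induct z; [rewrite !mul_0; reflexivity|].
  intros z H. rewrite !mul_S, <- H, (mul_comm x), mul_add, !(mul_comm x). reflexivity.
Qed.

Lemma mul_1_l x : 1 * x = x.
Proof. rewrite <- (add_0_l 1), mul_S_l, mul_0_l, add_0_l. reflexivity. Qed.

Lemma model_semiring : semi_ring_theory 0 1 m_add m_mul (@eq (num M)).
Proof.
  constructor; auto using add_0_l, add_comm, add_assoc, mul_1_l, mul_0_l, mul_comm,
    mul_assoc, mul_add.
Qed.

End Semiring.

Section Arithmetic.

Context {M : model} {HM : ATR0_model M}.
Implicit Types x y z n m i j k d e s t l a b u v q r : num M.
Add Ring model_ring : (@model_semiring M HM).

Lemma add_cancel z x y : x + z = y + z -> x = y.
Proof.
  induct z; [rewrite !add_0; auto|]. intros z H. rewrite !add_S. intro E.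
  apply H, succ_inj, E.
Qed.

Lemma zero_or_succ x : x = 0 \/ exists y, x = y + 1.
Proof. induct x; [left; reflexivity|]. intros x _. right. exists x. reflexivity. Qed.

(** Trades an inequality for an equation with a witness, after which [ring] applies. *)
Lemma lt_iff x y : x < y <-> exists z, y = x + z + 1.
Proof.
  induct y.
  - split; [intro H; destruct (lt_0 _ H)|].
    intros [z H]. destruct (succ_nz (x + z)). congruence.
  - intros y IH. rewrite lt_S, IH. split.
    + intros [[z ->]| ->]; [exists (z + 1); ring|exists 0; ring].
    + intros [z H]. apply succ_inj in H. destruct (zero_or_succ z) as [->|[w ->]].
      * right. rewrite H. ring.
      * left. exists w. rewrite H. ring.
Qed.

Lemma le_iff x y : x <= y <-> exists z, y = x + z.
Proof.
  unfold mle. rewrite lt_iff. split.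
  - intros [[z ->]| ->]; [exists (z + 1)|exists 0]; ring.
  - intros [z ->]. destruct (zero_or_succ z) as [->|[w ->]].
    + right. ring.
    + left. exists w. ring.
Qed.

Lemma lt_irrefl x : ~ x < x.
Proof.
  rewrite lt_iff. intros [z H]. apply (succ_nz z).
  apply (add_cancel x). transitivity x; [|ring]. symmetry. rewrite H at 1. ring.
Qed.

Lemma lt_trans x y z : x < y -> y < z -> x < z.
Proof. rewrite !lt_iff. intros [u ->] [v ->]. exists (u + v + 1). ring. Qed.

Lemma le_refl x : x <= x.
Proof. right; reflexivity. Qed.

Lemma lt_le x y : x < y -> x <= y.
Proof. left; assumption. Qed.

Lemma le_lt_trans x y z : x <= y -> y < z -> x < z.
Proof. intros [H| ->] H'; [eapply lt_trans; eassumption|exact H']. Qed.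

Lemma lt_le_trans x y z : x < y -> y <= z -> x < z.
Proof. intros H [H'|<-]; [eapply lt_trans; eassumption|exact H]. Qed.

Lemma le_trans x y z : x <= y -> y <= z -> x <= z.
Proof. intros [H| ->] H'; [left; eapply lt_le_trans; eassumption|exact H']. Qed.

Lemma lt_succ_le x y : x < y + 1 <-> x <= y.
Proof. apply lt_S. Qed.

Lemma le_succ_lt x y : x + 1 <= y <-> x < y.
Proof.
  rewrite le_iff, lt_iff. split; intros [z ->]; exists z; ring.
Qed.

Lemma lt_succ_r x : x < x + 1.
Proof. apply lt_S. right; reflexivity. Qed.

Lemma lt_total x y : x < y \/ x = y \/ y < x.
Proof.
  induct y.
  - destruct (zero_or_succ x) as [->|[y ->]]; [tauto|]. right; right.
    apply lt_iff. exists y. ring.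
  - intros y [H|[->|H]].
    + left. apply lt_S. tauto.
    + left. apply lt_succ_r.
    + apply le_succ_lt in H. destruct H as [H|H]; [tauto|]. right; left; congruence.
Qed.

Lemma le_or_lt x y : x <= y \/ y < x.
Proof. unfold mle. destruct (lt_total x y) as [|[|]]; tauto. Qed.

Lemma le_not_lt x y : x <= y -> ~ y < x.
Proof. intros H H'. apply (lt_irrefl x). eapply le_lt_trans; eassumption. Qed.

Lemma le_antisym x y : x <= y -> y <= x -> x = y.
Proof. intros [H|H] H'; [|exact H]. destruct (le_not_lt _ _ H' H). Qed.

Lemma zero_le x : 0 <= x.
Proof. apply le_iff. exists x. ring. Qed.

Lemma lt_0_succ x : 0 < x + 1.
Proof. apply lt_succ_le, zero_le. Qed.

Lemma le_add_l x y : x <= x + y.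
Proof. apply le_iff. exists y. reflexivity. Qed.

Lemma le_add_r x y : y <= x + y.
Proof. apply le_iff. exists x. ring. Qed.

Lemma add_le x y x' y' : x <= x' -> y <= y' -> x + y <= x' + y'.
Proof. rewrite !le_iff. intros [a ->] [b ->]. exists (a + b). ring. Qed.

Lemma add_lt_le x y x' y' : x < x' -> y <= y' -> x + y < x' + y'.
Proof. rewrite le_iff, !lt_iff. intros [a ->] [b ->]. exists (a + b). ring. Qed.

Lemma add_lt_cancel z x y : x + z < y + z <-> x < y.
Proof.
  rewrite !lt_iff. split; intros [w H]; exists w.
  - apply (add_cancel z). rewrite H. ring.
  - rewrite H. ring.
Qed.

Lemma mul_le x y x' y' : x <= x' -> y <= y' -> x * y <= x' * y'.
Proof.
  rewrite !le_iff. intros [a ->] [b ->]. exists (x * b + a * y + a * b). ring.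
Qed.

Lemma le_mul_r x y : 0 < y -> x <= x * y.
Proof. rewrite lt_iff, le_iff. intros [z ->]. exists (x * z). ring. Qed.

Lemma le_0 x : x <= 0 -> x = 0.
Proof. intros [H|H]; [destruct (lt_0 _ H)|exact H]. Qed.

Lemma le_1_cases b : b < #2 -> b = 0 \/ b = 1.
Proof.
  simpl. rewrite lt_S. intros [H| ->]; [|tauto].
  replace 1 with (0 + 1 : num M) in H by ring. rewrite lt_S in H.
  destruct H as [H|H]; [destruct (lt_0 _ H)|tauto].
Qed.

Lemma one_neq_zero : (1 : num M) <> 0.
Proof. rewrite <- (add_0_l 1). apply succ_nz. Qed.

(** ** Pairing *)

Lemma pair_lt x y x' y' : x + y < x' + y' -> ⟨x, y⟩ < ⟨x', y'⟩.
Proof.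
  unfold mpair. rewrite !lt_iff. intros [z E]. rewrite E.
  (* With [x' + y' = x + y + z + 1], the new square exceeds the old one by at least [2(x + y) + 1],
     which absorbs the summand [x]. The witness is the difference of the codes less 1, with
     [2(x + y) - x] written as [(x + y) + y]. *)
  exists (z * z + #2 * (x + y) * z + #2 * z + (x + y) + y + x'). simpl. ring.
Qed.

Lemma pair_inj x y x' y' : ⟨x, y⟩ = ⟨x', y'⟩ -> x = x' /\ y = y'.
Proof.
  intro E. assert (Es : x + y = x' + y').
  { destruct (lt_total (x + y) (x' + y')) as [H|[H|H]]; [|exact H|];
      apply pair_lt in H; rewrite E in H; destruct (lt_irrefl _ H). }
  unfold mpair in E. rewrite Es in E.
  assert (Ex : x = x').
  { apply (add_cancel ((x' + y') * (x' + y'))). rewrite add_comm, E. ring. }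
  split; [exact Ex|]. subst x'. apply (add_cancel x).
  rewrite (add_comm y), (add_comm y'). exact Es.
Qed.

Lemma le_square x : x <= x * x.
Proof.
  destruct (zero_or_succ x) as [->|[y ->]]; [apply zero_le|].
  apply le_mul_r, lt_0_succ.
Qed.

Lemma le_pair_l x y : x <= ⟨x, y⟩.
Proof. apply le_add_r. Qed.

Lemma le_pair_r x y : y <= ⟨x, y⟩.
Proof.
  eapply le_trans; [apply (le_add_r x)|]. eapply le_trans; [apply le_square|apply le_add_l].
Qed.

Lemma numeral_lt (n k : nat) : (n < k)%nat -> (#n : num M) < #k.
Proof.
  assert (E : forall n : nat, (#(S n) : num M) = #n + 1).
  { intros [|n']; [simpl; ring|reflexivity]. }
  induction 1 as [|k _ IH]; rewrite E; [apply lt_succ_r|].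
  eapply lt_trans; [exact IH|apply lt_succ_r].
Qed.

Lemma zero_lt_2 : (0 : num M) < #2.
Proof. apply (numeral_lt 0 2). lia. Qed.

Lemma one_lt_2 : (1 : num M) < #2.
Proof. apply (numeral_lt 1 2). lia. Qed.

Lemma numeral_inj (n k : nat) : (#n : num M) = #k -> n = k.
Proof.
  intro E. destruct (Nat.lt_total n k) as [H|[H|H]]; [|exact H|];
    apply numeral_lt in H; rewrite E in H; destruct (lt_irrefl _ H).
Qed.

(** ** Induction and division *)

Lemma strong_induction (P : num M -> Prop) : Def 1 (fun c => P (snd c)) ->
  (forall n, (forall m, m < n -> P m) -> P n) -> forall n, P n.
Proof.
  intros HP H. destruct (comprehension_Def P HP) as [X HX].
  assert (A : forall n m, m < n -> m ∈ X).
  { intro n. induct n.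
    - intros m Hm. destruct (lt_0 _ Hm).
    - intros n IH m Hm. apply lt_S in Hm. destruct Hm as [Hm| ->]; [auto|].
      apply HX, H. intros k Hk. apply HX, IH, Hk. }
  intro n. apply HX, (A (n + 1)), lt_succ_r.
Qed.

Lemma least (P : num M -> Prop) : Def 1 (fun c => P (snd c)) ->
  (exists n, P n) -> exists n, P n /\ forall m, m < n -> ~ P m.
Proof.
  intros HP [n Hn]. apply NNPP. intro C.
  assert (A : forall n, ~ P n).
  { apply (strong_induction (fun n => ~ P n)); [exact (Def_neg _ _ HP)|].
    intros m Hm Pm. apply C. exists m. auto. }
  exact (A n Hn).
Qed.

Lemma division a m : 0 < m -> exists q r, a = q * m + r /\ r < m.
Proof.
  intro Hm. induct a; [exists 0, 0; split; [ring|exact Hm]|].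
  intros a (q & r & -> & Hr). apply le_succ_lt in Hr. destruct Hr as [Hr|Hr].
  - exists q, (r + 1). split; [ring|exact Hr].
  - exists (q + 1), 0. split; [rewrite <- Hr; ring|exact Hm].
Qed.

Lemma division_unique q r q' r' m : r < m -> r' < m -> q * m + r = q' * m + r' -> r = r'.
Proof.
  assert (A : forall q r q' r', r < m -> q < q' -> q * m + r <> q' * m + r').
  { intros q0 r0 q1 r1 Hr Hq E. apply lt_iff in Hq as [z ->].
    apply (lt_irrefl (q0 * m + r0)). rewrite E at 2.
    apply lt_le_trans with (q0 * m + m).
    - rewrite !(add_comm (q0 * m)). apply add_lt_le; [exact Hr|apply le_refl].
    - apply le_iff. exists (z * m + r1). ring. }
  intros Hr Hr' E. destruct (lt_total q q') as [H|[->|H]].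
  - destruct (A _ _ _ r' Hr H E).
  - apply (add_cancel (q' * m)). rewrite !(add_comm _ (q' * m)). exact E.
  - destruct (A _ _ _ r Hr' H). symmetry; exact E.
Qed.

(** ** Definable relations *)

(** The last clause, that all members are pairs, is what [IsFun] requires of a graph. *)
Lemma comprehension2 (R : num M -> num M -> Prop) :
  Def 2 (fun c => R (snd (fst c)) (snd c)) -> exists X,
  (forall x y, ⟨x, y⟩ ∈ X <-> R x y) /\ forall q, q ∈ X -> exists x y, q = ⟨x, y⟩.
Proof.
  intros (p & r & w & Ap & Hp).
  destruct (comprehension_Def (fun q => exists x y, q = ⟨x, y⟩ /\ R x y)) as [X HX].
  { apply (Def_ex 1 (fun c x => exists y, snd c = ⟨x, y⟩ /\ R x y)).
    apply (Def_ex 2 (fun c y => snd (fst c) = ⟨snd c, y⟩ /\ R (snd c) y)).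
    apply Def_and; [def|].
    (* In the present context the coded pair is variable 2, behind [y] and [x]; the formula [p] does
       not know it, so its parameters are moved up by one. *)
    exists (fsubst (scons (Var 0) (scons (Var 1) (fun o : nat => Var (S (S (S o)))))) (fun o : nat => o) p), r, w.
    split; [apply arithmetical_fsubst, Ap|]. intro c. rewrite sat_fsubst.
    rewrite <- (Hp ((fst (fst (fst c)), snd (fst c)), snd c)). simpl.
    replace (fun o : nat => teval M _ _) with
      (scons (snd c) (scons (snd (fst c)) r)); [tauto|].
    extensionality o. destruct o as [|[|o]]; reflexivity. }
  exists X. split.
  - intros x y. rewrite HX. split; [|eauto].
    intros (x' & y' & E & H). apply pair_inj in E as [-> ->]. exact H.
  - intros q Hq. apply HX in Hq as (x & y & E & _). eauto.
Qed.

Lemma comprehension3 (R : num M -> num M -> num M -> Prop) :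
  Def 3 (fun c => R (snd (fst (fst c))) (snd (fst c)) (snd c)) -> exists X,
  forall x y z, ⟨x, y, z⟩ ∈ X <-> R x y z.
Proof.
  intros (p & r & w & Ap & Hp).
  destruct (comprehension_Def (fun q => exists x y z, q = ⟨x, y, z⟩ /\ R x y z)) as [X HX].
  { apply (Def_ex 1 (fun c x => exists y z, snd c = ⟨x, y, z⟩ /\ R x y z)).
    apply (Def_ex 2 (fun c y => exists z, snd (fst c) = ⟨snd c, y, z⟩ /\ R (snd c) y z)).
    apply (Def_ex 3 (fun c z => snd (fst (fst c)) = ⟨snd (fst c), snd c, z⟩ /\ R (snd (fst c)) (snd c) z)).
    apply Def_and; [def|].
    exists (fsubst (scons (Var 0) (scons (Var 1) (scons (Var 2)
      (fun o : nat => Var (S (S (S (S o)))))))) (fun o : nat => o) p), r, w.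
    split; [apply arithmetical_fsubst, Ap|]. intro c. rewrite sat_fsubst.
    rewrite <- (Hp (((fst (fst (fst (fst c))), snd (fst (fst c))), snd (fst c)), snd c)). simpl.
    replace (fun o : nat => teval M _ _) with
      (scons (snd c) (scons (snd (fst c)) (scons (snd (fst (fst c))) r))); [tauto|].
    extensionality o. destruct o as [|[|[|o]]]; reflexivity. }
  exists X. intros x y z. rewrite HX. split; [|eauto 6].
  intros (x' & y' & z' & E & H). apply pair_inj in E as [-> E].
  apply pair_inj in E as [-> ->]. exact H.
Qed.

End Arithmetic.

(** * Coded sequences *)

Lemma Def_mle {M : model} {HM : ATR0_model M} p (f g : ctx p -> num M) :
  DefF p f -> DefF p g -> Def p (fun c => f c <= g c).
Proof. intros. unfold mle. def. Qed.

#[local] Hint Resolve Def_mle : def.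

Section Sequences.

Context {M : model} {HM : ATR0_model M}.
Implicit Types x y z n m i j k d e s t l a b u v q r : num M.
Implicit Types X Y Z F T : set M.
Add Ring model_ring : (@model_semiring M HM).

(** In effect [b] is [B] times the factorial of [l]. Its size makes the moduli [1 + (i + 1) * b]
    exceed all entries to be coded, and its divisors make them coprime in pairs. *)
Lemma common_multiple l B :
  exists b, B <= b /\ forall d, 0 < d -> d <= l -> exists w, b = d * w.
Proof.
  induct l.
  - exists B. split; [apply le_refl|]. intros d H H'. apply le_0 in H'. subst d.
    destruct (lt_irrefl _ H).
  - intros l (b & Hb & H). exists (b * (l + 1)). split.
    + eapply le_trans; [exact Hb|]. apply le_mul_r, lt_0_succ.
    + intros d Hd [Hl| ->].
      * destruct (H d Hd) as [w ->]; [apply lt_succ_le, Hl|]. exists (w * (l + 1)). ring.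
      * exists b. ring.
Qed.

(** The Bezout identity behind the coprimality of the moduli used by [Beta],
    with all subtractions moved to the other side. *)
Lemma moduli_coprime b i d w : b = d * w ->
  exists u v, (1 + (i + 1) * b) * u = 1 + v * (1 + (i + d + 1) * b).
Proof.
  intros ->. set (j := i + d).
  (* Let [m_i = 1 + (i + 1) b]. From [(j + 1) m_i - (i + 1) m_j = d] and [b = d w], an inverse of
     [m_i] modulo [m_j] is [1 - (i + 1)(j + 1) w]. The subtraction vanishes on replacing -1 by
     [(j + 1) b], to which it is congruent modulo [m_j]. *)
  exists (1 + (i + 1) * w * (j + 1) * ((j + 1) * (d * w))),
    ((i + 1) * w * (d + (j + 1) * (i + 1) * (d * w))).
  unfold j. ring.
Qed.

Lemma Beta_total a b i : exists y, Beta a b i y.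
Proof.
  destruct (division a (1 + (i + 1) * b)) as (q & r & E & H).
  - rewrite add_comm. apply lt_0_succ.
  - exists r. split; [exact H|]. exists q. exact E.
Qed.

Lemma Beta_unique a b i y z : Beta a b i y -> Beta a b i z -> y = z.
Proof.
  intros (H & q & E) (H' & q' & E').
  eapply division_unique; [exact H|exact H'|]. rewrite <- E. exact E'.
Qed.

(** Chinese remaindering, one modulus at a time: [a] has the right remainders below [k], while [m]
    is a multiple of the moduli already treated and invertible modulo the others. [X] may be
    many-valued; the choices of entries are made within the induction. *)
Lemma beta_exists X l : (forall i, i < l -> exists y, ⟨i, y⟩ ∈ X) ->
  exists a b, forall i, i < l -> exists y, ⟨i, y⟩ ∈ X /\ Beta a b i y.
Proof.
  intro HX.
  assert (HB : exists B, forall i, i < l -> exists y, ⟨i, y⟩ ∈ X /\ y <= B).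
  { revert HX. induct l; [intros _; exists 0; intros i Hi; destruct (lt_0 _ Hi)|].
    intros l IH HX. destruct IH as [B HB].
    { intros i Hi. apply HX. eapply lt_trans; [exact Hi|apply lt_succ_r]. }
    destruct (HX l (lt_succ_r l)) as [y Hy]. exists (B + y). intros i Hi.
    apply lt_S in Hi as [Hi| ->].
    - destruct (HB i Hi) as (z & Hz & Hle). exists z. split; [exact Hz|].
      eapply le_trans; [exact Hle|apply le_add_l].
    - exists y. split; [exact Hy|apply le_add_r]. }
  destruct HB as [B HB]. destruct (common_multiple l B) as (b & Hb & Hmul).
  assert (H : forall k, k <= l -> exists a m,
    (forall i, i < k -> exists y, ⟨i, y⟩ ∈ X /\
       y < 1 + (i + 1) * b /\ exists q, a = q * (1 + (i + 1) * b) + y)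
    /\ (forall i, i < k -> exists w, m = w * (1 + (i + 1) * b))
    /\ (forall j, k <= j -> j < l -> exists u v, m * u = 1 + v * (1 + (j + 1) * b))).
  { assert (D : Def 1 (fun c => snd c <= l)) by (unfold mle; def).
    intro k. revert k. refine (induction_Def _ _ _ _).
    - apply Def_imp; [exact D|]. unfold mle. def.
    - intros _. exists 0, 1. split; [|split].
      + intros i Hi. destruct (lt_0 _ Hi).
      + intros i Hi. destruct (lt_0 _ Hi).
      + intros j _ _. exists 1, 0. ring.
    - intros k IH Hk. apply le_succ_lt in Hk.
      destruct IH as (a & m & H1 & H2 & H3); [left; exact Hk|].
      destruct (HB k Hk) as (y & Hy & HyB).
      destruct (H3 k (le_refl k) Hk) as (u & v & Huv).
      (* Modulo the new modulus [m * u] is 1, so this number is congruent to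
         [a + y + a * ((k + 1) * b)], that is, to [y] plus a multiple of the modulus. Here
         [(k + 1) * b] stands for -1. The old remainders survive since a multiple of [m] is
         added. *)
      exists (a + m * (u * (y + a * ((k + 1) * b)))), (m * (1 + (k + 1) * b)).
      split; [|split].
      + intros i Hi. apply lt_S in Hi as [Hi| ->].
        * destruct (H1 i Hi) as (z & Hz & Hlt & q & ->).
          destruct (H2 i Hi) as [w ->]. exists z. split; [exact Hz|]. split; [exact Hlt|].
          eexists (q + w * (u * (y + (q * (1 + (i + 1) * b) + z) * ((k + 1) * b)))). ring.
        * exists y. split; [exact Hy|]. split.
          -- eapply le_lt_trans; [exact HyB|]. eapply le_lt_trans; [exact Hb|].
             apply lt_iff. exists (k * b). ring.
          -- exists (a + v * (y + a * ((k + 1) * b))).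
             transitivity (a + (m * u) * (y + a * ((k + 1) * b))); [ring|].
             rewrite Huv. ring.
      + intros i Hi. apply lt_S in Hi as [Hi| ->].
        * destruct (H2 i Hi) as [w ->]. exists (w * (1 + (k + 1) * b)). ring.
        * exists m. ring.
      + intros j Hkj Hj. apply le_succ_lt in Hkj.
        destruct (H3 j (lt_le _ _ Hkj) Hj) as (u1 & v1 & E1).
        apply lt_iff in Hkj as [z ->].
        destruct (Hmul (z + 1)) as [w Hw]; [apply lt_0_succ| |].
        { left. eapply le_lt_trans; [|exact Hj]. apply le_iff. exists k. ring. }
        destruct (moduli_coprime b k (z + 1) w Hw) as (u2 & v2 & E2).
        replace (k + (z + 1) + 1) with (k + z + 1 + 1) in E2 by ring.
        exists (u1 * u2), (v1 + v2 + v1 * v2 * (1 + (k + z + 1 + 1) * b)).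
        transitivity ((m * u1) * ((1 + (k + 1) * b) * u2)); [ring|].
        rewrite E1, E2. ring. }
  destruct (H l (le_refl l)) as (a & m & Ha & _). exists a, b. exact Ha.
Qed.

Lemma Len_unique {s l k} : Len s l -> Len s k -> l = k.
Proof. intros (a & b & ->) (a' & b' & E). apply pair_inj in E. apply E. Qed.

Lemma Entry_unique {s i x y} : Entry s i x -> Entry s i y -> x = y.
Proof.
  intros (l & a & b & -> & _ & H) (l' & a' & b' & E & _ & H').
  apply pair_inj in E as [_ E]. apply pair_inj in E as [<- <-].
  eapply Beta_unique; eassumption.
Qed.

Lemma Entry_lt {s i x l} : Len s l -> Entry s i x -> i < l.
Proof.
  intros (a & b & ->) (l' & a' & b' & E & H & _). apply pair_inj in E as [-> _]. exact H.
Qed.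

Lemma Entry_total s i l : Len s l -> i < l -> exists x, Entry s i x.
Proof.
  intros (a & b & ->) H. destruct (Beta_total a b i) as [y Hy]. exists y, l, a, b. auto.
Qed.

Lemma Len_le s l : Len s l -> l <= s.
Proof. intros (a & b & ->). apply le_pair_l. Qed.

Lemma Entry_index_lt s i x : Entry s i x -> i < s.
Proof.
  intros (l & a & b & -> & H & _). eapply lt_le_trans; [exact H|apply le_pair_l].
Qed.

Lemma Entry_le s i x : Entry s i x -> x <= s.
Proof.
  intros (l & a & b & -> & _ & _ & q & ->).
  eapply le_trans; [|apply le_pair_r]. eapply le_trans; [|apply le_pair_l]. apply le_add_r.
Qed.

Lemma Def_Len p (f g : ctx p -> num M) : DefF p f -> DefF p g -> Def p (fun c => Len (f c) (g c)).
Proof. intros. unfold Len. def. Qed.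

Lemma Def_Entry p (f g h : ctx p -> num M) : DefF p f -> DefF p g -> DefF p h ->
  Def p (fun c => Entry (f c) (g c) (h c)).
Proof. intros. unfold Entry, Beta. def. Qed.

End Sequences.

#[local] Hint Resolve Def_Len Def_Entry : def.

Section Sequences.

Context {M : model} {HM : ATR0_model M}.
Implicit Types x y z n m i j k d e s t l a b u v q r : num M.
Implicit Types X Y Z F T : set M.

Lemma SameSeq_trans s t u : SameSeq s t -> SameSeq t u -> SameSeq s u.
Proof. intros [A B] [C D]. split; intros; rewrite ?A, ?B; auto. Qed.

Lemma SameSeq_sym s t : SameSeq s t -> SameSeq t s.
Proof. intros [A B]. split; intros; symmetry; auto. Qed.

Lemma SameSeq_intro s t l : Len s l -> Len t l ->
  (forall i x, Entry s i x -> Entry t i x) -> SameSeq s t.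
Proof.
  intros Hs Ht H. split.
  - intro k. split; intro Hk.
    + rewrite (Len_unique Hk Hs). exact Ht.
    + rewrite (Len_unique Hk Ht). exact Hs.
  - intros i x. split; [apply H|]. intro E.
    destruct (Entry_total s i l Hs) as [y Hy]; [eapply Entry_lt; eassumption|].
    rewrite (Entry_unique E (H _ _ Hy)). exact Hy.
Qed.

Lemma Seq_canonical s l : Len s l -> exists t, IsSeq t /\ SameSeq t s.
Proof.
  intro Hl. destruct (least (fun t => SameSeq t s)) as (t & Ht & Hmin).
  - unfold SameSeq. def.
  - exists s. split; intros; tauto.
  - exists t. split; [|exact Ht]. split.
    + exists l. apply Ht, Hl.
    + intros (u & Hu & E). apply (Hmin u Hu). eapply SameSeq_trans; [|exact Ht].
      apply SameSeq_sym, E.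
Qed.

Lemma Seq_eq s t : IsSeq s -> IsSeq t -> SameSeq s t -> s = t.
Proof.
  intros [_ Hs] [_ Ht] E. destruct (lt_total s t) as [H|[H|H]]; [|exact H|].
  - destruct Ht. exists s. split; [exact H|apply SameSeq_sym, E].
  - destruct Hs. exists t. auto.
Qed.

Lemma Seq_ext s t l : IsSeq s -> IsSeq t -> Len s l -> Len t l ->
  (forall i x, Entry s i x -> Entry t i x) -> s = t.
Proof. intros. apply Seq_eq; auto. eapply SameSeq_intro; eassumption. Qed.

Lemma Seq_exists_set X l : (forall i, i < l -> exists y, ⟨i, y⟩ ∈ X) ->
  exists s, IsSeq s /\ Len s l /\ forall i x, Entry s i x -> ⟨i, x⟩ ∈ X.
Proof.
  intro HX. destruct (beta_exists X l HX) as (a & b & H).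
  destruct (Seq_canonical ⟨l, a, b⟩ l) as (s & Hs & E); [exists a, b; reflexivity|].
  exists s. split; [exact Hs|]. assert (Hl : Len s l) by (apply E; exists a, b; reflexivity).
  split; [exact Hl|]. intros i x Hx. destruct (H i) as (y & Hy & HB).
  - eapply Entry_lt; eassumption.
  - replace x with y; [exact Hy|]. apply E in Hx. eapply Entry_unique; [|exact Hx].
    exists l, a, b. split; [reflexivity|]. split; [|exact HB].
    apply E in Hx. eapply Entry_lt; eassumption.
Qed.

Lemma Seq_exists (R : num M -> num M -> Prop) l :
  Def 2 (fun c => R (snd (fst c)) (snd c)) ->
  (forall i, i < l -> exists y, R i y) ->
  exists s, IsSeq s /\ Len s l /\ forall i x, Entry s i x -> R i x.
Proof.
  intros HR H.
  destruct (comprehension2 R HR) as (X & HX & _).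
  destruct (Seq_exists_set X l) as (s & Hs & Hl & HE).
  - intros i Hi. destruct (H i Hi) as [y Hy]. exists y. apply HX, Hy.
  - exists s. split; [exact Hs|]. split; [exact Hl|]. intros i x Hx.
    apply HX, HE, Hx.
Qed.

Lemma Def_Seq p (f : ctx p -> num M) : DefF p f -> Def p (fun c => IsSeq (f c)).
Proof. intros. unfold IsSeq, SameSeq. def. Qed.

#[local] Hint Resolve Def_Seq : def.

Lemma Def_Initial p (f g : ctx p -> num M) : DefF p f -> DefF p g -> Def p (fun c => Initial (f c) (g c)).
Proof. intros. unfold Initial. def. Qed.

Lemma Seq_Len s : IsSeq s -> exists l, Len s l.
Proof. intros [H _]. exact H. Qed.

Lemma Initial_intro s t l k : IsSeq s -> IsSeq t -> Len s l -> Len t k -> l <= k ->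
  (forall i x, Entry s i x -> Entry t i x) -> Initial s t.
Proof. intros. split; [assumption|]. split; [assumption|]. split; [exists l, k|]; auto. Qed.

Lemma Initial_Len s t l k : Initial s t -> Len s l -> Len t k -> l <= k.
Proof.
  intros (_ & _ & (l' & k' & A & B & C) & _) Hs Ht.
  rewrite (Len_unique Hs A), (Len_unique Ht B). exact C.
Qed.

Lemma Initial_Entry s t i x : Initial s t -> Entry s i x -> Entry t i x.
Proof. intros (_ & _ & _ & H). apply H. Qed.

Lemma Initial_Entry_inv s t l i x : Initial s t -> Len s l -> i < l ->
  Entry t i x -> Entry s i x.
Proof.
  intros H Hl Hi Hx. destruct (Entry_total s i l Hl Hi) as [y Hy].
  rewrite (Entry_unique Hx (Initial_Entry _ _ _ _ H Hy)). exact Hy.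
Qed.

Definition Along F s : Prop := IsSeq s /\ forall i x, Entry s i x -> ⟨i, x⟩ ∈ F.

Lemma Initial_l s t : Initial s t -> IsSeq s.
Proof. intros (H & _). exact H. Qed.

Lemma Initial_r s t : Initial s t -> IsSeq t.
Proof. intros (_ & H & _). exact H. Qed.

Lemma Along_Seq F s : Along F s -> IsSeq s.
Proof. intros [H _]. exact H. Qed.

Hint Resolve Initial_l Initial_r Along_Seq : seq.

Lemma Initial_refl s : IsSeq s -> Initial s s.
Proof.
  intro H. destruct (Seq_Len s H) as [l Hl]. eapply Initial_intro; eauto. apply le_refl.
Qed.

Lemma Initial_trans s t u : Initial s t -> Initial t u -> Initial s u.
Proof.
  intros H H'. destruct (Seq_Len s) as [l Hl]; [eauto with seq|].
  destruct (Seq_Len t) as [k Hk]; [eauto with seq|]. destruct (Seq_Len u) as [j Hj]; [eauto with seq|].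
  eapply Initial_intro; try eassumption; [eauto with seq|eauto with seq| |].
  - apply le_trans with k; [exact (Initial_Len _ _ _ _ H Hl Hk)|exact (Initial_Len _ _ _ _ H' Hk Hj)].
  - intros i x E. eapply Initial_Entry; [exact H'|]. eapply Initial_Entry; eassumption.
Qed.

Lemma Initial_eq s t l k : Initial s t -> Len s l -> Len t k -> k <= l -> s = t.
Proof.
  intros H Hs Ht Hle. assert (l = k) as -> by
    (apply le_antisym; [eapply Initial_Len; eassumption|exact Hle]).
  eapply Seq_ext; try eassumption; eauto with seq. apply H.
Qed.

Lemma Def_Along p F (f : ctx p -> num M) : DefF p f -> Def p (fun c => Along F (f c)).
Proof. intros. unfold Along. def. Qed.

Lemma IsFun_unique F i x y : IsFun F -> ⟨i, x⟩ ∈ F -> ⟨i, y⟩ ∈ F -> x = y.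
Proof. intros (_ & _ & H) A B. eapply H; eauto. Qed.

Lemma Along_exists F n : IsFun F -> exists s, Along F s /\ Len s n.
Proof.
  intros (_ & H & _). destruct (Seq_exists_set F n) as (s & A & B & C).
  - intros i _. apply H.
  - exists s. split; [split; assumption|exact B].
Qed.

Lemma Along_Entry F s l i x : IsFun F -> Along F s -> Len s l -> i < l ->
  ⟨i, x⟩ ∈ F -> Entry s i x.
Proof.
  intros HF [_ H] Hl Hi Hx. destruct (Entry_total s i l Hl Hi) as [y Hy].
  rewrite (IsFun_unique _ _ _ _ HF Hx (H _ _ Hy)). exact Hy.
Qed.

Lemma Along_Initial F s t l k : IsFun F -> Along F s -> Along F t ->
  Len s l -> Len t k -> l <= k -> Initial s t.
Proof.
  intros HF Hs Ht Hl Hk Hle. apply (Initial_intro s t l k); eauto with seq.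
  intros i x E. apply (Along_Entry F t k); auto.
  - exact (lt_le_trans _ _ _ (Entry_lt Hl E) Hle).
  - apply Hs, E.
Qed.

Lemma Along_unique F s t l : IsFun F -> Along F s -> Along F t -> Len s l -> Len t l -> s = t.
Proof.
  intros HF Hs Ht Hl Hk. apply (Initial_eq s t l l); try assumption; [|apply le_refl].
  apply (Along_Initial F s t l l); auto using le_refl.
Qed.

Lemma Initial_Along F s t : Initial s t -> Along F t -> Along F s.
Proof.
  intros H [_ Ht]. split; [eauto with seq|]. intros i x E. apply Ht, (Initial_Entry s t); assumption.
Qed.

Lemma Initial_comparable s t u : Initial s u -> Initial t u -> Initial s t \/ Initial t s.
Proof.
  assert (A : forall s t l k, Initial s u -> Initial t u -> Len s l -> Len t k -> l <= k ->
    Initial s t).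
  { intros s' t' l k Hs Ht Hl Hk Hle. apply (Initial_intro s' t' l k); eauto with seq.
    intros i x E. apply (Initial_Entry_inv t' u k); try assumption.
    - exact (lt_le_trans _ _ _ (Entry_lt Hl E) Hle).
    - apply (Initial_Entry s' u); assumption. }
  intros Hs Ht. destruct (Seq_Len s) as [l Hl]; [eauto with seq|].
  destruct (Seq_Len t) as [k Hk]; [eauto with seq|].
  destruct (le_or_lt l k) as [H|H]; [left|right; apply lt_le in H].
  - exact (A s t l k Hs Ht Hl Hk H).
  - exact (A t s k l Ht Hs Hk Hl H).
Qed.

Lemma Len_0_Entry s i x : Len s 0 -> ~ Entry s i x.
Proof. intros H E. apply (lt_0 i). eapply Entry_lt; eassumption. Qed.

Lemma empty_exists : exists s, IsSeq s /\ Len s 0.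
Proof.
  destruct set_inhabited as [X]. destruct (Seq_exists_set X 0) as (s & A & B & _);
    [|eauto]. intros i Hi. destruct (lt_0 _ Hi).
Qed.

Lemma empty_Initial s t : IsSeq s -> Len s 0 -> IsSeq t -> Initial s t.
Proof.
  intros Hs Hl Ht. destruct (Seq_Len t Ht) as [k Hk].
  eapply Initial_intro; try eassumption; [apply zero_le|].
  intros i x E. destruct (Len_0_Entry _ _ _ Hl E).
Qed.

Lemma snoc_exists s l v : Len s l -> exists t, IsSeq t /\ Len t (l + 1)
  /\ (forall i x, Entry s i x -> Entry t i x) /\ Entry t l v.
Proof.
  intro Hl.
  destruct (Seq_exists (fun i x => Entry s i x \/ (i = l /\ x = v)) (l + 1)) as (t & A & B & C).
  - def.
  - intros i Hi. apply lt_S in Hi as [Hi| ->]; [|exists v; auto].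
    destruct (Entry_total s i l Hl Hi) as [x Hx]. eauto.
  - exists t. split; [exact A|]. split; [exact B|].
    assert (D : forall i, i < l + 1 -> exists x, Entry t i x) by
      (intros; eapply Entry_total; eassumption).
    split.
    + intros i x E. pose proof (Entry_lt Hl E) as Hi.
      destruct (D i) as [y Hy]; [eapply lt_trans; [exact Hi|apply lt_succ_r]|].
      destruct (C i y Hy) as [H|[H _]].
      * rewrite (Entry_unique E H). exact Hy.
      * subst. destruct (lt_irrefl _ Hi).
    + destruct (D l (lt_succ_r l)) as [y Hy]. destruct (C l y Hy) as [H|[_ ->]]; [|exact Hy].
      destruct (lt_irrefl l). eapply Entry_lt; eassumption.
Qed.

End Sequences.

#[local] Hint Resolve Def_Seq Def_Initial Def_Along : def.

(** * Iteration and well-foundedness *)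

Section Computations.

Context {M : model} {HM : ATR0_model M}.
Implicit Types x y z n m i j k d e s t l a b u v q r : num M.
Implicit Types X Y Z F T : set M.

(** [I] is defined by the existence of a coded sequence that records a run of [k] steps, with [R]
    frozen into the set [X]. As [R] may be many-valued, [I] describes reachability; it thus yields
    the levels of a branching tree as well as recursively defined functions. *)
Lemma iteration (R : num M -> num M -> num M -> Prop) a :
  Def 3 (fun c => R (snd (fst (fst c))) (snd (fst c)) (snd c)) ->
  exists I, (forall x, ⟨0, x⟩ ∈ I <-> x = a)
    /\ (forall k y, ⟨k + 1, y⟩ ∈ I <-> exists x, ⟨k, x⟩ ∈ I /\ R k x y)
    /\ (forall q, q ∈ I -> exists x y, q = ⟨x, y⟩).
Proof.
  intro HR. destruct (comprehension3 R HR) as [X HX].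
  destruct (comprehension2 (fun k x => exists s, Entry s 0 a /\ Entry s k x /\
    forall i u v, i < k -> Entry s i u -> Entry s (i + 1) v -> ⟨i, u, v⟩ ∈ X)) as (I & HI & HI').
  { def. }
  exists I. split; [|split; [|exact HI']].
  - intro x. rewrite HI. split.
    + intros (s & H & H' & _). eapply Entry_unique; eassumption.
    + intros ->. destruct empty_exists as (s & _ & Hl).
      destruct (snoc_exists s 0 a Hl) as (t & _ & _ & _ & E).
      exists t. split; [exact E|]. split; [exact E|].
      intros i u v Hi. destruct (lt_0 _ Hi).
  - intros k y. rewrite HI. split.
    + intros (s & H0 & Hk & H). pose proof Hk as (l & a' & b' & E & Hlt & _).
      assert (Hl : Len s l) by (exists a', b'; exact E).
      destruct (Entry_total s k l Hl) as [x Hx].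
      { eapply lt_trans; [apply lt_succ_r|exact Hlt]. }
      exists x. split.
      * apply HI. exists s. split; [exact H0|]. split; [exact Hx|].
        intros i u v Hi. apply H. eapply lt_trans; [exact Hi|apply lt_succ_r].
      * apply HX. eapply H; [apply lt_succ_r|exact Hx|exact Hk].
    + intros (x & Hx & Hxy). apply HX in Hxy. apply HI in Hx as (s & H0 & Hk & H).
      pose proof Hk as (l & a' & b' & E & Hlt & _).
      assert (Hl : Len s l) by (exists a', b'; exact E).
      destruct (Seq_exists (fun i v => (i <= k /\ Entry s i v) \/ (i = k + 1 /\ v = y)) (k + 1 + 1))
        as (t & At & Bt & Ct).
      * def.
      * intros i Hi. apply lt_S in Hi as [Hi| ->]; [|exists y; auto]. apply lt_S in Hi.
        destruct (Entry_total s i l Hl) as [v Hv]; [eapply le_lt_trans; eassumption|].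
        exists v. auto.
      * assert (D : forall i v, i <= k -> Entry s i v -> Entry t i v).
        { intros i v Hi Hv. destruct (Entry_total t i _ Bt) as [v' Hv'].
          { eapply lt_trans; [apply lt_succ_le, Hi|apply lt_succ_r]. }
          destruct (Ct _ _ Hv') as [[_ H']|[-> _]].
          - rewrite (Entry_unique Hv H'). exact Hv'.
          - destruct (le_not_lt _ _ Hi (lt_succ_r k)). }
        assert (D' : Entry t (k + 1) y).
        { destruct (Entry_total t (k + 1) _ Bt (lt_succ_r _)) as [v' Hv'].
          destruct (Ct _ _ Hv') as [[Hle _]|[_ ->]]; [|exact Hv'].
          destruct (le_not_lt _ _ Hle (lt_succ_r k)). }
        exists t. split; [apply D, H0; apply zero_le|]. split; [exact D'|].
        intros i u v Hi Hu Hv. apply lt_S in Hi as [Hi| ->].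
        -- destruct (Ct _ _ Hu) as [[_ Hu']|[-> _]].
           ++ destruct (Ct _ _ Hv) as [[_ Hv']|[E' _]]; [eapply H; eassumption|].
              rewrite (succ_inj _ _ E') in Hi. destruct (lt_irrefl _ Hi).
           ++ destruct (lt_irrefl k). eapply lt_trans; [apply lt_succ_r|exact Hi].
        -- rewrite (Entry_unique Hu (D _ _ (le_refl k) Hk)).
           rewrite (Entry_unique Hv D'). exact Hxy.
Qed.

(** Always moving to the least successor makes the iteration single-valued, so arithmetical
    comprehension suffices. *)
Lemma dependent_choice (R : num M -> num M -> Prop) a :
  Def 2 (fun c => R (snd (fst c)) (snd c)) -> (forall x, exists y, R x y) ->
  exists F, IsFun F /\ ⟨0, a⟩ ∈ F
    /\ forall n x y, ⟨n, x⟩ ∈ F -> ⟨n + 1, y⟩ ∈ F -> R x y.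
Proof.
  intros HR H. destruct (comprehension2 R HR) as (X & HX & _).
  destruct (iteration (fun k x y => ⟨x, y⟩ ∈ X /\ forall z, z < y -> ~ ⟨x, z⟩ ∈ X) a)
    as (F & F0 & FS & FP); [def|].
  assert (U : forall n x y, ⟨n, x⟩ ∈ F -> ⟨n, y⟩ ∈ F -> x = y).
  { intro n. induct n.
    - intros x y Hx Hy. apply F0 in Hx, Hy. congruence.
    - intros n IH x y Hx Hy. apply FS in Hx as (x' & Hx' & Hx & Mx).
      apply FS in Hy as (y' & Hy' & Hy & My). rewrite (IH _ _ Hy' Hx') in *.
      destruct (lt_total x y) as [L|[L|L]]; [destruct (My _ L Hx)|exact L|destruct (Mx _ L Hy)]. }
  exists F. split; [split; [exact FP|split]|split].
  - refine (induction_Def _ _ _ _); [def|exists a; apply F0; reflexivity|].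
    intros n [x Hx]. destruct (least (fun y => ⟨x, y⟩ ∈ X)) as (y & Hy & My); [def| |].
    { destruct (H x) as [y Hy]. exists y. apply HX, Hy. }
    exists y. apply FS. exists x. auto.
  - intros x y z [Hy Hz]. eapply U; eassumption.
  - apply F0. reflexivity.
  - intros n x y Hx Hy. apply FS in Hy as (x' & Hx' & Hy & _).
    apply HX. rewrite (U _ _ _ Hx Hx'). exact Hy.
Qed.

Lemma WF_minimum X (P : num M -> Prop) : IsWF X -> Def 1 (fun c => P (snd c)) ->
  (exists x, P x) -> exists x, P x /\ forall y, LtIn X y x -> ~ P y.
Proof.
  intros HX HP [a Ha]. destruct (comprehension_Def P HP) as [C HC].
  apply NNPP. intro N. apply HX.
  (* Outside [C] the relation holds vacuously, which makes it total on all numbers; starting at [a]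
     in [C], the sequence never leaves [C]. *)
  destruct (dependent_choice (fun x y => x ∈ C -> y ∈ C /\ LtIn X y x) a) as (F & HF & F0 & FS).
  - unfold LtIn. def.
  - intro x. apply NNPP. intro N'. apply N. exists x. split.
    + apply HC. apply NNPP. intro Hx. apply N'. exists 0. tauto.
    + intros y Hy Py. apply N'. exists y. intros _. split; [apply HC, Py|exact Hy].
  - exists F. split; [exact HF|].
    assert (A : forall n x, ⟨n, x⟩ ∈ F -> x ∈ C).
    { intro n. induct n.
      - intros x Hx. rewrite (IsFun_unique _ _ _ _ HF Hx F0). apply HC, Ha.
      - intros n IH y Hy. destruct HF as (_ & T & _). destruct (T n) as [x Hx].
        apply (FS _ _ _ Hx Hy), (IH x), Hx. }
    intros n x y [Hx Hy]. apply (FS _ _ _ Hx Hy), (A n), Hx.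
Qed.

(** * Computations *)

Implicit Types f g w : num M.

Lemma Just_mono (E E' : num M -> num M -> num M -> Prop) (O O' : num M -> Prop) e x y :
  (forall e x y, E e x y -> E' e x y) -> (O x <-> O' x) -> Just E O e x y -> Just E' O' e x y.
Proof.
  intros HE HO H. unfold Just in *. rewrite HO in H.
  destruct H as [H|[H|[H|[H|[H|[H|[H|[H|[H|H]]]]]]]]]; try tauto.
  - do 6 right; left. destruct H as (f & g & H & u & v & H1 & H2 & H3).
    exists f, g. split; [exact H|]. exists u, v. auto.
  - do 7 right; left. destruct H as (f & g & H & u & H1 & H2).
    exists f, g. split; [exact H|]. exists u. auto.
  - do 8 right; left. destruct H as (f & g & H & a & [[H1 H2]|(m & u & H1 & H2 & H3)]);
      exists f, g; (split; [exact H|]); exists a; [left; auto|right].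
    exists m, u. auto.
  - do 9 right. destruct H as (f & H & H1 & H2). exists f. split; [exact H|].
    split; [auto|]. intros z Hz. destruct (H2 z Hz) as [w Hw]. eauto.
Qed.

Ltac pair_contra :=
  repeat match goal with
  | H : ⟨_, _⟩ = ⟨_, _⟩ |- _ => apply pair_inj in H as [? ?]
  end;
  try match goal with
  | H : mnumeral _ = mnumeral _ |- _ => apply numeral_inj in H; discriminate H
  end.

(** [E] and [E'] stand for the triples available in two different computations. The leading numeral
    of [e] fixes the clause, so mixed cases are contradictory; for minimisation, the smaller of two
    results would have both value 0 and a successor value. *)
Lemma Just_functional (E E' : num M -> num M -> num M -> Prop) O e x y y' :
  (forall e x y y', E e x y -> E' e x y' -> y = y') ->
  Just E O e x y -> Just E' O e x y' -> y = y'.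
Proof.
  intros HE H H'. unfold Just in *.
  destruct H as [[-> H]|[[-> H]|[[-> H]|[[-> H]|[[-> H]|[[-> H]|[(f & g & -> & H)|[(f & g & -> & H)|[(f & g & He & H)|(f & -> & H)]]]]]]]]];
  destruct H' as [[H1 H']|[[H1 H']|[[H1 H']|[[H1 H']|[[H1 H']|[[H1 H']|[(f' & g' & H1 & H')|[(f' & g' & H1 & H')|[(f' & g' & H1 & H')|(f' & H1 & H')]]]]]]]]];
  try (subst e); pair_contra; subst; try reflexivity.
  - destruct H as [z E1], H' as [z' E2]. rewrite E1 in E2. apply pair_inj in E2. apply E2.
  - destruct H as [z E1], H' as [z' E2]. rewrite E1 in E2. apply pair_inj in E2. apply E2.
  - destruct H as [[H ->]|[H ->]], H' as [[H' ->]|[H' ->]]; tauto.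
  - destruct H as (u & v & A & B & ->), H' as (u' & v' & A' & B' & ->).
    rewrite (HE _ _ _ _ A A'), (HE _ _ _ _ B B'). reflexivity.
  - destruct H as (u & A & B), H' as (u' & A' & B').
    rewrite (HE _ _ _ _ A A') in B. exact (HE _ _ _ _ B B').
  - destruct H as (a & [[-> A]|(m & u & -> & A & B)]),
      H' as (a' & [[E1 A']|(m' & u' & E1 & A' & B')]); apply pair_inj in E1 as [<- E1].
    + exact (HE _ _ _ _ A A').
    + destruct (succ_nz m'). symmetry. exact E1.
    + destruct (succ_nz m). exact E1.
    + apply succ_inj in E1 as <-. rewrite (HE _ _ _ _ A A') in B. exact (HE _ _ _ _ B B').
  - destruct H as [A B], H' as [A' B']. destruct (lt_total y y') as [L|[L|L]]; [|exact L|].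
    + destruct (B' _ L) as [w Hw]. destruct (succ_nz w). symmetry. exact (HE _ _ _ _ A Hw).
    + destruct (B _ L) as [w Hw]. destruct (succ_nz w). exact (HE _ _ _ _ Hw A').
Qed.

(** Induction on the position in the first computation, with the position in the second one
    arbitrary. The predicate of the induction speaks of entries alone, so [O] may be an undefinable
    oracle. *)
Lemma Comp_functional O e x y y' : Comp O e x y -> Comp O e x y' -> y = y'.
Proof.
  intros (d & _ & Hd & i & Hi) (d' & _ & Hd' & i' & Hi').
  assert (A : forall i e x y, Entry d i ⟨e, x, y⟩ ->
    forall i' y', Entry d' i' ⟨e, x, y'⟩ -> y = y').
  { intro i0. revert i0. refine (strong_induction _ _ _); [def|].
    intros i0 IH e0 x0 y0 H i1 y1 H1.
    destruct (Hd _ _ H) as (e2 & x2 & y2 & E & J).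
    apply pair_inj in E as [-> E]. apply pair_inj in E as [-> ->].
    destruct (Hd' _ _ H1) as (e3 & x3 & y3 & E & J').
    apply pair_inj in E as [<- E]. apply pair_inj in E as [<- <-].
    eapply Just_functional; [|exact J|exact J'].
    intros e4 x4 y4 y5 (j & Hj & Ej) (j' & _ & Ej'). eapply IH; eassumption. }
  eapply A; eassumption.
Qed.

Lemma Valid_concat O d d' : Valid O d -> Valid O d' -> IsSeq d -> IsSeq d' ->
  exists D, IsSeq D /\ Valid O D /\ (forall q, Member d q -> Member D q)
    /\ (forall q, Member d' q -> Member D q).
Proof.
  intros Hd Hd' Sd Sd'. destruct (Seq_Len d Sd) as [l Hl]. destruct (Seq_Len d' Sd') as [l' Hl'].
  destruct (Seq_exists (fun i q => Entry d i q \/ exists j, i = l + j /\ Entry d' j q) (l + l'))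
    as (D & SD & LD & HD); [def| |].
  { intros i Hi. destruct (le_or_lt l i) as [Hli|Hli].
    - apply le_iff in Hli as [j ->].
      destruct (Entry_total d' j l' Hl') as [q Hq]; [|exists q; right; exists j; auto].
      apply (add_lt_cancel l). rewrite !(add_comm _ l). exact Hi.
    - destruct (Entry_total d i l Hl Hli) as [q Hq]. exists q. auto. }
  assert (A : forall i q, Entry d i q -> Entry D i q).
  { intros i q Hq. pose proof (Entry_lt Hl Hq) as Hi.
    destruct (Entry_total D i _ LD) as [q' Hq'].
    { eapply lt_le_trans; [exact Hi|apply le_add_l]. }
    destruct (HD _ _ Hq') as [H|(j & -> & _)].
    - rewrite (Entry_unique Hq H). exact Hq'.
    - destruct (le_not_lt _ _ (le_add_l l j) Hi). }
  assert (A' : forall j q, Entry d' j q -> Entry D (l + j) q).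
  { intros j q Hq. pose proof (Entry_lt Hl' Hq) as Hj.
    destruct (Entry_total D (l + j) _ LD) as [q' Hq'].
    { rewrite !(add_comm l). apply add_lt_cancel, Hj. }
    destruct (HD _ _ Hq') as [H|(j' & E & H)].
    - destruct (le_not_lt _ _ (le_add_l l j) (Entry_lt Hl H)).
    - rewrite !(add_comm l) in E. apply add_cancel in E as <-.
      rewrite (Entry_unique Hq H). exact Hq'. }
  exists D. split; [exact SD|]. split; [|split].
  - intros i q Hq. destruct (HD _ _ Hq) as [H|(j & -> & H)].
    + destruct (Hd _ _ H) as (e & x & y & -> & J). exists e, x, y. split; [reflexivity|].
      eapply Just_mono; [|reflexivity|exact J].
      intros e' x' y' (j & Hj & Ej). exists j. auto.
    + destruct (Hd' _ _ H) as (e & x & y & -> & J). exists e, x, y. split; [reflexivity|].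
      eapply Just_mono; [|reflexivity|exact J].
      intros e' x' y' (j' & Hj & Ej). exists (l + j'). split; [|auto].
      rewrite !(add_comm l). apply add_lt_cancel, Hj.
  - intros q [i Hq]. exists i. auto.
  - intros q [i Hq]. exists (l + i). auto.
Qed.

Lemma Valid_snoc O d e x y : IsSeq d -> Valid O d ->
  Just (fun e x y => Member d ⟨e, x, y⟩) O e x y ->
  exists D, IsSeq D /\ Valid O D /\ Member D ⟨e, x, y⟩ /\ forall q, Member d q -> Member D q.
Proof.
  intros Sd Hd J. destruct (Seq_Len d Sd) as [l Hl].
  destruct (snoc_exists d l ⟨e, x, y⟩ Hl) as (D & SD & LD & HD & HD').
  exists D. split; [exact SD|]. split; [|split].
  - intros i q Hq. pose proof (Entry_lt LD Hq) as Hi. apply lt_S in Hi as [Hi| ->].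
    + destruct (Entry_total d i l Hl Hi) as [q' Hq'].
      rewrite (Entry_unique Hq (HD _ _ Hq')).
      destruct (Hd _ _ Hq') as (e' & x' & y' & -> & J').
      exists e', x', y'. split; [reflexivity|]. eapply Just_mono; [|reflexivity|exact J'].
      intros e2 x2 y2 (j & Hj & Ej). exists j. auto.
    + rewrite (Entry_unique Hq HD'). exists e, x, y. split; [reflexivity|].
      eapply Just_mono; [|reflexivity|exact J].
      intros e2 x2 y2 (j & Ej). exists j. split; [eapply Entry_lt; eassumption|auto].
  - exists l. exact HD'.
  - intros q [i Hq]. exists i. auto.
Qed.

Lemma Comp_intro O d e x y : IsSeq d -> Valid O d ->
  Just (fun e x y => Member d ⟨e, x, y⟩) O e x y -> Comp O e x y.
Proof.
  intros Sd Hd J. destruct (Valid_snoc O d e x y Sd Hd J) as (D & A & B & C & _).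
  exists D. auto.
Qed.

Lemma Comp_base O e x y : Just (fun _ _ _ => False) O e x y -> Comp O e x y.
Proof.
  intro J. destruct empty_exists as (d & Sd & Ld).
  apply (Comp_intro O d); [exact Sd| |].
  - intros i q Hq. destruct (Len_0_Entry _ _ _ Ld Hq).
  - eapply Just_mono; [|reflexivity|exact J]. intros ? ? ? [].
Qed.

Lemma Comp_id O x : Comp O ⟨#0, #0⟩ x x.
Proof. apply Comp_base. unfold Just. tauto. Qed.

Lemma Comp_zero O x : Comp O ⟨#0, #1⟩ x 0.
Proof. apply Comp_base. unfold Just. tauto. Qed.

Lemma Comp_succ O x : Comp O ⟨#0, #2⟩ x (x + 1).
Proof. apply Comp_base. unfold Just. tauto. Qed.

Lemma Comp_fst O x y : Comp O ⟨#0, #3⟩ ⟨x, y⟩ x.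
Proof. apply Comp_base. unfold Just. do 3 right; left. eauto. Qed.

Lemma Comp_snd O x y : Comp O ⟨#0, #4⟩ ⟨x, y⟩ y.
Proof. apply Comp_base. unfold Just. do 4 right; left. eauto. Qed.

Lemma Comp_oracle (O : num M -> Prop) x y :
  (O x /\ y = 1) \/ (~ O x /\ y = 0) -> Comp O ⟨#0, #5⟩ x y.
Proof. intro H. apply Comp_base. unfold Just. do 5 right; left. auto. Qed.

Lemma Comp_two O e1 x1 y1 e2 x2 y2 e x y : Comp O e1 x1 y1 -> Comp O e2 x2 y2 ->
  (forall E : num M -> num M -> num M -> Prop, E e1 x1 y1 -> E e2 x2 y2 -> Just E O e x y) ->
  Comp O e x y.
Proof.
  intros (d1 & S1 & V1 & M1) (d2 & S2 & V2 & M2) H.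
  destruct (Valid_concat O d1 d2 V1 V2 S1 S2) as (D & SD & VD & I1 & I2).
  apply (Comp_intro O D); [exact SD|exact VD|]. apply H; auto.
Qed.

Lemma Comp_pair O f g x u v : Comp O f x u -> Comp O g x v -> Comp O ⟨#1, f, g⟩ x ⟨u, v⟩.
Proof.
  intros Hf Hg. apply (Comp_two _ _ _ _ _ _ _ _ _ _ Hf Hg).
  intros E A B. do 6 right; left. exists f, g. split; [reflexivity|]. eauto.
Qed.

Lemma Comp_comp O f g x u y : Comp O g x u -> Comp O f u y -> Comp O ⟨#2, f, g⟩ x y.
Proof.
  intros Hf Hg. apply (Comp_two _ _ _ _ _ _ _ _ _ _ Hf Hg).
  intros E A B. do 7 right; left. exists f, g. split; [reflexivity|]. eauto.
Qed.

Lemma Comp_rec_0 O f g a y : Comp O f a y -> Comp O ⟨#3, f, g⟩ ⟨a, 0⟩ y.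
Proof.
  intros Hf. apply (Comp_two _ _ _ _ _ _ _ _ _ _ Hf Hf).
  intros E A _. do 8 right; left. exists f, g. split; [reflexivity|]. eauto.
Qed.

Lemma Comp_rec_S O f g a m u y : Comp O ⟨#3, f, g⟩ ⟨a, m⟩ u -> Comp O g ⟨a, m, u⟩ y ->
  Comp O ⟨#3, f, g⟩ ⟨a, m + 1⟩ y.
Proof.
  intros Hf Hg. apply (Comp_two _ _ _ _ _ _ _ _ _ _ Hf Hg).
  intros E A B. do 8 right; left. exists f, g. split; [reflexivity|].
  exists a. right. exists m, u. auto.
Qed.

Lemma Def_Earlier p (d i e x y : ctx p -> num M) :
  DefF p d -> DefF p i -> DefF p e -> DefF p x -> DefF p y ->
  Def p (fun c => Earlier (d c) (i c) (e c) (x c) (y c)).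
Proof. intros. unfold Earlier. def. Qed.

#[local] Hint Resolve Def_Earlier : def.

Lemma Def_Valid_set Y p (d : ctx p -> num M) :
  DefF p d -> Def p (fun c => Valid (fun z => z ∈ Y) (d c)).
Proof. intros. unfold Valid, Just. def. Qed.

(** The part of the graph of a path that [s] determines. Queries about later arguments are answered
    negatively, so the answers can be relied upon only below the length of [s]. *)
Definition StringOracle s q : Prop := exists i v, q = ⟨i, v⟩ /\ Entry s i v.

#[local] Hint Resolve Def_Valid_set : def.

Lemma Def_Computes Y p (e x y : ctx p -> num M) :
  DefF p e -> DefF p x -> DefF p y -> Def p (fun c => Computes Y (e c) (x c) (y c)).
Proof. intros. unfold Computes, Comp, Member. def. Qed.

(** The computations for all [z < y], possibly nonstandardly many, must be joined into one sequence.
    This takes an induction inside the model, for which the oracle has to be a set and not an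
    arbitrary predicate. *)
Lemma Comp_mu Y f x y : Computes Y f ⟨x, y⟩ 0 ->
  (forall z, z < y -> exists w, Computes Y f ⟨x, z⟩ (w + 1)) -> Computes Y ⟨#4, f⟩ x y.
Proof.
  intros (d & Sd & Vd & Md) H.
  assert (A : forall y', y' <= y -> exists d, IsSeq d /\ Valid (fun z => z ∈ Y) d
    /\ forall z, z < y' -> exists w, Member d ⟨f, ⟨x, z⟩, w + 1⟩).
  { intro y'. revert y'. refine (induction_Def _ _ _ _).
    - unfold Member. def.
    - intros _. exists d. split; [exact Sd|]. split; [exact Vd|].
      intros z Hz. destruct (lt_0 _ Hz).
    - intros k IH Hk. apply le_succ_lt in Hk. destruct (IH (lt_le _ _ Hk)) as (d' & S' & V' & M').
      destruct (H k Hk) as (w & d2 & S2 & V2 & M2).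
      destruct (Valid_concat _ _ _ V' V2 S' S2) as (D & SD & VD & I1 & I2).
      exists D. split; [exact SD|]. split; [exact VD|]. intros z Hz.
      apply lt_S in Hz as [Hz| ->]; [|exists w; auto]. destruct (M' z Hz) as [w' Hw]. eauto. }
  destruct (A y (le_refl y)) as (d' & S' & V' & M').
  destruct (Valid_concat _ _ _ Vd V' Sd S') as (D & SD & VD & I1 & I2).
  apply (Comp_intro _ D); [exact SD|exact VD|]. do 9 right. exists f. split; [reflexivity|].
  split; [apply I1, Md|]. intros z Hz. destruct (M' z Hz) as [w Hw]. exists w. auto.
Qed.

End Computations.

#[local] Hint Resolve Def_Earlier Def_Computes : def.

(** * Functions recursive in an oracle *)

Section Recursive.

Context {M : model} {HM : ATR0_model M}.
Implicit Types x y z n m i j k e s t l a b u v q r w : num M.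
Variable Y : set M.

(** [f] is computed by one index on the codes [enc c] of its arguments, which
    range over an arbitrary type. *)
Definition Rec {C : Type} (enc f : C -> num M) : Prop :=
  exists e, forall c, Computes Y e (enc c) (f c).

Definition RecP {C : Type} (enc : C -> num M) (P : C -> Prop) : Prop :=
  Rec enc (fun c => chi (P c)).

Definition encp {C : Type} (enc : C -> num M) (p : C * num M) : num M := ⟨enc (fst p), snd p⟩.

Lemma chi_0 (P : Prop) : (chi P : num M) = 0 <-> ~ P.
Proof.
  unfold chi. destruct excluded_middle_informative; [|tauto].
  split; [intro E; destruct (one_neq_zero E)|tauto].
Qed.

Lemma chi_1 (P : Prop) : (chi P : num M) = 1 <-> P.
Proof.
  unfold chi. destruct excluded_middle_informative; [tauto|].
  split; [intro E; destruct one_neq_zero; symmetry; exact E|tauto].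
Qed.

Lemma Rec_ext {C} (enc f g : C -> num M) : (forall c, f c = g c) -> Rec enc f -> Rec enc g.
Proof. intros H [e He]. exists e. intro c. rewrite <- H. apply He. Qed.

Lemma RecP_ext {C} (enc : C -> num M) (P Q : C -> Prop) :
  (forall c, P c <-> Q c) -> RecP enc P -> RecP enc Q.
Proof. intro H. apply Rec_ext. intro c. apply chi_iff, H. Qed.

Lemma Rec_pull {C D} (h : D -> C) (enc f : C -> num M) :
  Rec enc f -> Rec (fun d => enc (h d)) (fun d => f (h d)).
Proof. intros [e He]. exists e. intro d. apply He. Qed.

Lemma Rec_comp {C} (enc g f : C -> num M) : Rec enc g -> Rec g f -> Rec enc f.
Proof.
  intros [e He] [e' He']. exists ⟨#2, e', e⟩. intro c. eapply Comp_comp; [apply He|apply He'].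
Qed.

Lemma Rec_id {C} (f : C -> num M) : Rec f f.
Proof. exists ⟨#0, #0⟩. intro c. apply Comp_id. Qed.

Lemma Rec_pair {C} (enc f g : C -> num M) :
  Rec enc f -> Rec enc g -> Rec enc (fun c => ⟨f c, g c⟩).
Proof. intros [e He] [e' He']. exists ⟨#1, e, e'⟩. intro c. apply Comp_pair; [apply He|apply He']. Qed.

Lemma Rec_fst {C} (f g : C -> num M) : Rec (fun c => ⟨f c, g c⟩) f.
Proof. exists ⟨#0, #3⟩. intro c. apply Comp_fst. Qed.

Lemma Rec_snd {C} (f g : C -> num M) : Rec (fun c => ⟨f c, g c⟩) g.
Proof. exists ⟨#0, #4⟩. intro c. apply Comp_snd. Qed.

Lemma Rec_succ {C} (enc f : C -> num M) : Rec enc f -> Rec enc (fun c => f c + 1).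
Proof. intro H. eapply Rec_comp; [exact H|]. exists ⟨#0, #2⟩. intro c. apply Comp_succ. Qed.

Lemma Rec_const {C} (enc : C -> num M) a : Rec enc (fun _ => a).
Proof.
  assert (H : exists e, forall x, Computes Y e x a).
  { induct a.
    - exists ⟨#0, #1⟩. intro x. apply Comp_zero.
    - intros a [e He]. exists ⟨#2, ⟨#0, #2⟩, e⟩. intro x.
      eapply Comp_comp; [apply He|apply Comp_succ]. }
  destruct H as [e He]. exists e. intro c. apply He.
Qed.

Lemma Rec_weak {C} (enc f : C -> num M) : Rec enc f -> Rec (encp enc) (fun p => f (fst p)).
Proof.
  intro H. eapply Rec_comp; [apply (Rec_fst (fun p => enc (fst p)) snd)|].
  apply (Rec_pull fst _ _ H).
Qed.

Lemma Rec_var {C} (enc : C -> num M) : Rec (encp enc) (fun p => snd p).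
Proof. apply (Rec_snd (fun p => enc (fst p)) snd). Qed.

Lemma RecP_mem {C} (enc f : C -> num M) : Rec enc f -> RecP enc (fun c => f c ∈ Y).
Proof.
  intro H. eapply Rec_comp; [exact H|]. exists ⟨#0, #5⟩. intro c. apply Comp_oracle.
  destruct (classic (f c ∈ Y)); [left; rewrite chi_true|right; rewrite chi_false]; auto.
Qed.

Lemma Rec_subst {C} (enc g : C -> num M) (h : C -> num M -> num M) :
  Rec (encp enc) (fun p => h (fst p) (snd p)) -> Rec enc g -> Rec enc (fun c => h c (g c)).
Proof.
  intros Hh Hg. eapply Rec_comp; [apply (Rec_pair _ _ _ (Rec_id enc) Hg)|].
  apply (Rec_pull (fun c => (c, g c)) _ _ Hh).
Qed.

(** The index comes from the recursion clause, but its correctness is an induction on [n] in the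
    model; hence the definability condition on each [h c]. *)
Lemma Rec_prim {C} (enc : C -> num M) (h : C -> num M -> num M) :
  Rec enc (fun c => h c 0) ->
  Rec (fun p : C * num M => ⟨enc (fst p), snd p, h (fst p) (snd p)⟩)
      (fun p => h (fst p) (snd p + 1)) ->
  (forall c, DefF 1 (fun d => h c (snd d))) ->
  Rec (encp enc) (fun p => h (fst p) (snd p)).
Proof.
  intros [f Hf] [g Hg] HD. exists ⟨#3, f, g⟩. intros [c n]. unfold encp. simpl.
  revert n. refine (induction_Def _ _ _ _).
  - apply Def_Computes; [def|def|apply HD].
  - apply Comp_rec_0, Hf.
  - intros n IH. eapply Comp_rec_S; [exact IH|]. apply (Hg (c, n)).
Qed.

Lemma Rec_prim_at {C} (enc g : C -> num M) (h : C -> num M -> num M) :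
  Rec enc (fun c => h c 0) ->
  Rec (fun p : C * num M => ⟨enc (fst p), snd p, h (fst p) (snd p)⟩)
      (fun p => h (fst p) (snd p + 1)) ->
  (forall c, DefF 1 (fun d => h c (snd d))) ->
  Rec enc g -> Rec enc (fun c => h c (g c)).
Proof. intros. apply Rec_subst; [apply Rec_prim|]; assumption. Qed.

Lemma Rec_step_arg {C} (enc f : C -> num M) (h : C * num M -> num M) :
  Rec enc f -> Rec (fun p : C * num M => ⟨enc (fst p), snd p, h p⟩) (fun p => f (fst p)).
Proof.
  intro H. eapply Rec_comp; [apply (Rec_fst (fun p => enc (fst p)))|].
  apply (Rec_pull fst _ _ H).
Qed.

Lemma Rec_step_index {C} (enc : C -> num M) (h : C * num M -> num M) :
  Rec (fun p : C * num M => ⟨enc (fst p), snd p, h p⟩) (fun p => snd p).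
Proof. eapply Rec_comp; [apply Rec_snd|apply (Rec_fst (fun p => snd p))]. Qed.

Lemma Rec_step_value {C} (enc : C -> num M) (h : C * num M -> num M) :
  Rec (fun p : C * num M => ⟨enc (fst p), snd p, h p⟩) h.
Proof. eapply Rec_comp; [apply Rec_snd|apply Rec_snd]. Qed.

Lemma Rec_add {C} (enc f g : C -> num M) :
  Rec enc f -> Rec enc g -> Rec enc (fun c => f c + g c).
Proof.
  intros Hf Hg. apply (Rec_prim_at enc g (fun c n => f c + n)); [| | |exact Hg].
  - eapply Rec_ext; [|exact Hf]. intro c. symmetry. apply add_0.
  - eapply Rec_ext; [|apply Rec_succ, Rec_step_value]. intro p. symmetry. apply add_S.
  - intro c. def.
Qed.

Lemma Rec_mul {C} (enc f g : C -> num M) :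
  Rec enc f -> Rec enc g -> Rec enc (fun c => f c * g c).
Proof.
  intros Hf Hg. apply (Rec_prim_at enc g (fun c n => f c * n)); [| | |exact Hg].
  - eapply Rec_ext; [|apply (Rec_const enc 0)]. intro c. symmetry. apply mul_0.
  - eapply Rec_ext; [|apply Rec_add; [apply Rec_step_value|apply Rec_step_arg, Hf]].
    intro p. symmetry. apply mul_S.
  - intro c. def.
Qed.

Definition ifz z x y : num M := if excluded_middle_informative (z = 0) then x else y.

Lemma ifz_0 x y : ifz 0 x y = x.
Proof. unfold ifz. destruct excluded_middle_informative; tauto. Qed.

Lemma ifz_neq z x y : z <> 0 -> ifz z x y = y.
Proof. unfold ifz. destruct excluded_middle_informative; tauto. Qed.

Lemma Rec_ifz {C} (enc h f g : C -> num M) :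
  Rec enc h -> Rec enc f -> Rec enc g -> Rec enc (fun c => ifz (h c) (f c) (g c)).
Proof.
  intros Hh Hf Hg. apply (Rec_prim_at enc h (fun c n => ifz n (f c) (g c))); [| | |exact Hh].
  - eapply Rec_ext; [|exact Hf]. intro c. symmetry. apply ifz_0.
  - eapply Rec_ext; [|apply Rec_step_arg, Hg]. intro p. symmetry. apply ifz_neq, succ_nz.
  - intro c. apply Def_equiv with (fun d => (snd (fst d) = 0 /\ snd d = f c)
      \/ (~ snd (fst d) = 0 /\ snd d = g c)); [|def].
    intros [[d n] x]. simpl. unfold ifz. destruct excluded_middle_informative; tauto.
Qed.

Definition monus x y : num M :=
  epsilon (inhabits 0) (fun z => (y <= x /\ x = y + z) \/ (x < y /\ z = 0)).

Lemma monus_spec x y z : monus x y = z <-> (y <= x /\ x = y + z) \/ (x < y /\ z = 0).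
Proof.
  assert (H : (y <= x /\ x = y + monus x y) \/ (x < y /\ monus x y = 0)).
  { unfold monus. apply epsilon_spec. destruct (le_or_lt y x) as [H|H]; [|eauto].
    pose proof H as H'. apply le_iff in H' as [z' ->]. exists z'. auto. }
  split; [intros <-; exact H|].
  intros [[A E]|[A ->]]; destruct H as [[B E']|[B E']]; try (destruct (le_not_lt _ _ A B));
    try (destruct (le_not_lt _ _ B A)); [|exact E'].
  rewrite E in E' at 1. rewrite !(add_comm y) in E'. symmetry. apply (add_cancel _ _ _ E').
Qed.

Lemma monus_eq_0 x y : monus x y = 0 <-> x <= y.
Proof.
  rewrite monus_spec. rewrite add_0. split.
  - intros [[_ ->]|[H _]]; [apply le_refl|apply lt_le, H].
  - intros [H| ->]; [tauto|]. left. split; [apply le_refl|reflexivity].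
Qed.

Lemma Rec_monus {C} (enc f g : C -> num M) :
  Rec enc f -> Rec enc g -> Rec enc (fun c => monus (f c) (g c)).
Proof.
  assert (P : forall C (enc f : C -> num M), Rec enc f -> Rec enc (fun c => monus (f c) 1)).
  { intros C' enc' f' Hf. apply (Rec_prim_at enc' f' (fun _ n => monus n 1)); [| | |exact Hf].
    - eapply Rec_ext; [|apply (Rec_const enc' 0)]. intro c. symmetry.
      apply monus_eq_0, zero_le.
    - eapply Rec_ext; [|apply Rec_step_index]. intro p. symmetry. apply monus_spec. left.
      rewrite (add_comm 1). split; [|reflexivity]. apply le_add_r.
    - intro c. apply Def_equiv with (fun d => (1 <= snd (fst d) /\ snd (fst d) = 1 + snd d)
        \/ (snd (fst d) < 1 /\ snd d = 0)); [|def].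
      intro d. rewrite <- monus_spec. split; congruence. }
  intros Hf Hg. apply (Rec_prim_at enc g (fun c n => monus (f c) n)); [| | |exact Hg].
  - eapply Rec_ext; [|exact Hf]. intro c. symmetry. apply monus_spec. left.
    rewrite add_0_l. split; [apply zero_le|reflexivity].
  - eapply Rec_ext; [|apply P, Rec_step_value]. intros [c n]. simpl. symmetry.
    apply monus_spec. destruct (le_or_lt (n + 1) (f c)) as [H|H].
    + left. split; [exact H|]. apply le_iff in H as [z E]. rewrite E.
      replace (monus (n + 1 + z) n) with (1 + z).
      * f_equal. symmetry. apply monus_spec. left. split; [apply le_add_l|reflexivity].
      * symmetry. apply monus_spec. left. rewrite <- add_assoc. split; [apply le_add_l|reflexivity].
    + right. split; [exact H|]. apply lt_S in H. replace (monus (f c) n) with (0 : num M).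
      * apply monus_eq_0, zero_le.
      * symmetry. apply monus_eq_0. exact H.
  - intro c. apply Def_equiv with (fun d => (snd (fst d) <= f c /\ f c = snd (fst d) + snd d)
      \/ (f c < snd (fst d) /\ snd d = 0)); [|def].
    intro d. rewrite <- monus_spec. split; congruence.
Qed.

Lemma RecP_zero {C} (enc f : C -> num M) : Rec enc f -> RecP enc (fun c => f c = 0).
Proof.
  intro H. eapply Rec_ext; [|apply (Rec_ifz enc f (fun _ => 1) (fun _ => 0));
    [exact H|apply Rec_const|apply Rec_const]].
  intro c. simpl. unfold ifz, chi. destruct excluded_middle_informative; reflexivity.
Qed.

Lemma RecP_not {C} (enc : C -> num M) (P : C -> Prop) :
  RecP enc P -> RecP enc (fun c => ~ P c).
Proof.
  intro H. eapply RecP_ext; [|apply (RecP_zero _ _ H)]. intro c. apply chi_0.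
Qed.

Lemma RecP_or {C} (enc : C -> num M) (P Q : C -> Prop) :
  RecP enc P -> RecP enc Q -> RecP enc (fun c => P c \/ Q c).
Proof.
  intros HP HQ. eapply Rec_ext; [|apply (Rec_ifz enc _ _ (fun _ => 1) HP HQ); apply Rec_const].
  intro c. simpl. destruct (classic (P c)) as [H|H].
  - rewrite (chi_true (P c)), ifz_neq, chi_true; auto using one_neq_zero.
  - rewrite (chi_false (P c)), ifz_0 by assumption. apply chi_iff. tauto.
Qed.

Lemma RecP_and {C} (enc : C -> num M) (P Q : C -> Prop) :
  RecP enc P -> RecP enc Q -> RecP enc (fun c => P c /\ Q c).
Proof.
  intros HP HQ. apply RecP_ext with (fun c => ~ (~ P c \/ ~ Q c)); [intro c; tauto|].
  auto using RecP_not, RecP_or.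
Qed.

Lemma RecP_le {C} (enc f g : C -> num M) :
  Rec enc f -> Rec enc g -> RecP enc (fun c => f c <= g c).
Proof.
  intros Hf Hg. eapply RecP_ext; [intro c; apply monus_eq_0|].
  apply RecP_zero, Rec_monus; assumption.
Qed.

Lemma RecP_lt {C} (enc f g : C -> num M) :
  Rec enc f -> Rec enc g -> RecP enc (fun c => f c < g c).
Proof.
  intros Hf Hg. eapply RecP_ext; [intro c; apply le_succ_lt|].
  apply RecP_le; [apply Rec_succ|]; assumption.
Qed.

Lemma RecP_eq {C} (enc f g : C -> num M) :
  Rec enc f -> Rec enc g -> RecP enc (fun c => f c = g c).
Proof.
  intros Hf Hg. apply RecP_ext with (fun c => f c <= g c /\ g c <= f c).
  - intro c. split; [intros []; apply le_antisym; assumption|].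
    intros ->. split; apply le_refl.
  - apply RecP_and; apply RecP_le; assumption.
Qed.

Lemma RecP_subst {C} (enc g : C -> num M) (P : C -> num M -> Prop) :
  RecP (encp enc) (fun p => P (fst p) (snd p)) -> Rec enc g -> RecP enc (fun c => P c (g c)).
Proof. apply (Rec_subst enc g (fun c n => chi (P c n))). Qed.

Lemma Rec_mu {C} (enc f : C -> num M) (P : C -> num M -> Prop) :
  RecP (encp enc) (fun p => P (fst p) (snd p)) ->
  (forall c, P c (f c) /\ forall z, z < f c -> ~ P c z) -> Rec enc f.
Proof.
  (* Minimisation searches for the value 0, so it is applied to the characteristic function of the
     negation. *)
  intros HP H. destruct (RecP_not _ _ HP) as [e He]. exists ⟨#4, e⟩. intro c.
  destruct (H c) as [A B]. apply Comp_mu.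
  - specialize (He (c, f c)). simpl in He. rewrite chi_false in He by tauto. exact He.
  - intros z Hz. exists 0. specialize (He (c, z)). simpl in He.
    rewrite chi_true in He by auto. rewrite add_0_l. exact He.
Qed.

(** Whatever one index decides is arithmetical in [Y], by way of [Computes]; this supplies the
    definability that [least] asks for. *)
Lemma RecP_Def {C} (enc : C -> num M) (P : C -> num M -> Prop) :
  RecP (encp enc) (fun p => P (fst p) (snd p)) -> forall c, Def 1 (fun d => P c (snd d)).
Proof.
  intros [e He] c. apply Def_equiv with (fun d => Computes Y e ⟨enc c, snd d⟩ 1).
  - intro d. specialize (He (c, snd d)). unfold encp in He. simpl in He. split.
    + intro H. apply chi_1. exact (Comp_functional _ _ _ _ _ He H).
    + intro H. rewrite (chi_true _ H) in He. exact He.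
  - def.
Qed.

Lemma RecP_ex {C} (enc t : C -> num M) (P : C -> num M -> Prop) :
  Rec enc t -> RecP (encp enc) (fun p => P (fst p) (snd p)) ->
  (forall c z, P c z -> z <= t c) -> RecP enc (fun c => exists z, P c z).
Proof.
  (* The bound is added to the search as a sentinel, so that it always terminates. One evaluation of
     [P] at the place found then settles the question. *)
  intros Ht HP Hb. set (Q c z := z = t c \/ P c z).
  set (f c := epsilon (inhabits 0) (fun z => Q c z /\ forall w, w < z -> ~ Q c w)).
  assert (Hf : forall c, Q c (f c) /\ forall w, w < f c -> ~ Q c w).
  { intro c. unfold f. apply epsilon_spec. apply least.
    - unfold Q. apply Def_or; [def|]. apply (RecP_Def _ _ HP c).
    - exists (t c). left. reflexivity. }
  assert (Rf : Rec enc f).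
  { apply (Rec_mu enc f Q); [|exact Hf]. unfold Q. apply RecP_or; [|exact HP].
    apply RecP_eq; [apply Rec_var|apply Rec_weak, Ht]. }
  apply RecP_ext with (fun c => P c (f c)); [|apply RecP_subst; assumption].
  intro c. split; [eauto|]. intros [z Hz]. destruct (Hf c) as [[E|H] Hmin]; [|exact H].
  destruct (Hb c z Hz) as [L| ->]; [|rewrite E; exact Hz].
  rewrite <- E in L. destruct (Hmin z L). right. exact Hz.
Qed.

Lemma RecP_all_lt {C} (enc t : C -> num M) (P : C -> num M -> Prop) :
  Rec enc t -> RecP (encp enc) (fun p => P (fst p) (snd p)) ->
  RecP enc (fun c => forall z, z < t c -> P c z).
Proof.
  intros Ht HP. apply RecP_ext with (fun c => ~ exists z, z < t c /\ ~ P c z).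
  - intro c. split.
    + intros H z Hz. apply NNPP. eauto.
    + intros H (z & Hz & N). auto.
  - apply RecP_not, (RecP_ex enc t (fun c z => z < t c /\ ~ P c z) Ht).
    + apply RecP_and; [|apply RecP_not, HP]. apply RecP_lt; [apply Rec_var|apply Rec_weak, Ht].
    + intros c z [H _]. apply lt_le, H.
Qed.

End Recursive.

(** Strips the innermost variable from a function of the outer ones: at the dummy pair [(c, 0)] it
    reduces to a term in [c]. *)
Ltac rec_weaken :=
  lazymatch goal with
  | |- Rec ?Y (@encp _ ?C ?enc) ?F =>
      let f := constr:(fun c : C => ltac:(
        let t := eval cbn beta iota delta [fst snd] in (F (c, 0)) in exact t)) in
      let f' := eval cbv beta in f in
      apply (Rec_weak Y enc f')
  end.

Ltac rec :=
  lazymatch goal with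
  | |- Rec _ _ (fun c => m_add _ _) => apply Rec_add; rec
  | |- Rec _ _ (fun c => m_mul _ _) => apply Rec_mul; rec
  | |- Rec _ _ (fun c => mpair _ _) => apply Rec_pair; rec
  | |- Rec _ (encp _) (fun c => snd c) => apply Rec_var
  | |- Rec _ (encp _) (@snd _ _) => apply Rec_var
  | |- Rec _ _ _ => first [assumption | apply Rec_const | rec_weaken; rec]
  | |- RecP _ _ (fun c => _ /\ _) => apply RecP_and; rec
  | |- RecP _ _ (fun c => _ \/ _) => apply RecP_or; rec
  | |- RecP _ _ (fun c => ~ _) => apply RecP_not; rec
  | |- RecP _ _ (fun c => _ = _) => apply RecP_eq; rec
  | |- RecP _ _ (fun c => m_lt _ _) => apply RecP_lt; rec
  | |- RecP _ _ (fun c => mle _ _) => apply RecP_le; rec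
  | |- RecP _ _ (fun c => m_mem _ _) => apply RecP_mem; rec
  | |- _ => solve [auto with rec]
  end.

#[local] Hint Extern 1 (Rec _ _ _) => rec : rec.

(** * Deciding statements about sequences and computations *)

Section Decide.

Context {M : model} {HM : ATR0_model M}.
Implicit Types x y z n m i j k e s t l a b u v q r w : num M.
Variable Y : set M.

(** A component of a pair is at most its code, so the quantifiers in the definition are bounded by
    [s c]. The same remark carries the lemmas that follow. *)
Lemma RecP_Len {C} (enc s l : C -> num M) :
  Rec Y enc s -> Rec Y enc l -> RecP Y enc (fun c => Len (s c) (l c)).
Proof.
  intros. unfold Len.
  apply (RecP_ex Y enc s); [rec| |].
  - apply (RecP_ex Y (encp enc) (fun p => s (fst p))); [rec|rec|].
    intros [c a] b. simpl. intros ->.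
    eapply le_trans; [|apply le_pair_r]. apply le_pair_r.
  - intros c a [b ->]. eapply le_trans; [|apply le_pair_r]. apply le_pair_l.
Qed.

Lemma RecP_Entry {C} (enc s i x : C -> num M) :
  Rec Y enc s -> Rec Y enc i -> Rec Y enc x -> RecP Y enc (fun c => Entry (s c) (i c) (x c)).
Proof.
  intros. unfold Entry, Beta.
  apply (RecP_ex Y enc s); [rec| |].
  - apply (RecP_ex Y (encp enc) (fun p => s (fst p))); [rec| |].
    + apply (RecP_ex Y (encp (encp enc)) (fun p => s (fst (fst p)))); [rec| |].
      * apply RecP_and; [rec|]. apply RecP_and; [rec|]. apply RecP_and; [rec|].
        apply (RecP_ex Y _ (fun p => snd (fst p))); [rec|rec|].
        intros [[[c l] a] b] q. simpl. intros ->. eapply le_trans; [|apply le_add_l].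
        apply le_mul_r. rewrite add_comm. apply lt_0_succ.
      * intros [[c l] a] b. simpl. intros [-> _].
        eapply le_trans; [|apply le_pair_r]. apply le_pair_r.
    + intros [c l] a. simpl. intros (b & -> & _).
      eapply le_trans; [|apply le_pair_r]. apply le_pair_l.
  - intros c l (a & b & -> & _). apply le_pair_l.
Qed.

Lemma RecP_Earlier {C} (enc d i e x y : C -> num M) :
  Rec Y enc d -> Rec Y enc i -> Rec Y enc e -> Rec Y enc x -> Rec Y enc y ->
  RecP Y enc (fun c => Earlier (d c) (i c) (e c) (x c) (y c)).
Proof.
  intros. unfold Earlier. apply (RecP_ex Y enc i); [rec| |].
  - apply RecP_and; [rec|]. apply RecP_Entry; rec.
  - intros c j [Hj _]. apply lt_le, Hj.
Qed.

Lemma le_pair3 x y z t : t = ⟨x, y, z⟩ -> x <= t /\ y <= t /\ z <= t.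
Proof.
  intros ->. split; [apply le_pair_l|]. split; (eapply le_trans; [|apply le_pair_r]);
    [apply le_pair_l|apply le_pair_r].
Qed.

Lemma Earlier_le d i e x y : Earlier d i e x y -> y <= d.
Proof.
  intros (j & _ & H). apply Entry_le in H. eapply le_trans; [|exact H].
  eapply le_trans; [|apply le_pair_r]. apply le_pair_r.
Qed.

End Decide.

Ltac rec_bound :=
  intros; simpl in *;
  repeat match goal with
  | H : ex _ |- _ => destruct H
  | H : _ /\ _ |- _ => destruct H
  end;
  solve [ match goal with H : _ = ⟨_, _, _⟩ |- _ => apply (le_pair3 _ _ _ _ H) end
        | eapply Earlier_le; eassumption
        | eapply Entry_le; eassumption | eapply lt_le, Entry_index_lt; eassumption
        | apply lt_le; assumption ].

#[local] Hint Resolve RecP_Len RecP_Entry RecP_Earlier : rec.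

Section Decide.

Context {M : model} {HM : ATR0_model M}.
Implicit Types x y z n m i j k e s t l a b u v q r w : num M.
Variable Y : set M.

Lemma RecP_Just {C} (enc d i e x y : C -> num M) :
  Rec Y enc d -> Rec Y enc i -> Rec Y enc e -> Rec Y enc x -> Rec Y enc y ->
  RecP Y enc (fun c => Just (Earlier (d c) (i c)) (fun z => z ∈ Y) (e c) (x c) (y c)).
Proof.
  intros. unfold Just.
  apply RecP_or; [rec|]. apply RecP_or; [rec|]. apply RecP_or; [rec|].
  apply RecP_or; [|apply RecP_or; [|apply RecP_or; [rec|apply RecP_or;
    [|apply RecP_or; [|apply RecP_or]]]]].
  - apply RecP_and; [rec|]. apply (RecP_ex Y enc x); [rec|rec|].
    intros c z ->. apply le_pair_r.
  - apply RecP_and; [rec|]. apply (RecP_ex Y enc x); [rec|rec|].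
    intros c z ->. apply le_pair_l.
  - apply (RecP_ex Y enc e); [rec| |rec_bound].
    apply (RecP_ex Y _ (fun p => e (fst p))); [rec| |rec_bound].
    apply RecP_and; [rec|]. apply (RecP_ex Y _ (fun p => d (fst (fst p)))); [rec| |rec_bound].
    apply (RecP_ex Y _ (fun p => d (fst (fst (fst p))))); [rec|rec|rec_bound].
  - apply (RecP_ex Y enc e); [rec| |rec_bound].
    apply (RecP_ex Y _ (fun p => e (fst p))); [rec| |rec_bound].
    apply RecP_and; [rec|]. apply (RecP_ex Y _ (fun p => d (fst (fst p)))); [rec|rec|rec_bound].
  - apply (RecP_ex Y enc e); [rec| |rec_bound].
    apply (RecP_ex Y _ (fun p => e (fst p))); [rec| |rec_bound].
    apply RecP_and; [rec|]. apply (RecP_ex Y _ (fun p => x (fst (fst p)))); [rec| |].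
    2: { intros p a [[E _]|(m & u & E & _)]; rewrite E; apply le_pair_l. }
    apply RecP_or; [rec|].
    apply (RecP_ex Y _ (fun p => x (fst (fst (fst p))))); [rec| |].
    2: { intros p m (u & E & _). rewrite E. eapply le_trans; [|apply le_pair_r]. apply le_add_l. }
    apply (RecP_ex Y _ (fun p => d (fst (fst (fst (fst p)))))); [rec|rec|rec_bound].
  - apply (RecP_ex Y enc e); [rec| |intros c f [E _]; rewrite E; apply le_pair_r].
    apply RecP_and; [rec|]. apply RecP_and; [rec|].
    apply (RecP_all_lt Y _ (fun p => y (fst p))); [rec|].
    apply (RecP_ex Y _ (fun p => d (fst (fst p)))); [rec|rec|].
    intros p w Hw. eapply le_trans; [|apply (Earlier_le _ _ _ _ _ Hw)]. apply le_add_l.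
Qed.

(** Every quantifier is bounded by the code of the computation. Convergence within a given bound
    thereby becomes decidable from the oracle, which permits a search for the first bound that
    works. *)
Lemma RecP_Valid {C} (enc d : C -> num M) :
  Rec Y enc d -> RecP Y enc (fun c => Valid (fun z => z ∈ Y) (d c)).
Proof.
  intro Hd. apply RecP_ext with (fun c => ~ exists i q, Entry (d c) i q /\
    ~ exists e x y, q = ⟨e, x, y⟩ /\ Just (Earlier (d c) i) (fun z => z ∈ Y) e x y).
  { intro c. unfold Valid. split.
    - intros H i q Hq. apply NNPP. intro N. apply H. eauto.
    - intros H (i & q & Hq & N). apply N, H, Hq. }
  apply RecP_not. apply (RecP_ex Y enc d); [rec| |rec_bound].
  apply (RecP_ex Y _ (fun p => d (fst p))); [rec| |rec_bound].
  apply RecP_and; [rec|]. apply RecP_not.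
  apply (RecP_ex Y _ (fun p => snd p)); [rec| |rec_bound].
  apply (RecP_ex Y _ (fun p => snd (fst p))); [rec| |rec_bound].
  apply (RecP_ex Y _ (fun p => snd (fst (fst p)))); [rec| |rec_bound].
  apply RecP_and; [rec|]. apply RecP_Just; rec.
Qed.

End Decide.

(** * The Kleene-Brouwer order *)

Section Game.

Context {M : model} {HM : ATR0_model M}.
Implicit Types x y z n m i j k d e s t l a b u v q r w : num M.
Implicit Types X Y Z F T S L : set M.

(** The Kleene-Brouwer order. If [t] ends at [k], the condition on [v] is vacuous, so a proper
    extension lies below the string it extends. *)
Definition KBlt s t : Prop :=
  exists k, (forall i v, i < k -> (Entry s i v <-> Entry t i v))
    /\ exists u, Entry s k u /\ forall v, Entry t k v -> u < v.

Lemma KBlt_irrefl s : ~ KBlt s s.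
Proof. intros (k & _ & u & Hu & H). exact (lt_irrefl _ (H u Hu)). Qed.

Lemma KBlt_trans s t u : KBlt s t -> KBlt t u -> KBlt s u.
Proof.
  intros (k & A & x & Hx & Mx) (j & B & y & Hy & My).
  destruct (lt_total k j) as [L|[<-|L]].
  - exists k. split.
    + intros i v Hi. rewrite A by exact Hi. apply B. eapply lt_trans; eassumption.
    + exists x. split; [exact Hx|]. intros v Hv. apply Mx, B, Hv. exact L.
  - exists k. split.
    + intros i v Hi. rewrite A by exact Hi. apply B, Hi.
    + exists x. split; [exact Hx|]. intros v Hv. eapply lt_trans; [apply Mx, Hy|apply My, Hv].
  - exists j. split.
    + intros i v Hi. rewrite A; [apply B, Hi|]. eapply lt_trans; eassumption.
    + exists y. split; [apply A; assumption|exact My].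
Qed.

Lemma KBlt_total s t : IsSeq s -> IsSeq t -> KBlt s t \/ s = t \/ KBlt t s.
Proof.
  intros Hs Ht. destruct (Seq_Len s Hs) as [l Hl]. destruct (Seq_Len t Ht) as [l' Hl'].
  destruct (classic (forall k v, Entry s k v <-> Entry t k v)) as [E|N].
  - right; left. apply Seq_eq; auto. split; [|exact E].
    assert (l = l') as ->.
    { destruct (lt_total l l') as [L|[L|L]]; [|exact L|].
      - destruct (Entry_total t l l' Hl' L) as [v Hv]. apply E in Hv.
        destruct (lt_irrefl l). eapply Entry_lt; eassumption.
      - destruct (Entry_total s l' l Hl L) as [v Hv]. apply E in Hv.
        destruct (lt_irrefl l'). eapply Entry_lt; eassumption. }
    intro k. split; intro H.
    + rewrite (Len_unique H Hl). exact Hl'.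
    + rewrite (Len_unique H Hl'). exact Hl.
  - destruct (least (fun k => ~ forall v, Entry s k v <-> Entry t k v)) as (k & Hk & Mk).
    + def.
    + apply not_all_ex_not. exact N.
    + assert (A : forall i v, i < k -> (Entry s i v <-> Entry t i v)).
      { intros i v Hi. specialize (Mk i Hi). apply NNPP in Mk. apply Mk. }
      destruct (classic (exists u, Entry s k u)) as [[u Hu]|Nu];
      destruct (classic (exists v, Entry t k v)) as [[v Hv]|Nv].
      * destruct (lt_total u v) as [L|[L|L]].
        -- left. exists k. split; [exact A|]. exists u. split; [exact Hu|].
           intros v' Hv'. rewrite (Entry_unique Hv' Hv). exact L.
        -- destruct Hk. subst v. intro v'. split; intro H.
           ++ rewrite (Entry_unique H Hu). exact Hv.
           ++ rewrite (Entry_unique H Hv). exact Hu.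
        -- right; right. exists k. split; [intros i v' Hi; symmetry; apply A, Hi|].
           exists v. split; [exact Hv|].
           intros v' Hv'. rewrite (Entry_unique Hv' Hu). exact L.
      * left. exists k. split; [exact A|]. exists u. split; [exact Hu|].
        intros v Hv. destruct Nv. eauto.
      * right; right. exists k. split; [intros i v' Hi; symmetry; apply A, Hi|].
        exists v. split; [exact Hv|].
        intros u Hu. destruct Nu. eauto.
      * destruct Hk. intro v. split; intro H; [destruct Nu|destruct Nv]; eauto.
Qed.

(** * A descending sequence of strings converges to a path *)

Section Descending.

Variable S : set M.
Hypothesis S_Seq : forall s, s ∈ S -> IsSeq s.

Variable F : set M.
Hypothesis F_fun : IsFun F.
Hypothesis F_S : forall n s, ⟨n, s⟩ ∈ F -> s ∈ S.
Hypothesis F_desc : forall n s t, ⟨n, s⟩ ∈ F -> ⟨n + 1, t⟩ ∈ F -> KBlt t s.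

Definition Settled k n : Prop :=
  forall m s t i, n <= m -> ⟨n, s⟩ ∈ F -> ⟨m, t⟩ ∈ F -> i < k ->
    exists v, Entry s i v /\ Entry t i v.

(** With the entries below [k] settled, [t'] can first beat [t] only at [k] or later. Hence entry
    [k] exists after every descent and does not increase. *)
Lemma Settled_step k n m t t' : Settled k n -> n <= m -> ⟨m, t⟩ ∈ F -> ⟨m + 1, t'⟩ ∈ F ->
  exists u, Entry t' k u /\ forall v, Entry t k v -> u <= v.
Proof.
  intros H Hnm Ht Ht'. destruct F_fun as (_ & Ft & _). destruct (Ft n) as [s Hs].
  destruct (F_desc _ _ _ Ht Ht') as (j & A & u & Hu & Mu).
  destruct (lt_total j k) as [L|[->|L]].
  - destruct (H m s t j Hnm Hs Ht L) as (v & Hv & Htv).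
    destruct (H (m + 1) s t' j) as (v' & Hv' & Htv'); try assumption.
    { eapply le_trans; [exact Hnm|apply le_add_l]. }
    rewrite (Entry_unique Hv' Hv) in Htv'.
    rewrite (Entry_unique Hu Htv') in Mu.
    destruct (lt_irrefl v). apply Mu, Htv.
  - exists u. split; [exact Hu|]. intros v Hv. apply lt_le, Mu, Hv.
  - destruct (Seq_Len t') as [l Hl]; [eapply S_Seq, F_S, Ht'|].
    destruct (Entry_total t' k l Hl) as [v Hv].
    { eapply lt_trans; [exact L|]. eapply Entry_lt; eassumption. }
    exists v. split; [exact Hv|]. intros v' Hv'. apply A in Hv'; [|exact L].
    rewrite (Entry_unique Hv Hv'). apply le_refl.
Qed.

Lemma Settled_exists k : exists n, Settled k n.
Proof.
  revert k. refine (induction_Def _ _ _ _); [unfold Settled; def| |].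
  - exists 0. intros m s t i _ _ _ Hi. destruct (lt_0 _ Hi).
  - intros k [n H]. pose proof F_fun as (_ & Ft & _).
    (* Stage [n] may lack entry [k], but each later stage follows a descent and has it. A
       nonincreasing entry is constant from the moment it reaches its least value. *)
    destruct (least (fun v => exists m t, n + 1 <= m /\ ⟨m, t⟩ ∈ F /\ Entry t k v))
      as (v & (m0 & t0 & Hm0 & Ht0 & Hv) & Mv); [def| |].
    { destruct (Ft n) as [s Hs]. destruct (Ft (n + 1)) as [t Ht].
      destruct (Settled_step k n n s t H (le_refl n) Hs Ht) as (u & Hu & _).
      exists u, (n + 1), t. split; [apply le_refl|]. auto. }
    assert (A : forall j t, ⟨m0 + j, t⟩ ∈ F -> Entry t k v).
    { intro j. induct j.
      - intros t Ht. rewrite add_0 in Ht.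
        rewrite (IsFun_unique _ _ _ _ F_fun Ht Ht0). exact Hv.
      - intros j IH t' Ht'. destruct (Ft (m0 + j)) as [t Ht]. rewrite add_S in Ht'.
        destruct (Settled_step k n (m0 + j) t t' H) as (u & Hu & Mu); try assumption.
        { eapply le_trans; [|apply le_add_l]. eapply le_trans; [apply le_add_l|exact Hm0]. }
        destruct (Mu v (IH t Ht)) as [L| ->]; [|exact Hu].
        destruct (Mv u L). exists (m0 + j + 1), t'. split; [|auto].
        eapply le_trans; [exact Hm0|]. eapply le_trans; [apply le_add_l|]. apply le_add_l. }
    assert (Hn : n <= m0) by (eapply le_trans; [apply le_add_l|exact Hm0]).
    exists m0. intros m s t i Hm Hs Ht Hi. pose proof Hm as Hm'.
    apply le_iff in Hm' as [j ->].
    apply lt_S in Hi as [Hi| ->].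
    + destruct (Ft n) as [r Hr]. destruct (H m0 r s i) as (x & Hx & Hsx); try assumption.
      destruct (H (m0 + j) r t i) as (x' & Hx' & Htx); try assumption.
      { exact (le_trans _ _ _ Hn Hm). }
      exists x. split; [exact Hsx|]. rewrite (Entry_unique Hx Hx'). exact Htx.
    + exists v. split; [|exact (A _ _ Ht)]. apply (A 0). rewrite add_0. exact Hs.
Qed.

(** The limit of the settled entries, arithmetical in [F]. A stage at which the first [n] entries
    are settled agrees with it below [n]. *)
Lemma descending_path : exists G, IsFun G /\
  forall n, exists s, s ∈ S /\ forall i x, i < n -> ⟨i, x⟩ ∈ G -> Entry s i x.
Proof.
  pose proof F_fun as (_ & Ft & _).
  destruct (comprehension2 (fun k v => exists n s, Settled (k + 1) n /\ ⟨n, s⟩ ∈ F /\ Entry s k v))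
    as (G & HG & GP); [unfold Settled; def|].
  exists G. split; [split; [exact GP|split]|].
  - intro k. destruct (Settled_exists (k + 1)) as [n Hn]. destruct (Ft n) as [s Hs].
    destruct (Hn n s s k (le_refl n) Hs Hs (lt_succ_r k)) as (v & Hv & _).
    exists v. apply HG. exists n, s. auto.
  - assert (A : forall n n' s s' k x y, Settled (k + 1) n -> n <= n' -> ⟨n, s⟩ ∈ F ->
      ⟨n', s'⟩ ∈ F -> Entry s k x -> Entry s' k y -> x = y).
    { intros n n' s s' k x y H Hle Hs Hs' Hx Hy.
      destruct (H n' s s' k Hle Hs Hs' (lt_succ_r k)) as (v & A & B).
      rewrite (Entry_unique Hx A), (Entry_unique Hy B). reflexivity. }
    intros k x y [Hx Hy]. apply HG in Hx as (n & s & P & Hs & Hx).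
    apply HG in Hy as (n' & s' & P' & Hs' & Hy).
    destruct (le_or_lt n n') as [L|L].
    + exact (A n n' s s' k x y P L Hs Hs' Hx Hy).
    + symmetry. exact (A n' n s' s k y x P' (lt_le _ _ L) Hs' Hs Hy Hx).
  - intro n. destruct (Settled_exists n) as [N HN]. destruct (Ft N) as [s Hs].
    exists s. split; [eapply F_S, Hs|]. intros i x Hi Hx.
    apply HG in Hx as (n' & s' & P & Hs' & Hx). destruct (le_or_lt n' N) as [L|L].
    + destruct (P N s' s i L Hs' Hs (lt_succ_r i)) as (v & A & B).
      rewrite (Entry_unique Hx A). exact B.
    + apply lt_le in L. destruct (HN n' s s' i L Hs Hs' Hi) as (v & A & B).
      rewrite (Entry_unique Hx B). exact A.
Qed.

End Descending.

Lemma KB_WO S : (forall s, s ∈ S -> IsSeq s) ->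
  (forall G, IsFun G ->
     (forall n, exists s, s ∈ S /\ forall i x, i < n -> ⟨i, x⟩ ∈ G -> Entry s i x) -> False) ->
  exists L, IsWO L /\ (forall s, InField s L <-> s ∈ S)
    /\ forall s t, LtIn L s t <-> s ∈ S /\ t ∈ S /\ KBlt s t.
Proof.
  intros HS Hpath.
  destruct (comprehension2 (fun s t => s ∈ S /\ t ∈ S /\ (s = t \/ KBlt s t))) as (L & HL & _);
    [unfold KBlt; def|].
  assert (Hfield : forall s, InField s L <-> s ∈ S).
  { intro s. unfold InField. rewrite HL. tauto. }
  assert (Hlt : forall s t, LtIn L s t <-> s ∈ S /\ t ∈ S /\ KBlt s t).
  { intros s t. unfold LtIn. rewrite !HL. split.
    - intros ((A & B & [->|C]) & D); tauto.
    - intros (A & B & C). split; [tauto|]. intros (_ & _ & [->|D]).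
      + exact (KBlt_irrefl _ C).
      + exact (KBlt_irrefl _ (KBlt_trans _ _ _ C D)). }
  exists L. split; [|split; assumption]. split.
  - split; [|split; [|split]].
    + intros i j H. rewrite !Hfield. apply HL in H. tauto.
    + intros i j k [A B]. apply HL in A as (A1 & A2 & A), B as (B1 & B2 & B). apply HL.
      split; [exact A1|]. split; [exact B2|].
      destruct A as [->|A]; [exact B|]. destruct B as [<-|B]; [right; exact A|].
      right. eapply KBlt_trans; eassumption.
    + intros i j [A B]. apply HL in A as (_ & _ & A), B as (_ & _ & B).
      destruct A as [A|A]; [exact A|]. destruct B as [B|B]; [symmetry; exact B|].
      destruct (KBlt_irrefl _ (KBlt_trans _ _ _ A B)).
    + intros i j [A B]. rewrite Hfield in A, B. rewrite !HL.
      destruct (KBlt_total i j (HS _ A) (HS _ B)) as [H|[H|H]]; auto 10.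
  - intros (F & HF & Hdesc).
    assert (D : forall n s t, ⟨n, s⟩ ∈ F -> ⟨n + 1, t⟩ ∈ F -> t ∈ S /\ s ∈ S /\ KBlt t s).
    { intros n s t A B. apply Hlt. eapply Hdesc. split; eassumption. }
    pose proof HF as (_ & Ft & _).
    destruct (descending_path S HS F HF) as (G & HG & H).
    + intros n s Hs. destruct (Ft (n + 1)) as [t Ht]. apply (D n s t Hs Ht).
    + intros n s t Hs Ht. apply (D n s t Hs Ht).
    + exact (Hpath G HG H).
Qed.

(** * The game *)

(** Convergence with a computation coded below [n]; such a computation asks
    the oracle only about numbers below [n]. *)
Definition Conv (O : num M -> Prop) n e q b : Prop :=
  exists d, d < n /\ Valid O d /\ Member d ⟨e, q, b⟩.

Lemma Valid_agree (O O' : num M -> Prop) d :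
  (forall q, q <= d -> (O q <-> O' q)) -> Valid O d -> Valid O' d.
Proof.
  intros H Hd i q Hq. destruct (Hd i q Hq) as (e & x & y & -> & J).
  exists e, x, y. split; [reflexivity|]. eapply Just_mono; [| |exact J]; [auto|].
  apply H. eapply le_trans; [|apply (Entry_le _ _ _ Hq)].
  eapply le_trans; [|apply le_pair_r]. apply le_pair_l.
Qed.

Lemma Conv_agree (O O' : num M -> Prop) n e q b :
  (forall x, x < n -> (O x <-> O' x)) -> Conv O n e q b -> Conv O' n e q b.
Proof.
  intros H (d & Hd & V & Hm). exists d. split; [exact Hd|]. split; [|exact Hm].
  eapply Valid_agree; [|exact V]. intros x Hx. apply H. eapply le_lt_trans; eassumption.
Qed.

(** [Conv] accepts any representative of a computation, whereas [Comp] wants the canonical one; both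
    have the same entries. *)
Lemma Conv_Comp O n e q b : Conv O n e q b -> Comp O e q b.
Proof.
  intros (d & _ & V & i & Hi). pose proof Hi as (l & a & c & E & _).
  destruct (Seq_canonical d l) as (d' & Sd & HE); [exists a, c; exact E|].
  exists d'. split; [exact Sd|]. split.
  - intros k p Hp. apply HE in Hp. destruct (V k p Hp) as (e' & x & y & -> & J).
    exists e', x, y. split; [reflexivity|]. eapply Just_mono; [|reflexivity|exact J].
    intros e2 x2 y2 (j & Hj & Ej). exists j. split; [exact Hj|]. apply HE, Ej.
  - exists i. apply HE, Hi.
Qed.

Lemma Conv_functional O n m e q b b' : Conv O n e q b -> Conv O m e q b' -> b = b'.
Proof.
  intros H H'. apply Conv_Comp in H, H'. exact (Comp_functional _ _ _ _ _ H H').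
Qed.

Lemma StringOracle_Along F s l q : IsFun F -> Along F s -> Len s l -> q < l ->
  (StringOracle s q <-> q ∈ F).
Proof.
  intros HF Hs Hl Hq. split.
  - intros (i & v & -> & E). apply Hs, E.
  - intro H. pose proof HF as (HP & _). destruct (HP q H) as (i & v & ->).
    exists i, v. split; [reflexivity|]. apply (Along_Entry F s l); try assumption.
    eapply le_lt_trans; [apply le_pair_l|exact Hq].
Qed.

Lemma StringOracle_Initial s t l q : Initial s t -> Len s l -> q < l ->
  (StringOracle s q <-> StringOracle t q).
Proof.
  intros H Hl Hq. split; intros (i & v & -> & E); exists i, v; (split; [reflexivity|]).
  - eapply Initial_Entry; eassumption.
  - apply (Initial_Entry_inv s t l); try assumption.
    eapply le_lt_trans; [apply le_pair_l|exact Hq].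
Qed.

Variable T : set M.

(** In position [s] the opponent names a bit [b], and the answer must be the
    first extension of [s] on which index [e] computes [b] from [⟨e, s⟩]. *)
Definition Legal e s b t : Prop :=
  Initial s t /\ t ∈ T /\ exists l k, Len s l /\ Len t k /\ l < k
    /\ Conv (StringOracle t) k e ⟨e, s⟩ b
    /\ forall n b', l < n -> n < k -> b' < #2 -> ~ Conv (StringOracle t) n e ⟨e, s⟩ b'.

Lemma Def_Legal p (e s b t : ctx p -> num M) :
  DefF p e -> DefF p s -> DefF p b -> DefF p t ->
  Def p (fun c => Legal (e c) (s c) (b c) (t c)).
Proof. intros. unfold Legal, Conv, Valid, Just, StringOracle, Member. def. Qed.

Hypothesis T_tree : IsTree T.

Lemma Path_Along F s n : IsPath F T -> Along F s -> Len s n -> s ∈ T.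
Proof.
  intros [HF HP] Hs Hn. destruct (HP n) as (t & Ht & Hl & HE).
  replace s with t; [exact Ht|]. apply (Along_unique F t s n); auto.
  split; [apply T_tree, Ht|exact HE].
Qed.

Lemma path_answer F e s b : IsPath F T -> Along F s -> b < #2 -> Computes F e ⟨e, s⟩ b ->
  exists t, Along F t /\ Legal e s b t.
Proof.
  intros HP Hs Hb (d & Sd & V & Hm). pose proof (proj1 HP) as HF.
  destruct (Seq_Len s (proj1 Hs)) as [l Hl].
  (* The minimum is taken over both bits, because [Legal] forbids earlier convergence to either.
     That the bit found is [b] follows from the uniqueness of the value computed from [F]. *)
  set (P n := l < n /\ exists b', b' < #2 /\ Conv (fun z => z ∈ F) n e ⟨e, s⟩ b').
  destruct (least P) as (n & (Hln & b' & Hb' & HC) & Mn).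
  - unfold P, Conv, Valid, Just, Member. def.
  (* Large enough to exceed the length [l] of [s] and the code [d] of the given computation. *)
  - exists (l + d + 1). split; [apply lt_succ_le, le_add_l|]. exists b. split; [exact Hb|].
    exists d. split; [apply lt_succ_le, le_add_r|]. split; assumption.
  - assert (b' = b) as ->.
    { apply (Comp_functional (fun z => z ∈ F) e ⟨e, s⟩); [eapply Conv_Comp, HC|].
      exists d. split; [exact Sd|]. split; assumption. }
    destruct (Along_exists F n HF) as (t & Ht & Hn).
    exists t. split; [exact Ht|]. split; [|split].
    + apply (Along_Initial F s t l n); auto using lt_le.
    + eapply Path_Along; eassumption.
    + exists l, n. split; [exact Hl|]. split; [exact Hn|]. split; [exact Hln|]. split.
      * eapply Conv_agree; [|exact HC]. intros x Hx. symmetry.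
        eapply StringOracle_Along; eassumption.
      * intros m b' Hm1 Hm2 Hb2 HC'. apply (Mn m Hm2). split; [exact Hm1|].
        exists b'. split; [exact Hb2|]. eapply Conv_agree; [|exact HC'].
        intros x Hx. eapply StringOracle_Along; try eassumption. eapply lt_trans; eassumption.
Qed.

Variable eps : num M.
Hypothesis eps_Seq : IsSeq eps.
Hypothesis eps_Len : Len eps 0.

(** Finite parts of a winning strategy for the closed player: entry 0 is the
    index [e], and entries [2n], [2n + 1] answer the bits 0, 1 in position
    entry [n], the root being entry 1. *)
Definition Attempt s : Prop :=
  IsSeq s /\ (forall v, Entry s 1 v -> v = eps)
  /\ forall n b e u v, 1 <= n -> b < #2 -> Entry s 0 e -> Entry s n u ->
       Entry s (#2 * n + b) v -> Legal e u b v.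

Definition WinningStrategy F e : Prop :=
  IsFun F /\ ⟨0, e⟩ ∈ F /\ ⟨1, eps⟩ ∈ F /\
  forall n b u v, 1 <= n -> b < #2 -> ⟨n, u⟩ ∈ F -> ⟨#2 * n + b, v⟩ ∈ F -> Legal e u b v.

Lemma winning_of_attempts F : IsFun F ->
  (forall n, exists s, Attempt s /\ forall i x, i < n -> ⟨i, x⟩ ∈ F -> Entry s i x) ->
  exists e, WinningStrategy F e.
Proof.
  intros HF H. pose proof HF as (_ & Ft & _).
  destruct (Ft 0) as [e He]. exists e. split; [exact HF|]. split; [exact He|]. split.
  - destruct (Ft 1) as [v Hv]. destruct (H (1 + 1)) as (s & (_ & A & _) & HE).
    rewrite <- (A v); [exact Hv|]. apply HE; [apply lt_succ_r|exact Hv].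
  - intros n b u v Hn Hb Hu Hv. destruct (H (#2 * n + b + 1)) as (s & (_ & _ & A) & HE).
    assert (B : n <= #2 * n + b).
    { apply le_iff. exists (n + b). simpl. rewrite mul_add, mul_1_l, !add_assoc. reflexivity. }
    apply (A n b e u v Hn Hb); apply HE; try assumption; apply lt_succ_le;
      [apply zero_le|exact B|apply le_refl].
Qed.

End Game.

#[local] Hint Resolve Def_Legal : def.

(** * Ranks of positions and determinacy of the game *)

Section Determinacy.

Context {M : model} {HM : ATR0_model M}.
Implicit Types x y z n m i j k d e s t l a b u v q r w : num M.
Implicit Types X Y Z F T S L : set M.
Add Ring model_ring : (@model_semiring M HM).

Lemma double_inj n b n' b' : b < #2 -> b' < #2 -> #2 * n + b = #2 * n' + b' ->
  n = n' /\ b = b'.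
Proof.
  intros Hb Hb' E. assert (b = b') as <-.
  { apply (division_unique n b n' b' #2 Hb Hb').
    rewrite (mul_comm n), (mul_comm n'). exact E. }
  split; [|reflexivity]. apply add_cancel in E.
  assert (Mono : forall x y, x < y -> #2 * x < #2 * y).
  { intros x y. rewrite !lt_iff. intros [z ->]. exists (z + z + 1). simpl. ring. }
  destruct (lt_total n n') as [H|[H|H]]; [|exact H|]; apply Mono in H; rewrite E in H;
    destruct (lt_irrefl _ H).
Qed.

Lemma double_cases l : 1 < l -> exists n b, 1 <= n /\ b < #2 /\ l = #2 * n + b.
Proof.
  intro H. destruct (division l #2) as (n & b & E & Hb).
  - simpl. apply lt_0_succ.
  - exists n, b. split; [|split; [exact Hb|rewrite E; ring]].
    destruct (zero_or_succ n) as [->|[z ->]]; [|apply le_add_r].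
    rewrite mul_0_l, add_0_l in E. subst l.
    destruct (le_1_cases b Hb) as [->| ->]; [destruct (lt_0 _ H)|destruct (lt_irrefl _ H)].
Qed.

Lemma double_ge n b : 1 <= n -> n < #2 * n + b.
Proof.
  rewrite le_iff, lt_iff. intros [z ->]. exists (z + b). simpl. ring.
Qed.

Variable T : set M.
Hypothesis T_tree : IsTree T.
Variable eps : num M.
Hypothesis eps_Seq : IsSeq eps.
Hypothesis eps_Len : Len eps 0.

Local Notation legal := (Legal T).
Local Notation attempt := (Attempt T eps).

(** Besides the root, entry [l] has a single condition to meet: it answers one bit at one earlier
    position, since [l = 2n + b] determines [n] and [b], and [n < l]. The answers to entry [l]
    itself would have larger numbers. *)
Lemma Attempt_extend s l e v : attempt s -> Len s l -> Entry s 0 e ->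
  (l = 1 /\ v = eps) \/ (exists n b u, 1 <= n /\ b < #2 /\ l = #2 * n + b
     /\ Entry s n u /\ legal e u b v) ->
  exists t, attempt t /\ (forall i x, Entry s i x -> Entry t i x) /\ Entry t l v
    /\ forall i x, Entry t i x -> Entry s i x \/ (i = l /\ x = v).
Proof.
  intros (Ss & A1 & A2) Hl He Hv.
  destruct (snoc_exists s l v Hl) as (t & St & Lt & HE & Ev).
  assert (Inv : forall i x, Entry t i x -> Entry s i x \/ (i = l /\ x = v)).
  { intros i x Hx. pose proof (Entry_lt Lt Hx) as Hi. apply lt_S in Hi as [Hi| ->].
    - left. destruct (Entry_total s i l Hl Hi) as [y Hy].
      rewrite (Entry_unique Hx (HE _ _ Hy)). exact Hy.
    - right. split; [reflexivity|]. exact (Entry_unique Hx Ev). }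
  exists t. split; [|auto]. split; [exact St|]. split.
  - intros w Hw. destruct (Inv _ _ Hw) as [H|[<- ->]]; [auto|].
    destruct Hv as [[_ H]|(n & b & u & Hn & _ & E & _)]; [exact H|].
    destruct (lt_irrefl n). eapply lt_le_trans; [apply (double_ge n b Hn)|].
    rewrite <- E. exact Hn.
  - intros n b e' u w Hn Hb He' Hu Hw.
    rewrite (Entry_unique He' (HE _ _ He)) in *.
    assert (Hlt : n < l).
    { eapply lt_le_trans; [apply (double_ge n b Hn)|]. apply lt_succ_le.
      exact (Entry_lt Lt Hw). }
    destruct (Inv _ _ Hu) as [Hu'|[-> _]]; [|destruct (lt_irrefl _ Hlt)].
    destruct (Inv _ _ Hw) as [Hw'|[E ->]]; [eapply A2; eassumption|].
    destruct Hv as [[-> _]|(n' & b' & u' & Hn' & Hb' & E' & Hu2 & HL)].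
    + destruct (le_not_lt _ _ Hn Hlt).
    + rewrite E' in E. apply double_inj in E as [-> ->]; try assumption.
      rewrite (Entry_unique Hu' Hu2). exact HL.
Qed.

Lemma Attempt_singleton e : exists s, attempt s /\ Len s 1 /\ Entry s 0 e.
Proof.
  destruct (snoc_exists eps 0 e eps_Len) as (s & Ss & Ls & _ & Es).
  rewrite add_0_l in Ls. exists s. split; [|auto]. split; [exact Ss|]. split.
  - intros v Hv. destruct (lt_irrefl 1). eapply Entry_lt; eassumption.
  - intros n b e' u v Hn Hb _ _ Hv. pose proof (Entry_lt Ls Hv) as H.
    destruct (lt_irrefl n). eapply lt_trans; [apply (double_ge n b Hn)|].
    eapply lt_le_trans; eassumption.
Qed.

Lemma LO_total L i j : IsLO L -> InField i L -> InField j L ->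
  LtIn L i j \/ i = j \/ LtIn L j i.
Proof.
  intros (_ & _ & A & B) Hi Hj. unfold LtIn.
  destruct (classic (⟨i, j⟩ ∈ L)) as [H|H], (classic (⟨j, i⟩ ∈ L)) as [H'|H']; auto.
  destruct (B i j); tauto.
Qed.

Lemma LtIn_trans L i j k : IsLO L -> LtIn L i j -> LtIn L j k -> LtIn L i k.
Proof.
  intros (_ & Tr & A & _) [H1 H2] [H3 H4]. split; [eapply Tr; eauto|].
  intro H. apply H2. eapply Tr. split; [exact H3|exact H].
Qed.

(** [R] ranks, along [L], the positions won by the opponent. *)
Definition Ranking L R : Prop := forall e s j, InField j L ->
  (⟨⟨e, s⟩, j⟩ ∈ R <->
   exists b, b < #2 /\ forall t, legal e s b t -> exists i, LtIn L i j /\ ⟨⟨e, t⟩, i⟩ ∈ R).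

(** The one appeal to transfinite recursion. The formula says that some bit forces every legal
    answer into the part [Z] of the ranking already built below [j]. *)
Lemma Ranking_exists L : IsWO L ->
  exists R, Ranking L R /\ forall q j, ⟨q, j⟩ ∈ R -> InField j L.
Proof.
  intro HL.
  destruct (recursion_Def (fun n Z => exists e s, n = ⟨e, s⟩ /\ exists b, b < #2 /\
    forall t, legal e s b t -> exists i, ⟨⟨e, t⟩, i⟩ ∈ Z) L) as [R HR]; [def|exact HL|].
  exists R. split.
  - intros e s j Hj. rewrite HR. split.
    + intros (n & j' & E & _ & Z & HZ & e' & s' & -> & b & Hb & H).
      apply pair_inj in E as [E <-]. apply pair_inj in E as [<- <-].
      exists b. split; [exact Hb|]. intros t Ht. destruct (H t Ht) as [i Hi].
      apply HZ in Hi as (m & i' & E & Hlt & Hin). apply pair_inj in E as [_ <-].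
      exists i. auto.
    + intros (b & Hb & H).
      destruct (comprehension_Def (fun q => exists m i, q = ⟨m, i⟩ /\ LtIn L i j /\ q ∈ R))
        as [Z HZ]; [unfold LtIn; def|].
      exists ⟨e, s⟩, j. split; [reflexivity|]. split; [exact Hj|]. exists Z. split; [exact HZ|].
      exists e, s. split; [reflexivity|]. exists b. split; [exact Hb|].
      intros t Ht. destruct (H t Ht) as (i & Hlt & Hin). exists i. apply HZ.
      exists ⟨e, t⟩, i. auto.
  - intros q j H. apply HR in H as (n & j' & E & Hj & _).
    apply pair_inj in E as [_ ->]. exact Hj.
Qed.

Variables (S L R : set M).
Hypothesis S_spec : forall s, s ∈ S <-> attempt s.
Hypothesis L_WO : IsWO L.
Hypothesis L_field : forall s, InField s L <-> s ∈ S.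
Hypothesis L_lt : forall s t, LtIn L s t <-> s ∈ S /\ t ∈ S /\ KBlt s t.
Hypothesis R_rank : Ranking L R.
Hypothesis R_field : forall q j, ⟨q, j⟩ ∈ R -> InField j L.

(** Membership at [j] expresses a rank of at most [j]: answers ranked below [i] are ranked below [j]
    by transitivity, with no induction. *)
Lemma rank_mono e s i j : LtIn L i j -> ⟨⟨e, s⟩, i⟩ ∈ R -> ⟨⟨e, s⟩, j⟩ ∈ R.
Proof.
  intros Hij Hi. pose proof Hij as Hj. apply L_lt in Hj as (Si & Sj & _).
  apply R_rank in Hi as (b & Hb & H); [|apply L_field, Si].
  apply R_rank; [apply L_field, Sj|]. exists b. split; [exact Hb|].
  intros t Ht. destruct (H t Ht) as (k & Hk & Hin). exists k. split; [|exact Hin].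
  apply (LtIn_trans L k i j); [apply L_WO|assumption|assumption].
Qed.

(** If the root had no rank, then the least [j] above some attempt [s] that
    avoids the positions of rank [j] could be replaced by [s] itself, after
    extending [s] by one answer. *)
Lemma root_ranked e : exists j, ⟨⟨e, eps⟩, j⟩ ∈ R.
Proof.
  apply NNPP. intro N.
  destruct (WF_minimum L (fun j => exists s, attempt s /\ Entry s 0 e /\
    (forall n u, 1 <= n -> Entry s n u -> ~ ⟨⟨e, u⟩, j⟩ ∈ R) /\ LtIn L s j))
    as (j & (s & As & He & Hs & Hlt) & Hmin).
  - apply L_WO.
  - unfold Attempt, LtIn. def.
  (* The empty string lies above all others in [L]. The attempt naming only [e] contains no position
     yet, so it avoids ranks vacuously. *)
  - destruct (Attempt_singleton e) as (s & As & Ls & Es). exists eps, s.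
    split; [exact As|]. split; [exact Es|]. split.
    + intros n u Hn Hu. destruct (le_not_lt _ _ Hn (Entry_lt Ls Hu)).
    + apply L_lt. rewrite !S_spec. split; [exact As|]. split.
      * split; [exact eps_Seq|]. split; intros; exfalso; eapply Len_0_Entry; eassumption.
      * exists 0. split; [intros i v Hi; destruct (lt_0 _ Hi)|]. exists e.
        split; [exact Es|]. intros v Hv. destruct (Len_0_Entry _ _ _ eps_Len Hv).
  - destruct (Seq_Len s (proj1 As)) as [l Hl].
    pose proof (Entry_lt Hl He) as Hpos.
    (* The next free place [l] is the root, unranked by assumption, or the answer to a position [u]
       without rank [j]. In the latter case some legal answer is unranked at [s]; otherwise [s],
       being below [j], would witness that [u] has rank [j]. *)
    assert (Hv : exists v, ~ ⟨⟨e, v⟩, s⟩ ∈ R /\ ((l = 1 /\ v = eps) \/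
      (exists n b u, 1 <= n /\ b < #2 /\ l = #2 * n + b /\ Entry s n u /\ legal e u b v))).
    { assert (H1 : 1 <= l) by (rewrite <- (add_0_l 1); apply le_succ_lt, Hpos).
      destruct H1 as [H1|<-]; [|exists eps; split; [eauto|auto]].
      destruct (double_cases l H1) as (n & b & Hn & Hb & E).
      assert (Hnl : n < l) by (rewrite E; apply double_ge, Hn).
      destruct (Entry_total s n l Hl Hnl) as [u Hu].
      pose proof Hlt as Hj. apply L_lt in Hj as (_ & Sj & _).
      apply NNPP. intro C. apply (Hs n u Hn Hu). apply R_rank; [apply L_field, Sj|].
      exists b. split; [exact Hb|]. intros v Hv. exists s. split; [exact Hlt|].
      apply NNPP. intro C'. apply C. exists v. split; [exact C'|]. right. exists n, b, u. auto. }
    destruct Hv as (v & Hv & Hcase).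
    destruct (Attempt_extend s l e v As Hl He Hcase) as (t & At & Et & Etl & Inv).
    apply (Hmin s Hlt). exists t. split; [exact At|]. split; [apply Et, He|]. split.
    + intros n u Hn Hu. destruct (Inv _ _ Hu) as [Hu'|[-> ->]]; [|exact Hv].
      intro C. apply (Hs n u Hn Hu'). exact (rank_mono _ _ _ _ Hlt C).
    + apply L_lt. rewrite !S_spec. split; [exact At|]. split; [exact As|].
      exists l. split.
      * intros i x Hi. split; [|apply Et]. intro Hx.
        destruct (Inv _ _ Hx) as [H|[-> _]]; [exact H|destruct (lt_irrefl _ Hi)].
      * exists v. split; [exact Etl|]. intros w Hw.
        destruct (lt_irrefl l). eapply Entry_lt; eassumption.
Qed.

(** The ranks give the opponent a winning strategy, which no path computes. *)
Lemma ranked_not_cofinal : ~ IsCofinal T.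
Proof.
  intro Hcof.
  (* At the least rank [j] of a position, [tau] plays 1 if this forces lower ranks, and 0 otherwise.
     Positions without rank receive 0. *)
  destruct (comprehension_Def (fun q => exists j, ⟨q, j⟩ ∈ R
    /\ (forall i, LtIn L i j -> ~ ⟨q, i⟩ ∈ R)
    /\ exists e s, q = ⟨e, s⟩ /\
         forall t, legal e s 1 t -> exists i, LtIn L i j /\ ⟨⟨e, t⟩, i⟩ ∈ R)) as [tau Htau];
    [unfold LtIn; def|].
  destruct (Hcof tau) as (F & HP & e & He). pose proof (proj1 HP) as HF.
  (* The play along [F] need not be formed as a sequence: among the initial segments of [F] one of
     least rank is taken, and a single further move refutes it. *)
  destruct (WF_minimum L (fun j => exists s, Along F s /\ ⟨⟨e, s⟩, j⟩ ∈ R))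
    as (j & (s & Hs & Hj) & Hmin).
  - apply L_WO.
  - def.
  - destruct (root_ranked e) as [j Hj]. exists j, eps. split; [|exact Hj].
    split; [exact eps_Seq|]. intros i x E. destruct (Len_0_Entry _ _ _ eps_Len E).
  - pose proof (R_field _ _ Hj) as Fj.
    assert (Hq : forall i, LtIn L i j -> ~ ⟨⟨e, s⟩, i⟩ ∈ R).
    { intros i Hi C. apply (Hmin i Hi). exists s. auto. }
    assert (Hb : exists b, b < #2 /\ Computes F e ⟨e, s⟩ b /\
      forall t, legal e s b t -> exists i, LtIn L i j /\ ⟨⟨e, t⟩, i⟩ ∈ R).
    { destruct (He ⟨e, s⟩) as [H1 H0]. destruct (classic (⟨e, s⟩ ∈ tau)) as [Ht|Ht].
      - exists 1. split; [exact one_lt_2|]. split; [apply H1, Ht|].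
        apply Htau in Ht as (j' & Hj' & Mj' & e' & s' & E & H).
        apply pair_inj in E as [<- <-].
        destruct (LO_total L j j' (proj1 L_WO) Fj (R_field _ _ Hj')) as [C|[<-|C]].
        + destruct (Mj' j C Hj).
        + exact H.
        + destruct (Hq j' C Hj').
      (* Some bit forces lower ranks from a ranked position; were it 1, the position would belong to
         [tau]. *)
      - exists 0. split; [exact zero_lt_2|]. split; [apply H0, Ht|].
        pose proof Hj as Hj'. apply R_rank in Hj' as (b & Hb & H); [|exact Fj].
        destruct (le_1_cases b Hb) as [->| ->]; [exact H|].
        destruct Ht. apply Htau. exists j. split; [exact Hj|]. split; [exact Hq|].
        exists e, s. auto. }
    destruct Hb as (b & Hb & HC & H).
    destruct (path_answer T T_tree F e s b HP Hs Hb HC) as (t & Ht & HL).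
    destruct (H t HL) as (i & Hi & Hin). apply (Hmin i Hi). exists t. auto.
Qed.

End Determinacy.

Theorem winning_strategy_exists {M : model} {HM : ATR0_model M} (T : set M) (eps : num M) :
  IsTree T -> IsCofinal T -> IsSeq eps -> Len eps 0 ->
  exists F e, WinningStrategy T eps F e.
Proof.
  intros HT Hcof Heps Hlen. apply NNPP. intro N.
  destruct (comprehension_Def (fun s => Attempt T eps s)) as [S HS]; [unfold Attempt; def|].
  destruct (KB_WO S) as (L & HL & Hfield & Hlt).
  - intros s Hs. apply HS in Hs. apply Hs.
  - intros G HG H. apply N. exists G. apply winning_of_attempts; [exact HG|].
    intro n. destruct (H n) as (s & Hs & E). exists s. split; [apply HS, Hs|exact E].
  - destruct (Ranking_exists T L HL) as (R & HR & HRf).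
    eapply ranked_not_cofinal; eassumption.
Qed.

(** * The pointed subtree *)

Section DefinableFunctions.

Context {M : model} {HM : ATR0_model M}.

Lemma chi_lt (P : Prop) : (chi P : num M) < #2.
Proof.
  destruct (classic P) as [H|H]; [rewrite (chi_true _ H); apply one_lt_2|
    rewrite (chi_false _ H); apply zero_lt_2].
Qed.

(** Turns the set produced by [iteration] into a Rocq function with definable graph, the form that
    the lemmas on [Rec] expect. *)
Lemma primitive_recursion (st : num M -> num M -> num M) a :
  Def 3 (fun c => snd c = st (snd (fst (fst c))) (snd (fst c))) ->
  exists g, g 0 = a /\ (forall k, g (k + 1) = st k (g k)) /\ DefF 1 (fun c => g (snd c)).
Proof.
  intro H. destruct (iteration (fun k x y => y = st k x) a H) as (I & I0 & IS & _).
  assert (U : forall k, exists x, forall y, ⟨k, y⟩ ∈ I <-> y = x).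
  { refine (induction_Def _ _ _ _); [def|exists a; exact I0|].
    intros k [x Hx]. exists (st k x). intro y. rewrite IS. split.
    - intros (x' & Hx' & ->). apply Hx in Hx' as ->. reflexivity.
    - intros ->. exists x. split; [apply Hx|]; reflexivity. }
  exists (fun k => epsilon (inhabits 0) (fun y => ⟨k, y⟩ ∈ I)).
  assert (E : forall k y, y = epsilon (inhabits 0) (fun y => ⟨k, y⟩ ∈ I) <-> ⟨k, y⟩ ∈ I).
  { intros k y. destruct (U k) as [x Hx].
    assert (E : ⟨k, epsilon (inhabits 0) (fun y => ⟨k, y⟩ ∈ I)⟩ ∈ I).
    { apply epsilon_spec. exists x. apply Hx. reflexivity. }
    split; [intros ->; exact E|]. intro Hy. apply Hx in E, Hy. congruence. }
  split; [|split].
  - symmetry. apply E, I0. reflexivity.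
  - intro k. symmetry. apply E, IS. eexists. split; [|reflexivity]. apply E. reflexivity.
  - apply Def_equiv with (fun c => ⟨snd (fst c), snd c⟩ ∈ I); [|def].
    intro c. symmetry. apply E.
Qed.

End DefinableFunctions.

Section Pointed.

Context {M : model} {HM : ATR0_model M}.
Implicit Types x y z n m i j k s t l a b u v q r w : num M.
Add Ring model_ring : (@model_semiring M HM).

Variable T : set M.
Hypothesis T_tree : IsTree T.
Variable eps : num M.
Hypothesis eps_Seq : IsSeq eps.
Hypothesis eps_Len : Len eps 0.
Hypothesis eps_T : eps ∈ T.
Variables (f : set M) (e : num M).
Hypothesis f_win : WinningStrategy T eps f e.

Definition phi n : num M := epsilon (inhabits 0) (fun v => ⟨n, v⟩ ∈ f).

Lemma phi_spec n : ⟨n, phi n⟩ ∈ f.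
Proof. unfold phi. apply epsilon_spec. apply f_win. Qed.

Lemma phi_iff n v : v = phi n <-> ⟨n, v⟩ ∈ f.
Proof.
  split; [intros ->; apply phi_spec|]. intro H.
  exact (IsFun_unique f n _ _ (proj1 f_win) H (phi_spec n)).
Qed.

Lemma DefF_phi p (g : ctx p -> num M) : DefF p g -> DefF p (fun c => phi (g c)).
Proof.
  intro H. pose proof (DefF_weak _ _ H) as H'.
  apply Def_equiv with (fun c => ⟨g (fst c), snd c⟩ ∈ f).
  - intro c. symmetry. apply phi_iff.
  - apply Def_mem; [apply DefF_pair; [exact H'|def]|def_set].
Qed.

#[local] Hint Extern 1 (DefF _ (fun c => phi _)) => apply DefF_phi; def : def_fun.

Lemma phi_1 : phi 1 = eps.
Proof. symmetry. apply phi_iff, f_win. Qed.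

Lemma phi_legal n b : 1 <= n -> b < #2 -> Legal T e (phi n) b (phi (#2 * n + b)).
Proof. intros Hn Hb. apply f_win with n; auto using phi_spec. Qed.

(** A computation on [v] only asks below the length of [v], so it persists on extensions, and [e]
    has at most one value there. Answers to different bits are thus incompatible: this yields the
    branching of the tree and makes the played bits readable from a path. *)
Lemma legal_conflict u b b' v v' :
  Legal T e u b v -> Legal T e u b' v' -> Initial v v' -> b = b'.
Proof.
  intros (_ & _ & _ & k & _ & Hk & _ & HC & _) (_ & _ & _ & k' & _ & _ & _ & HC' & _) H.
  apply (Conv_functional (StringOracle v') k k' e ⟨e, u⟩); [|exact HC'].
  eapply Conv_agree; [|exact HC]. intros x Hx. eapply StringOracle_Initial; eassumption.
Qed.

Lemma legal_Initial u b v : Legal T e u b v -> Initial u v.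
Proof. intros [H _]. exact H. Qed.

Lemma legal_T u b v : Legal T e u b v -> v ∈ T.
Proof. intros (_ & H & _). exact H. Qed.

Lemma legal_Len u b v l k : Legal T e u b v -> Len u l -> Len v k -> l < k.
Proof.
  intros (_ & _ & l' & k' & A & B & C & _) Hl Hk.
  rewrite (Len_unique Hl A), (Len_unique Hk B). exact C.
Qed.

(** A real coding [f] and the relation [Initial]; the tree is built so that
    each of its paths computes [A]. *)
Variable A : set M.
Hypothesis A_f : forall n v, ⟨#0, n, v⟩ ∈ A <-> ⟨n, v⟩ ∈ f.
Hypothesis A_Initial : forall s t, ⟨#1, s, t⟩ ∈ A <-> Initial s t.

Definition alpha k : num M := chi (k ∈ A).

Definition mid k n : num M := #2 * n + alpha k.

(** [⟨k, n⟩ ∈ I]: the node [phi n] is on level [k]; at that level bit [k] of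
    [A] is played first, and then an arbitrary bit. *)
Variable I : set M.
Hypothesis I_0 : forall n, ⟨0, n⟩ ∈ I <-> n = 1.
Hypothesis I_S : forall k m, ⟨k + 1, m⟩ ∈ I <->
  exists n, ⟨k, n⟩ ∈ I /\ exists b, b < #2 /\ m = #2 * mid k n + b.

Lemma alpha_lt k : alpha k < #2.
Proof. apply chi_lt. Qed.

Lemma mid_pos k n : 1 <= n -> 1 <= mid k n.
Proof. intro H. eapply le_trans; [exact H|]. apply lt_le, double_ge, H. Qed.

Lemma I_pos k n : ⟨k, n⟩ ∈ I -> 1 <= n.
Proof.
  revert n. induct k.
  - intros n Hn. apply I_0 in Hn as ->. apply le_refl.
  - intros k IH m Hm. apply I_S in Hm as (n & Hn & b & _ & ->).
    pose proof (mid_pos k n (IH n Hn)) as Hp.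
    eapply le_trans; [exact Hp|]. apply lt_le, double_ge, Hp.
Qed.

Lemma mid_legal k n : 1 <= n -> Legal T e (phi n) (alpha k) (phi (mid k n)).
Proof. intro H. apply phi_legal; [exact H|apply alpha_lt]. Qed.

Lemma child_legal k n b : 1 <= n -> b < #2 ->
  Legal T e (phi (mid k n)) b (phi (#2 * mid k n + b)).
Proof. intros H Hb. apply phi_legal; [apply mid_pos, H|exact Hb]. Qed.

Lemma child_Initial k n b : 1 <= n -> b < #2 -> Initial (phi n) (phi (#2 * mid k n + b)).
Proof.
  intros H Hb. apply Initial_trans with (phi (mid k n)); eapply legal_Initial;
    [apply mid_legal|apply child_legal]; assumption.
Qed.

Lemma node_T k n : ⟨k, n⟩ ∈ I -> phi n ∈ T.
Proof.
  intro H. destruct (zero_or_succ k) as [->|[j ->]].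
  - apply I_0 in H as ->. rewrite phi_1. exact eps_T.
  - apply I_S in H as (m & Hm & b & Hb & ->).
    eapply legal_T, child_legal; [eapply I_pos, Hm|exact Hb].
Qed.

Lemma node_Seq k n : ⟨k, n⟩ ∈ I -> IsSeq (phi n).
Proof. intro H. apply T_tree. eapply node_T, H. Qed.

(** Compatible nodes of one level have the same parent by induction. The bit of [A] played at that
    level is common to all nodes, and the free bit agrees by [legal_conflict]. *)
Lemma node_unique k n n' w : ⟨k, n⟩ ∈ I -> ⟨k, n'⟩ ∈ I ->
  Initial (phi n) w -> Initial (phi n') w -> n = n'.
Proof.
  revert n n'. induct k.
  - intros n n' Hn Hn' _ _. apply I_0 in Hn, Hn'. congruence.
  - intros k IH m m' Hm Hm' Hw Hw'.
    apply I_S in Hm as (n & Hn & b & Hb & ->). apply I_S in Hm' as (n' & Hn' & b' & Hb' & ->).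
    pose proof (I_pos _ _ Hn) as Pn. pose proof (I_pos _ _ Hn') as Pn'.
    assert (n = n') as <-.
    { apply IH; try assumption;
        [eapply Initial_trans; [|exact Hw]|eapply Initial_trans; [|exact Hw']];
        apply child_Initial; assumption. }
    pose proof (child_legal k n b Pn Hb) as L. pose proof (child_legal k n b' Pn Hb') as L'.
    destruct (Initial_comparable _ _ _ Hw Hw') as [C|C].
    + rewrite (legal_conflict _ _ _ _ _ L L' C). reflexivity.
    + rewrite (legal_conflict _ _ _ _ _ L' L C). reflexivity.
Qed.

Lemma node_below j i n : ⟨j + i, n⟩ ∈ I -> exists m, ⟨j, m⟩ ∈ I /\ Initial (phi m) (phi n).
Proof.
  revert n. induct i.
  - intros n Hn. rewrite add_0 in Hn. exists n. split; [exact Hn|].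
    eapply Initial_refl, node_Seq, Hn.
  - intros i IH m Hm. rewrite add_S in Hm. apply I_S in Hm as (n & Hn & b & Hb & ->).
    destruct (IH n Hn) as (p & Hp & Hi). exists p. split; [exact Hp|].
    eapply Initial_trans; [exact Hi|]. apply child_Initial; [eapply I_pos, Hn|exact Hb].
Qed.

Lemma node_above j i n : ⟨j, n⟩ ∈ I -> exists m, ⟨j + i, m⟩ ∈ I /\ Initial (phi n) (phi m).
Proof.
  intro Hn. induct i.
  - exists n. rewrite add_0. split; [exact Hn|]. eapply Initial_refl, node_Seq, Hn.
  - intros i (m & Hm & Hi). exists (#2 * mid (j + i) m + 0).
    split.
    + rewrite add_S. apply I_S. exists m. split; [exact Hm|]. exists 0. auto using zero_lt_2.
    + eapply Initial_trans; [exact Hi|]. apply child_Initial; [eapply I_pos, Hm|exact zero_lt_2].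
Qed.

Lemma node_level_le k n l : ⟨k, n⟩ ∈ I -> Len (phi n) l -> k <= l.
Proof.
  revert n l. induct k.
  - intros n l _ _. apply zero_le.
  - intros k IH m l Hm Hl. apply I_S in Hm as (n & Hn & b & Hb & ->).
    pose proof (I_pos _ _ Hn) as Pn.
    destruct (Seq_Len _ (node_Seq _ _ Hn)) as [l0 Hl0].
    pose proof (mid_legal k n Pn) as L1. pose proof (child_legal k n b Pn Hb) as L2.
    destruct (Seq_Len (phi (mid k n))) as [l1 Hl1]; [eapply Initial_r, legal_Initial, L1|].
    apply le_succ_lt. eapply le_lt_trans; [apply (IH n l0 Hn Hl0)|].
    eapply lt_trans; [exact (legal_Len _ _ _ _ _ L1 Hl0 Hl1)|exact (legal_Len _ _ _ _ _ L2 Hl1 Hl)].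
Qed.

(** A level is finite in the sense of the model: first the numbers of its nodes are bounded, then
    the lengths of the strings with bounded number. Hence a sufficiently long piece of a path passes
    the whole level. *)
Lemma level_bounded k : exists B, forall n l, ⟨k, n⟩ ∈ I -> Len (phi n) l -> l <= B.
Proof.
  assert (H : exists C, forall n, ⟨k, n⟩ ∈ I -> n <= C).
  { induct k.
    - exists 1. intros n Hn. apply I_0 in Hn as ->. apply le_refl.
    - intros k [C HC]. exists (#2 * (#2 * C + #2) + #2). intros m Hm.
      apply I_S in Hm as (n & Hn & b & Hb & ->). unfold mid.
      apply add_le; [apply mul_le; [apply le_refl|]|apply lt_le, Hb].
      apply add_le; [apply mul_le; [apply le_refl|apply HC, Hn]|apply lt_le, alpha_lt]. }
  destruct H as [C HC].
  assert (H : forall C, exists B, forall n l, n <= C -> Len (phi n) l -> l <= B).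
  { refine (induction_Def _ _ _ _).
    - def.
    - exists (phi 0). intros n l Hn Hl. apply le_0 in Hn as ->. apply Len_le, Hl.
    - intros D [B HB]. exists (B + phi (D + 1)). intros n l [Hn| ->] Hl.
      + eapply le_trans; [apply (HB n l)|apply le_add_l]; [apply lt_succ_le, Hn|exact Hl].
      + eapply le_trans; [apply Len_le, Hl|apply le_add_r]. }
  destruct (H C) as [B HB]. exists B. intros n l Hn Hl. apply (HB n l); auto.
Qed.

Variable S : set M.
Hypothesis S_spec : forall t, t ∈ S <-> exists k n, ⟨k, n⟩ ∈ I /\ Initial t (phi n).

Lemma S_Subset : Subset S T.
Proof.
  intros t Ht. apply S_spec in Ht as (k & n & Hn & Ht). apply T_tree with (phi n).
  split; [eapply node_T, Hn|exact Ht].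
Qed.

Lemma S_Tree : IsTree S.
Proof.
  split.
  - intros s Hs. apply T_tree, S_Subset, Hs.
  - intros s t [Hs Ht]. apply S_spec in Hs as (k & n & Hn & Hs). apply S_spec.
    exists k, n. split; [exact Hn|]. eapply Initial_trans; eassumption.
Qed.

Lemma S_Perfect : IsPerfect S.
Proof.
  split; [exact S_Tree|]. split.
  - exists eps. apply S_spec. exists 0, 1. split; [apply I_0; reflexivity|].
    rewrite phi_1. apply Initial_refl, eps_Seq.
  - intros s Hs. apply S_spec in Hs as (k & n & Hn & Hs). pose proof (I_pos _ _ Hn) as Pn.
    assert (HS : forall b, b < #2 -> phi (#2 * mid k n + b) ∈ S
       /\ Initial s (phi (#2 * mid k n + b))).
    { intros b Hb. pose proof (child_Initial k n b Pn Hb) as C. split.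
      - apply S_spec. exists (k + 1), (#2 * mid k n + b). split.
        + apply I_S. exists n. split; [exact Hn|]. exists b. auto.
        + apply Initial_refl. eapply Initial_r, C.
      - eapply Initial_trans; eassumption. }
    pose proof (child_legal k n 0 Pn zero_lt_2) as L0. pose proof (child_legal k n 1 Pn one_lt_2) as L1.
    exists (phi (#2 * mid k n + 0)), (phi (#2 * mid k n + 1)).
    split; [apply HS, zero_lt_2|]. split; [apply HS, one_lt_2|].
    split; [apply HS, zero_lt_2|]. split; [apply HS, one_lt_2|]. split; intro C.
    + apply one_neq_zero. symmetry. exact (legal_conflict _ _ _ _ _ L0 L1 C).
    + apply one_neq_zero. exact (legal_conflict _ _ _ _ _ L1 L0 C).
Qed.

Definition comparable s t : Prop := Initial s t \/ Initial t s.

Lemma S_level t k : t ∈ S -> exists n, ⟨k, n⟩ ∈ I /\ comparable (phi n) t.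
Proof.
  intro Ht. apply S_spec in Ht as (j & m & Hm & Ht). destruct (le_or_lt k j) as [H|H].
  - apply le_iff in H as [i ->]. destruct (node_below k i m Hm) as (n & Hn & Hi).
    exists n. split; [exact Hn|]. exact (Initial_comparable _ _ _ Hi Ht).
  - apply lt_le, le_iff in H as [i ->]. destruct (node_above j i m Hm) as (n & Hn & Hi).
    exists n. split; [exact Hn|]. right. eapply Initial_trans; eassumption.
Qed.

(** ** Following a string of the tree *)

Section Descent.

Variable t : num M.

(** Goes to child 0 if it is compatible with [t] and to child 1 otherwise. The descent makes sense
    for every [t]; whether [t] belongs to the tree is tested only at the end, in [descent_spec]. *)
Definition step k x : num M :=
  #2 * mid k x + chi (~ comparable (phi (#2 * mid k x)) t).

Variable g : num M -> num M.
Hypothesis g_0 : g 0 = 1.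
Hypothesis g_S : forall k, g (k + 1) = step k (g k).
Hypothesis g_Def : DefF 1 (fun c => g (snd c)).

Lemma DefF_g p (h : ctx p -> num M) : DefF p h -> DefF p (fun c => g (h c)).
Proof.
  intro H. pose proof (DefF_weak _ _ H) as H'.
  destruct (comprehension2 (fun k x => x = g k) g_Def) as (X & HX & _).
  apply Def_equiv with (fun c => ⟨h (fst c), snd c⟩ ∈ X).
  - intro c. apply HX.
  - apply Def_mem; [apply DefF_pair; [exact H'|def]|def_set].
Qed.

#[local] Hint Extern 1 (DefF _ (fun c => g _)) => apply DefF_g; def : def_fun.

Lemma descent_node k : ⟨k, g k⟩ ∈ I.
Proof.
  induct k.
  - apply I_0, g_0.
  - intros k IH. apply I_S. exists (g k). split; [exact IH|]. eexists. split; [|apply g_S].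
    apply chi_lt.
Qed.

Lemma descent_comparable k : t ∈ S -> comparable (phi (g k)) t.
Proof.
  intro Ht. assert (St : IsSeq t) by (apply S_Tree, Ht).
  revert k. refine (induction_Def _ _ _ _).
  - unfold comparable. def.
  - left. rewrite g_0, phi_1. apply empty_Initial; assumption.
  - intros k IH. rewrite g_S. unfold step. pose proof (descent_node k) as Hk.
    pose proof (I_pos _ _ Hk) as Pk.
    destruct (classic (comparable (phi (#2 * mid k (g k))) t)) as [C|C].
    + rewrite chi_false by tauto. rewrite add_0. exact C.
    + rewrite chi_true by exact C.
      destruct (S_level t (k + 1) Ht) as (m & Hm & Cm).
      apply I_S in Hm as (n & Hn & b & Hb & ->). pose proof (I_pos _ _ Hn) as Pn.
      pose proof (child_Initial k n b Pn Hb) as Hi.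
      (* The node reached must lie below [t]: if it extended [t], child 0 would extend [t] too,
         against [C]. This forces the compatible node at level [k + 1] to be a child of [g k], and
         not child 0. *)
      assert (Hgt : Initial (phi (g k)) t).
      { destruct IH as [H|H]; [exact H|]. destruct C. right.
        eapply Initial_trans; [exact H|].
        pose proof (child_Initial k (g k) 0 Pk zero_lt_2) as H'. rewrite add_0 in H'. exact H'. }
      assert (n = g k) as ->.
      { destruct Cm as [Cm|Cm].
        - apply (node_unique k _ _ t); try assumption. eapply Initial_trans; eassumption.
        - apply (node_unique k _ _ (phi (#2 * mid k n + b))); try assumption.
          eapply Initial_trans; eassumption. }
      destruct (le_1_cases b Hb) as [->| ->]; [|exact Cm].
      rewrite add_0 in Cm. contradiction.
Qed.

(** The code [t] itself is a sufficient level: the length of [t] is at most [t], and a node at level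
    [t] has at least that length. A comparable node there already extends [t]. *)
Lemma descent_spec : t ∈ S <-> Initial t (phi (g t)).
Proof.
  split.
  - intro Ht. destruct (descent_comparable t Ht) as [C|C]; [|exact C].
    assert (St : IsSeq t) by (apply S_Tree, Ht). destruct (Seq_Len t St) as [l Hl].
    pose proof (descent_node t) as Hn. destruct (Seq_Len _ (node_Seq _ _ Hn)) as [k Hk].
    rewrite (Initial_eq _ _ _ _ C Hk Hl); [apply Initial_refl, St|].
    eapply le_trans; [apply Len_le, Hl|]. exact (node_level_le _ _ _ Hn Hk).
  - intro H. apply S_spec. exists t, (g t). split; [apply descent_node|exact H].
Qed.

End Descent.

Lemma Def_step t : Def 3 (fun c => snd c = step t (snd (fst (fst c))) (snd (fst c))).
Proof.
  unfold step, comparable, mid, alpha. def.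
Qed.

(** [delta t k]: the node of level [k] towards [t]. *)
Definition delta t : num M -> num M :=
  epsilon (inhabits (fun x => x)) (fun g => g 0 = 1 /\ (forall k, g (k + 1) = step t k (g k))
    /\ DefF 1 (fun c => g (snd c))).

Lemma delta_spec t : delta t 0 = 1 /\ (forall k, delta t (k + 1) = step t k (delta t k))
  /\ DefF 1 (fun c => delta t (snd c)).
Proof. unfold delta. apply epsilon_spec, primitive_recursion, Def_step. Qed.

(** ** Paths compute the tree *)

Variable F : set M.
Hypothesis F_path : IsPath F S.

Lemma path_fun : IsFun F.
Proof. apply F_path. Qed.

(** The initial segment of [F] of length [B] is comparable with a node of level [k]. Should the node
    be the longer of the two, the bound on its length makes them equal. *)
Lemma path_level k : exists n, ⟨k, n⟩ ∈ I /\ Along F (phi n).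
Proof.
  destruct (level_bounded k) as [B HB]. destruct F_path as [_ HP].
  destruct (HP B) as (t & Ht & Hl & HE). assert (At : Along F t) by (split; [apply S_Tree, Ht|exact HE]).
  destruct (S_level t k Ht) as (n & Hn & [C|C]); exists n; (split; [exact Hn|]).
  - eapply Initial_Along; eassumption.
  - destruct (Seq_Len _ (node_Seq _ _ Hn)) as [l Hl'].
    rewrite <- (Initial_eq _ _ _ _ C Hl Hl' (HB n l Hn Hl')). exact At.
Qed.

Lemma path_level_unique k n n' : ⟨k, n⟩ ∈ I -> ⟨k, n'⟩ ∈ I ->
  Along F (phi n) -> Along F (phi n') -> n = n'.
Proof.
  intros Hn Hn' A1 A2. destruct (Seq_Len _ (proj1 A1)) as [l Hl].
  destruct (Seq_Len _ (proj1 A2)) as [l' Hl'].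
  destruct (Along_exists F (l + l') path_fun) as (w & Aw & Hw).
  apply (node_unique k n n' w Hn Hn').
  - exact (Along_Initial _ _ _ _ _ path_fun A1 Aw Hl Hw (le_add_l _ _)).
  - exact (Along_Initial _ _ _ _ _ path_fun A2 Aw Hl' Hw (le_add_r _ _)).
Qed.

Definition index k : num M :=
  epsilon (inhabits 0) (fun n => ⟨k, n⟩ ∈ I /\ Along F (phi n)).

Lemma index_spec k : ⟨k, index k⟩ ∈ I /\ Along F (phi (index k)).
Proof. unfold index. apply epsilon_spec, path_level. Qed.

Lemma index_step k : exists b, b < #2 /\ index (k + 1) = #2 * mid k (index k) + b
  /\ Along F (phi (mid k (index k))).
Proof.
  destruct (index_spec (k + 1)) as [H HA]. apply I_S in H as (n & Hn & b & Hb & E).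
  pose proof (I_pos _ _ Hn) as Pn. destruct (index_spec k) as [Hk HkA].
  rewrite E in HA.
  assert (n = index k) as <-.
  { apply (path_level_unique k); try assumption.
    eapply Initial_Along; [apply (child_Initial k n b); assumption|exact HA]. }
  exists b. split; [exact Hb|]. split; [exact E|].
  eapply Initial_Along; [eapply legal_Initial, child_legal; eassumption|exact HA].
Qed.

Lemma DefF_node : DefF 1 (fun c => phi (index (snd c))).
Proof.
  apply Def_equiv with (fun c => exists n, ⟨snd (fst c), n⟩ ∈ I /\ Along F (phi n) /\ snd c = phi n).
  - intro c. destruct (index_spec (snd (fst c))) as [H H']. split.
    + intros (n & Hn & HA & ->). f_equal. apply (path_level_unique (snd (fst c))); assumption.
    + intros ->. exists (index (snd (fst c))). auto.
  - def.
Qed.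

(** A path finds the answer to a position on it as its own first segment that
    decides the next bit. *)
Lemma Rec_answer {C} (enc U V : C -> num M) :
  (forall c, exists b, b < #2 /\ Legal T e (U c) b (V c) /\ Along F (V c)) ->
  Rec F enc U -> Rec F enc V.
Proof.
  intros H HU.
  set (K c := epsilon (inhabits 0) (fun k => Len (V c) k)).
  assert (HK : forall c, Len (V c) (K c)).
  { intro c. unfold K. apply epsilon_spec. destruct (H c) as (b & _ & _ & HA).
    apply Seq_Len, HA. }
  (* Convergence to 0 or to 1 is searched for, since the path does not know in advance which bit was
     played. Every clause is decidable from [F], so the length of the answer is found by
     minimisation. *)
  set (P c n := exists l, Len (U c) l /\ l < n /\ exists d, d < n /\
     Valid (fun z => z ∈ F) d /\ exists i, Entry d i ⟨e, ⟨e, U c⟩, 0⟩ \/ Entry d i ⟨e, ⟨e, U c⟩, 1⟩).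
  assert (P_iff : forall c n, P c n <-> exists l, Len (U c) l /\ l < n /\ exists b, b < #2 /\
     Conv (fun z => z ∈ F) n e ⟨e, U c⟩ b).
  { intros c n. unfold P, Conv, Member. split.
    - intros (l & Hl & Hln & d & Hd & HV & i & [Hi|Hi]); exists l; (split; [exact Hl|]);
        (split; [exact Hln|]); [exists 0|exists 1];
        (split; [exact zero_lt_2 || exact one_lt_2|]); eauto.
    - intros (l & Hl & Hln & b & Hb & d & Hd & HV & i & Hi). exists l. split; [exact Hl|].
      split; [exact Hln|]. exists d. split; [exact Hd|]. split; [exact HV|]. exists i.
      destruct (le_1_cases b Hb) as [->| ->]; auto. }
  assert (RK : Rec F enc K).
  { apply (Rec_mu F enc K P).
    - unfold P. apply (RecP_ex F _ (fun p => U (fst p))); [rec| |].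
      2: { intros p l [Hl _]. apply Len_le, Hl. }
      apply RecP_and; [rec|]. apply RecP_and; [rec|].
      apply (RecP_ex F _ (fun p => snd (fst p))); [rec| |rec_bound].
      apply RecP_and; [rec|]. apply RecP_and; [apply RecP_Valid; rec|].
      apply (RecP_ex F _ (fun p => snd p)); [rec|rec|].
      intros p i [Hi|Hi]; apply lt_le, (Entry_index_lt _ _ _ Hi).
    - intro c. destruct (H c) as (b & Hb & (HI & _ & l & k & Hl & Hk & Hlk & HC & HN) & HA).
      rewrite (Len_unique Hk (HK c)) in *.
      assert (Agree : forall m, m <= K c -> forall x, x < m ->
        (StringOracle (V c) x <-> x ∈ F)).
      { intros m Hm x Hx. apply (StringOracle_Along F (V c) (K c)); auto using path_fun.
        eapply lt_le_trans; eassumption. }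
      split.
      + apply P_iff. exists l. split; [exact Hl|]. split; [exact Hlk|]. exists b.
        split; [exact Hb|]. eapply Conv_agree; [apply (Agree _ (le_refl _))|exact HC].
      + intros n Hn HP. apply P_iff in HP as (l' & Hl' & Hln & b' & Hb' & HC').
        rewrite (Len_unique Hl' Hl) in Hln.
        apply (HN n b' Hln Hn Hb'). eapply Conv_agree; [|exact HC'].
        intros x Hx. symmetry. exact (Agree n (lt_le _ _ Hn) x Hx). }
  (* Once its length is known, the answer is the least code of that length agreeing with [F];
     minimality is part of being canonical in [IsSeq]. *)
  apply (Rec_mu F enc V (fun c s => Len s (K c) /\
    forall i, i < K c -> exists v, Entry s i v /\ ⟨i, v⟩ ∈ F)).
  - apply RecP_and; [rec|]. apply (RecP_all_lt F _ (fun p => K (fst p))); [rec|].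
    apply (RecP_ex F _ (fun p => snd (fst p))); [rec|rec|].
    intros p v [Hv _]. apply (Entry_le _ _ _ Hv).
  - intro c. destruct (H c) as (b & _ & _ & HA). split.
    + split; [apply HK|]. intros i Hi.
      destruct (Entry_total _ _ _ (HK c) Hi) as [v Hv]. exists v. split; [exact Hv|].
      apply HA, Hv.
    + intros s Hs [Hl HE]. destruct HA as [HV HA]. apply HV. exists s. split; [exact Hs|].
      apply SameSeq_sym. apply (SameSeq_intro s (V c) (K c) Hl (HK c)).
      intros i x Hx. destruct (HE i (Entry_lt Hl Hx)) as (v & Hv & HvF).
      rewrite (Entry_unique Hx Hv).
      apply (Along_Entry F _ (K c)); [exact path_fun|split; assumption|apply HK| |exact HvF].
      eapply Entry_lt; eassumption.
Qed.

(** Two searches by [Rec_answer] per level, one for the bit of [A] and one for the free bit. The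
    recursion carries the string [phi (index k)] and not its number, so neither [A] nor the strategy
    is consulted. *)
Lemma Rec_node {C} (enc h : C -> num M) : Rec F enc h -> Rec F enc (fun c => phi (index (h c))).
Proof.
  apply (Rec_prim_at F enc h (fun _ k => phi (index k))).
  - eapply Rec_ext; [|apply (Rec_const F enc eps)]. intro c.
    destruct (index_spec 0) as [H _]. apply I_0 in H as ->. symmetry. apply phi_1.
  - apply (Rec_answer _ (fun p => phi (mid (snd p) (index (snd p))))).
    + intros [c k]. simpl. destruct (index_step k) as (b & Hb & E & _).
      exists b. split; [exact Hb|]. rewrite E. split.
      * apply child_legal; [eapply I_pos, index_spec|exact Hb].
      * rewrite <- E. apply index_spec.
    + apply (Rec_answer _ (fun p => phi (index (snd p)))); [|apply Rec_step_value].
      intros [c k]. simpl. destruct (index_step k) as (b & _ & _ & HA).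
      exists (alpha k). split; [apply alpha_lt|]. split; [|exact HA].
      apply mid_legal. eapply I_pos, index_spec.
  - intros _. exact DefF_node.
Qed.

(** The path passes through the answer to bit [k] of [A] at its node of level [k], so running [e] on
    that node returns the bit. *)
Lemma RecP_A {C} (enc h : C -> num M) : Rec F enc h -> RecP F enc (fun c => h c ∈ A).
Proof.
  intro H. apply (Rec_comp F enc (fun c => ⟨e, phi (index (h c))⟩)).
  - apply Rec_pair; [apply Rec_const|apply Rec_node, H].
  - exists e. intro c. destruct (index_step (h c)) as (b & _ & _ & HA).
    pose proof (mid_legal (h c) (index (h c)) (I_pos _ _ (proj1 (index_spec (h c))))) as L.
    destruct L as (_ & _ & l & k & _ & Hk & _ & HC & _).
    apply (Conv_Comp _ k). eapply Conv_agree; [|exact HC].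
    intros x Hx. eapply StringOracle_Along; eauto using path_fun.
Qed.

Lemma Rec_phi {C} (enc h : C -> num M) : Rec F enc h -> Rec F enc (fun c => phi (h c)).
Proof.
  intro H. apply (Rec_mu F enc _ (fun c v => ⟨#0, h c, v⟩ ∈ A)).
  - apply RecP_A. rec.
  - intro c. split; [apply A_f, phi_spec|]. intros z Hz HzA. apply A_f, phi_iff in HzA.
    rewrite HzA in Hz. destruct (lt_irrefl _ Hz).
Qed.

Lemma RecP_Initial {C} (enc g h : C -> num M) : Rec F enc g -> Rec F enc h ->
  RecP F enc (fun c => Initial (g c) (h c)).
Proof.
  intros Hg Hh. apply RecP_ext with (fun c => ⟨#1, g c, h c⟩ ∈ A); [intro c; apply A_Initial|].
  apply RecP_A. rec.
Qed.

Lemma Rec_delta {C} (enc g h : C -> num M) : Rec F enc g -> Rec F enc h ->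
  Rec F enc (fun c => delta (g c) (h c)).
Proof.
  intros Hg. apply (Rec_prim_at F enc h (fun c k => delta (g c) k)).
  - eapply Rec_ext; [|apply (Rec_const F enc 1)]. intro c. symmetry. apply delta_spec.
  - eapply Rec_ext; [intro p; symmetry; apply delta_spec|]. unfold step.
    assert (Hmid : Rec F (fun p : C * num M => ⟨enc (fst p), snd p, delta (g (fst p)) (snd p)⟩)
      (fun p => #2 * mid (snd p) (delta (g (fst p)) (snd p)))).
    { unfold mid. apply Rec_mul; [apply Rec_const|]. apply Rec_add.
      - apply Rec_mul; [apply Rec_const|apply Rec_step_value].
      - apply RecP_A, Rec_step_index. }
    assert (Hg' : Rec F (fun p : C * num M => ⟨enc (fst p), snd p, delta (g (fst p)) (snd p)⟩)
      (fun p => g (fst p))) by apply Rec_step_arg, Hg.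
    apply Rec_add; [exact Hmid|]. apply RecP_not, RecP_or; apply RecP_Initial;
      try exact Hg'; apply Rec_phi, Hmid.
  - intro c. apply delta_spec.
Qed.

(** By [descent_spec] the tree is recursive in [A], which the path has already recovered. *)
Lemma path_computes_tree : LeT S F.
Proof.
  assert (H : RecP F (fun t => t) (fun t => Initial t (phi (delta t t)))).
  { apply RecP_Initial; [apply Rec_id|]. apply Rec_phi, Rec_delta; apply Rec_id. }
  destruct H as [e' He']. exists e'. intro t. specialize (He' t).
  destruct (delta_spec t) as (d0 & dS & dD).
  pose proof (descent_spec t (delta t) d0 dS dD) as E.
  split; intro Ht; rewrite E in Ht.
  - rewrite (chi_true _ Ht) in He'. exact He'.
  - rewrite (chi_false _ Ht) in He'. exact He'.
Qed.

End Pointed.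

Theorem pointed_subtree {M : model} {HM : ATR0_model M} (T : set M) :
  IsTree T -> IsCofinal T -> exists S, Subset S T /\ IsPointed S.
Proof.
  intros HT Hcof. destruct empty_exists as (eps & Seps & Leps).
  destruct (winning_strategy_exists T eps HT Hcof Seps Leps) as (f & e & Hf).
  assert (Teps : eps ∈ T).
  { destruct (Hcof T) as (F & [_ HP] & _). destruct (HP 0) as (s & Hs & Ls & _).
    replace eps with s; [exact Hs|]. apply (Seq_ext s eps 0); auto; [apply HT, Hs|].
    intros i x E. destruct (Len_0_Entry _ _ _ Ls E). }
  (* The tags 0 and 1 keep the two relations apart. With [Initial] in the coded real, strings can be
     compared by queries to [A], without an algorithm for this relation. *)
  destruct (comprehension_Def (fun q => (exists n v, q = ⟨#0, n, v⟩ /\ ⟨n, v⟩ ∈ f)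
    \/ exists s t, q = ⟨#1, s, t⟩ /\ Initial s t)) as [A HA]; [def|].
  assert (A_f : forall n v, ⟨#0, n, v⟩ ∈ A <-> ⟨n, v⟩ ∈ f).
  { intros n v. rewrite HA. split; [|eauto].
    intros [(n' & v' & E & H)|(s & t & E & _)]; apply pair_inj in E as [E0 E].
    - apply pair_inj in E as [-> ->]. exact H.
    - apply numeral_inj in E0. discriminate E0. }
  assert (A_I : forall s t, ⟨#1, s, t⟩ ∈ A <-> Initial s t).
  { intros s t. rewrite HA. split; [|eauto].
    intros [(n' & v' & E & _)|(s' & t' & E & H)]; apply pair_inj in E as [E0 E].
    - apply numeral_inj in E0. discriminate E0.
    - apply pair_inj in E as [-> ->]. exact H. }
  (* Here the iterated relation is two-valued: the free bit [b] produces both children of a node. *)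
  destruct (iteration (fun k n m => exists b, b < #2 /\ m = #2 * mid A k n + b) 1)
    as (I & I0 & IS & _); [unfold mid, alpha; def|].
  destruct (comprehension_Def (fun t => exists k n, ⟨k, n⟩ ∈ I /\ Initial t (phi f n)))
    as [S HS].
  { pose proof (DefF_phi T eps f e Hf) as D. def. }
  exists S. split; [eapply S_Subset; eassumption|]. split; [eapply S_Perfect; eassumption|].
  intros F HF. eapply path_computes_tree; eassumption.
Qed.

Theorem theorem5p6 : ATR0 ⊢ MPT.
Proof.
  apply completeness. intros M HM rho xi. apply sat_MPT.
  intros T [HT Hcof]. pose proof (ATR0_model_of_models M rho xi HM) as HM'.
  exact (pointed_subtree T HT Hcof).
Qed.
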